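(* Let $\mathbb{K}$ be a local field, let $V$ be a finite-dimensional $\mathbb{K}$-vector space equipped with a norm $\|\cdot\|$, and let $\mu$ be a probability measure on $\mathrm{Asim}(V)$ satisfying: (i) (moment condition) $\displaystyle\int\bigl(\log^+c(g)+\log^+\|b(g)\|\bigr)\,d\mu(g)<\infty$; (ii) (affine non-degeneracy) there is no $v\in V$ fixed by all $g\in\mathrm{supp}\,\mu$; (iii) (centered ratio) $\displaystyle\int\log c(g)\,d\mu(g)=0$; (iv) (non-trivial ratio) $\mu\{g:\ c(g)=1\}<1$. Let $L_n:=X_n\cdots X_1$ be the associated left random walk, where $X_1,X_2,\dots$ are independent random variables of law $\mu$. Then for every compact $U\subset V$ and every $x,y\in V$, $$\|L_nx-L_ny\|\,\mathbf{1}_{\{L_nx\in U\}}\longrightarrow 0\qquad\text{almost surely as } n\to\infty.$$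
   Context: A local field means $\mathbb{R}$, $\mathbb{C}$, a finite extension of $\mathbb{Q}_p$ for some prime $p$, or a finite extension of a field of formal Laurent series $\mathbf{F}_q((T))$ over a finite field $\mathbf{F}_q$. The group of linear similarities of $V$ is $\mathrm{Sim}_{\mathrm{lin}}(V):=\{T\in \mathrm{GL}(V): \exists\, c(T)>0,\ \|Tx\|=c(T)\|x\|\ \ \forall x\in V\}$. The group of affine similarities is $\mathrm{Asim}(V):=V\rtimes \mathrm{Sim}_{\mathrm{lin}}(V)$, whose elements $g=(b,T)$ act on $V$ by $x\mapsto Tx+b$, with group law $(b,T)(b',T')=(b+Tb',TT')$ and its natural topology. For $g=(b,T)$ write $b(g)=b$ and $c(g)=c(T)$. $\log^+ t=\max(\log t,0)$, with $\log^+0=0$. *)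

(* Defs.v *)
From HB Require Import structures.
From mathcomp Require Import all_boot all_order all_algebra all_field.
From mathcomp Require Import all_classical all_reals all_analysis.
From mathcomp Require Import complex.
Set Implicit Arguments.
Unset Strict Implicit.
Unset Printing Implicit Defensive.
Import Order.TTheory GRing.Theory Num.Theory.
Import numFieldNormedType.Exports.
Local Open Scope classical_set_scope.
Local Open Scope ring_scope.

(* The norm of [Num.NormedZmodule] satisfies [`|x *+ n| = `|x| *+ n], which
   fails over a non-archimedean field; hence the two structures below. *)
HB.mixin Record Field_hasAbs (R : realType) K of GRing.Field K := {
  absv : K -> R;
  absv_ge0 : forall x, 0 <= absv x;
  absv_eq0 : forall x, (absv x == 0) = (x == 0);
  absvM : {morph absv : x y / x * y};
  absvD : forall x y, absv (x + y) <= absv x + absv y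
}.

#[short(type="absFieldType")]
HB.structure Definition AbsField (R : realType) :=
  {K of GRing.Field K & Field_hasAbs R K}.

HB.mixin Record Vector_isNormed (R : realType) (K : absFieldType R) V
    of Vector K V := {
  vnorm : V -> R;
  vnorm_eq0 : forall x, (vnorm x == 0) = (x == 0);
  vnormZ : forall (a : K) x, vnorm (a *: x) = absv a * vnorm x;
  vnormD : forall x y, vnorm (x + y) <= vnorm x + vnorm y
}.

#[short(type="normedVectType")]
HB.structure Definition NormedVect (R : realType) (K : absFieldType R) :=
  {V of Vector K V & Vector_isNormed R K V}.

Section local_field.
Variable R : realType.

Definition abs_complete (F : absFieldType R) :=
  forall u : nat -> F,
    (forall e : R, 0 < e -> exists N, forall m n, (N <= m)%N -> (N <= n)%N ->
       absv (u m - u n) < e) ->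
    exists l : F, absv (u n - l) @[n --> \oo] --> (0 : R).

(* [F] is the completion of [rat] for a [p]-adic absolute value. The value [r]
   of [absv p] is left free in ]0, 1[, so that every normalization is covered. *)
Definition is_padic_field (p : nat) (F : absFieldType R) :=
  [/\ prime p,
      exists2 r : R, 0 < r < 1 &
        forall n : nat, (0 < n)%N -> absv (n%:R : F) = r ^+ logn p n,
      forall (x : F) (e : R), 0 < e -> exists q : rat, absv (x - ratr q) < e &
      abs_complete F].

(* [F] is the field of formal Laurent series in one variable [T] over [k]:
   [coef x n] is the coefficient of [T ^ n] in [x], and the absolute value of a
   series of valuation [n] is [r ^ n], for a free normalization [r = absv T].
   The convolution sum has finite support. *)
Definition is_laurent_field (k : finFieldType) (F : absFieldType R) :=
  exists coef : F -> int -> k,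
  [/\ injective coef,
      range coef = [set u | exists N : int, forall n : int, n < N -> u n = 0],
      forall x y n, coef (x + y) n = coef x n + coef y n,
      forall x y n,
        coef (x * y) n = \sum_(i \in [set: int]) coef x i * coef y (n - i) &
      exists2 r : R, 0 < r < 1 &
        forall x (n : int), coef x n != 0 ->
          (forall m : int, m < n -> coef x m = 0) -> absv x = r ^ n].

Definition finite_extension (F K : absFieldType R) :=
  exists (L : fieldExtType F) (f : {rmorphism L -> K}),
    bijective f /\ forall a : F, absv (f a%:A) = absv a.

Definition local_field (K : absFieldType R) :=
  [\/ exists f : {rmorphism R -> K},
        bijective f /\ forall x, absv (f x) = `|x|,
      exists f : {rmorphism R[i] -> K},
        bijective f /\ forall z, absv (f z) = Normc.normc z,
      exists (p : nat) (F : absFieldType R),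
        is_padic_field p F /\ finite_extension F K |
      exists (k : finFieldType) (F : absFieldType R),
        is_laurent_field k F /\ finite_extension F K].

End local_field.

Section norm_topology.
Variables (R : realType) (K : absFieldType R) (V : normedVectType K).
Implicit Types x y z : V.

Lemma absv1 : absv (1 : K) = 1.
Proof.
have n1 : absv (1 : K) != 0 by rewrite absv_eq0 oner_eq0.
by apply: (mulfI n1); rewrite -absvM !mulr1.
Qed.

Lemma absvN1 : absv (-1 : K) = 1.
Proof.
apply/eqP; rewrite -(@pexpr_eq1 _ _ 2) ?absv_ge0//.
by rewrite expr2 -absvM mulrNN mulr1 absv1.
Qed.

Lemma vnorm0 : vnorm (0 : V) = 0.
Proof. by apply/eqP; rewrite vnorm_eq0. Qed.

Lemma vnormN x : vnorm (- x) = vnorm x.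
Proof. by rewrite -scaleN1r vnormZ absvN1 mul1r. Qed.

Lemma vnorm_ge0 x : 0 <= vnorm x.
Proof.
have := vnormD x (- x); rewrite subrr vnorm0 vnormN -mulr2n.
by rewrite pmulrn_lge0.
Qed.

Definition vdist x y : R := vnorm (x - y).

Lemma vdistxx x : vdist x x = 0.
Proof. by rewrite /vdist subrr vnorm0. Qed.

Lemma vdist_eq0 x y : vdist x y = 0 -> x = y.
Proof. by move=> /eqP; rewrite vnorm_eq0 subr_eq0 => /eqP. Qed.

Lemma vdist_sym x y : vdist x y = vdist y x.
Proof. by rewrite /vdist -vnormN opprB. Qed.

Lemma vdist_triangle y x z : vdist x z <= vdist x y + vdist y z.
Proof. by rewrite /vdist -(subrKA y) vnormD. Qed.

HB.instance Definition _ := isMetric.Build R (NormedVect.sort V)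
  vdistxx vdist_eq0 vdist_sym vdist_triangle.

End norm_topology.

Section similarities.
Variables (R : realType) (K : absFieldType R) (V : normedVectType K).
Implicit Types (A B T : 'End(V)) (x y : V) (c : R).

Definition similarity_ratio T c :=
  0 < c /\ forall x, vnorm (T x) = c * vnorm x.

Definition is_similarity T := bijective T /\ exists c, similarity_ratio T c.

Definition sim_lin : {pred 'End(V)} := fun T => `[< is_similarity T >].

(* The ratio is unique unless [V] is the zero space. *)
Definition sim_ratio T : R := xget 1 (similarity_ratio T).

Definition opnorm A : R :=
  inf [set c | 0 <= c /\ forall x, vnorm (A x) <= c * vnorm x].

Record asim := Asim {
  trans : V;
  lin : 'End(V);
  lin_sim : lin \in sim_lin
}.

Implicit Types g h : asim.

Definition aact g x : V := lin g x + trans g.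

Lemma asimP g h : trans g = trans h -> lin g = lin h -> g = h.
Proof.
case: g h => [b T sT] [b' T' sT'] /= eb eT; subst b' T'.
by rewrite (bool_irrelevance sT sT').
Qed.

Definition bounded_lfun A := exists2 c, 0 <= c &
  forall x, vnorm (A x) <= c * vnorm x.

Lemma opnorm_le A c : 0 <= c -> (forall x, vnorm (A x) <= c * vnorm x) ->
  opnorm A <= c.
Proof.
move=> c0 Ac; apply: ge_inf; last by split.
by exists 0 => d [].
Qed.

Lemma opnorm_ge0 A : bounded_lfun A -> 0 <= opnorm A.
Proof.
move=> [c c0 Ac]; apply: lb_le_inf; first by exists c; split.
by move=> d [].
Qed.

Lemma le_opnorm A x : bounded_lfun A -> vnorm (A x) <= opnorm A * vnorm x.
Proof.
move=> [c c0 Ac]; have [->|x0] := eqVneq x 0.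
  by rewrite linear0 vnorm0 mulr0.
have nx0 : 0 < vnorm x by rewrite lt_neqAle eq_sym vnorm_eq0 x0 vnorm_ge0.
rewrite -ler_pdivrMr//; apply: lb_le_inf; first by exists c; split.
by move=> d [_ Ad]; rewrite ler_pdivrMr.
Qed.

Lemma sim_linP g : is_similarity (lin g).
Proof. by apply/asboolP; have := lin_sim g. Qed.

Lemma bounded_asimB g h : bounded_lfun (lin g - lin h).
Proof.
have [[_ [c [c0 gc]]] [_ [d [d0 hd]]]] := (sim_linP g, sim_linP h).
exists (c + d); first by rewrite addr_ge0 ?ltW.
move=> x; rewrite add_lfunE opp_lfunE (le_trans (vnormD _ _))//.
by rewrite vnormN gc hd mulrDl.
Qed.

HB.instance Definition _ := gen_eqMixin asim.
HB.instance Definition _ := gen_choiceMixin asim.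

(* [asim] carries the topology induced by [V * 'End(V)]. *)
Definition asim_dist g h : R :=
  vnorm (trans g - trans h) + opnorm (lin g - lin h).

Lemma asim_distxx g : asim_dist g g = 0.
Proof.
rewrite /asim_dist !subrr vnorm0 add0r; apply/eqP; rewrite eq_le.
have b0 : bounded_lfun 0 by rewrite -(subrr (lin g)); exact: bounded_asimB.
rewrite opnorm_ge0// andbT; apply: opnorm_le => // x.
by rewrite zero_lfunE vnorm0 mul0r.
Qed.

Lemma asim_dist_eq0 g h : asim_dist g h = 0 -> g = h.
Proof.
have b := bounded_asimB g h.
move=> /eqP; rewrite /asim_dist paddr_eq0 ?vnorm_ge0 ?opnorm_ge0//.
rewrite vnorm_eq0 subr_eq0 => /andP[/eqP tE /eqP oE].
apply: asimP => //; apply/lfunP => x; apply/eqP.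
have := le_opnorm x b; rewrite oE mul0r add_lfunE opp_lfunE => le0.
by rewrite -subr_eq0 -vnorm_eq0 eq_le le0 vnorm_ge0.
Qed.

Lemma opnormN A : opnorm (- A) = opnorm A.
Proof.
rewrite /opnorm; congr inf; apply/seteqP.
by split=> c [c0 Ac]; split=> // x; have := Ac x; rewrite opp_lfunE vnormN.
Qed.

Lemma asim_dist_sym g h : asim_dist g h = asim_dist h g.
Proof. by rewrite /asim_dist -vnormN -opnormN !opprB. Qed.

Lemma asim_dist_triangle h g k :
  asim_dist g k <= asim_dist g h + asim_dist h k.
Proof.
have bgh := bounded_asimB g h; have bhk := bounded_asimB h k.
rewrite /asim_dist addrACA lerD//.
  by rewrite -(subrKA (trans h)) vnormD.
apply: opnorm_le => [|x]; first by rewrite addr_ge0 ?opnorm_ge0.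
rewrite -(subrKA (lin h)) add_lfunE (le_trans (vnormD _ _))// mulrDl.
by rewrite lerD// le_opnorm.
Qed.

HB.instance Definition _ := isMetric.Build R asim
  asim_distxx asim_dist_eq0 asim_dist_sym asim_dist_triangle.

Lemma sim_lin1 : \1%VF \in sim_lin.
Proof.
apply/asboolP; split; first by exists id => x; rewrite id_lfunE.
by exists 1; split => // x; rewrite id_lfunE mul1r.
Qed.

Lemma sim_linM T T' : T \in sim_lin -> T' \in sim_lin -> (T \o T')%VF \in sim_lin.
Proof.
move=> /asboolP[bT [c [c0 cT]]] /asboolP[bT' [d [d0 dT']]].
apply/asboolP; split.
  by apply: (eq_bij (bij_comp bT bT')) => x; rewrite comp_lfunE.
by exists (c * d); split => [|x]; rewrite ?mulr_gt0// comp_lfunE cT dT' mulrA.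
Qed.

Lemma sim_lin_ker T : T \in sim_lin -> lker T == 0%VS.
Proof. by move=> /asboolP[/bij_inj iT _]; apply/lker0P. Qed.

Lemma sim_linV T : T \in sim_lin -> (T^-1)%VF \in sim_lin.
Proof.
move=> sT; have kT := sim_lin_ker sT.
move: (sT) => /asboolP[_ [c [c0 cT]]]; apply/asboolP; split.
  by exists T; [exact: lker0_lfunVK|exact: lker0_lfunK].
exists c^-1; split=> [|x]; first by rewrite invr_gt0.
by rewrite -[in RHS](lker0_lfunVK kT x) cT mulKf// gt_eqF.
Qed.

Definition asim1 : asim := Asim 0 sim_lin1.

Definition asimM g h : asim :=
  Asim (trans g + lin g (trans h)) (sim_linM (lin_sim g) (lin_sim h)).

Definition asimV g : asim :=
  Asim (- (lin g)^-1%VF (trans g)) (sim_linV (lin_sim g)).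

Lemma asimMA : associative asimM.
Proof.
move=> g h k; apply: asimP => /=; last by rewrite comp_lfunA.
by rewrite linearD comp_lfunE addrA.
Qed.

Lemma asim1M : left_id asim1 asimM.
Proof.
by move=> g; apply: asimP => /=; rewrite ?comp_lfun1l// add0r id_lfunE.
Qed.

Lemma asimM1 : right_id asim1 asimM.
Proof.
by move=> g; apply: asimP => /=; rewrite ?comp_lfun1r// linear0 addr0.
Qed.

Lemma asimVM : left_inverse asim1 asimV asimM.
Proof.
move=> g; have kg := sim_lin_ker (lin_sim g).
by apply: asimP => /=; rewrite ?addNr// lker0_compVf.
Qed.

Lemma asimMV : right_inverse asim1 asimV asimM.
Proof.
move=> g; have kg := sim_lin_ker (lin_sim g).
by apply: asimP => /=; rewrite ?lker0_compfV// linearN /= lker0_lfunVK// subrr.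
Qed.

HB.instance Definition _ := isGroup.Build asim
  asimMA asim1M asimM1 asimVM asimMV.

HB.instance Definition _ := isPointed.Build asim asim1.

Definition borel_asim : set (set asim) := <<s @open asim >>.

Lemma borel_asimC (A : set asim) : borel_asim A -> borel_asim (~` A).
Proof. by move=> mA; rewrite -setTD; exact: sigma_algebraCD. Qed.

HB.instance Definition _ := @isMeasurable.Build default_measure_display asim
  borel_asim (@sigma_algebra0 _ setT (@open asim)) borel_asimC
  (@sigma_algebra_bigcup _ setT (@open asim)).

Definition msupport (mu : probability asim R) : set asim :=
  [set g | forall U, open U -> U g -> (0 < mu U)%E].

(* [L_n = X_n ... X_1], with [X_(i+1)] encoded as [X i]. *)
Fixpoint left_walk (X : nat -> asim) (n : nat) : asim :=
  if n is m.+1 then (X m * left_walk X m)%g else 1%g.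

End similarities.

Definition logp (R : realType) (t : R) : R := Num.max (ln t) 0.

Definition mutually_independent (R : realType)
    (d : measure_display) (Omega : measurableType d) (P : probability Omega R)
    (d' : measure_display) (S : measurableType d')
    (X : nat -> {mfun Omega >-> S}) :=
  forall (J : seq nat) (A : nat -> set S), uniq J ->
    (forall i, measurable (A i)) ->
    P (\bigcap_(i in [set` J]) (X i @^-1` A i)) =
    (\prod_(i <- J) P (X i @^-1` A i))%E.

Definition has_law (R : realType)
    (d : measure_display) (Omega : measurableType d) (P : probability Omega R)
    (d' : measure_display) (S : measurableType d')
    (X : {mfun Omega >-> S}) (mu : probability S R) :=
  forall A, measurable A -> distribution P X A = mu A.

(* Main.v *)
Require Import Defs.
From HB Require Import structures.
From mathcomp Require Import all_boot all_order all_algebra all_field.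
From mathcomp Require Import all_classical all_reals all_analysis.
From mathcomp Require Import measurable_realfun complex ring lra.
Set Implicit Arguments.
Unset Strict Implicit.
Unset Printing Implicit Defensive.
Import Order.TTheory GRing.Theory Num.Theory.
Import numFieldNormedType.Exports.
Local Open Scope classical_set_scope.
Local Open Scope ring_scope.

(** Let [x_n] be the walk from [x], [S_n] the sum of the logarithms of the ratios
of the first [n] steps, and [Z] the logarithmic height above a ball [B] that
contains [U].  Since [|L_n x - L_n y| = exp (S_n) * |x - y|], it is enough to show
that for each [M] almost surely [x_n] is in [B] with [- M <= S_n] only finitely
often.

The proof is a Lyapunov function argument for the Markov chain [(x_n, s + S_n)].
We construct a function [Phi] with values in [0, 1] such that
- the chain composed with [Phi] is a supermartingale as long as [Phi < 1], and it
  loses a fixed amount at each visit to the points [(z, s)] with [z] in [B] and [s]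
  bounded below;
- [Phi (x, s)] tends to 0 as [s] tends to minus infinity, for each [x].
The total loss is at most [Phi (x, s)], hence (lemma [transient]) infinitely many
such visits have probability at most [Phi (x, s)].  The event does not depend on
[s], and letting [s] go to minus infinity shows that it is null.

Away from [B] the height moves as [S_n] does, up to small errors, so [A = Z - s] is
almost constant there, while on [B] it is [- s].  Thus the chain has two regimes.
- On [B], the function [V (2 ^ (j+1) - A)] is a martingale as long as
  [A <= 2 ^ (j+1)], where [V] is the positive harmonic function of the centred walk
  [S_n] killed below 0 ([V_harmonic]).  It is localized by a cutoff
  [chi (A / 2 ^ j)]; the errors made in this way are beaten by the gain of a
  function [l] which lives on [B] and decreases there on average
  ([exit_function]): from no point does the walk remain in [B] with probability
  close to 1, because no point is fixed by all the maps.
- Outside [B], errors come from steps whose translation part is comparable to the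
  current point, and from returns to [B].  They occur near the height [q] of the
  translation part, and are paid for by subtracting from [V] a subharmonic function
  of the height with a prescribed source of the right size at each height
  ([subharmonic_exists] and [wpot_src]).

The function [Phi] is the minimum of 1 and of the sum over the scales [j], with
weights [mass j = E (min 1 ((Y / 2 ^ j) ^ 2))], where [Y] bounds the size of a
step ([barrier]).  The series of the [2 ^ j * mass j] converges as soon as [Y] is
integrable ([mass_sum]), which gives the decay of [Phi], and truncation errors at
scale [j] are of order [mass j * E (Y * min 1 (Y / 2 ^ j))], which is negligible
with respect to [mass j]; this is how a first moment suffices.  The two
one-step estimates are [far_step] and [ball_step], and [barrier_exists] collects
the result; the geometric input is in [one_step_drop], [one_step_enter] and
[displacement]. *)

(** * Expectations of real functions *)
Lemma eq_ler (R : realType) (x y : R) : x = y -> x <= y.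
Proof. by move=> ->. Qed.

Lemma measurable_le_set d (T : measurableType d) (R : realType) (f g : T -> R) :
  measurable_fun [set: T] f -> measurable_fun [set: T] g ->
  measurable [set w | f w <= g w].
Proof.
by move=> mf mg; rewrite -[X in measurable X]setTI; apply: measurable_fun_ler.
Qed.

Lemma measurable_lt_set d (T : measurableType d) (R : realType) (f g : T -> R) :
  measurable_fun [set: T] f -> measurable_fun [set: T] g ->
  measurable [set w | f w < g w].
Proof.
by move=> mf mg; rewrite -[X in measurable X]setTI; apply: measurable_fun_ltr.
Qed.

Section expectation.
Context (d : measure_display) (T : measurableType d) (R : realType).
Variable P : probability T R.
Implicit Types f g : T -> R.

Definition itg f := P.-integrable [set: T] (EFin \o f).
Definition Ex f : R := \int[P]_x f x.

Lemma itg_meas f : itg f -> measurable_fun [set: T] f.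
Proof. by move=> /measurable_int/measurable_EFinP. Qed.

Lemma itg_cst (c : R) : itg (fun=> c).
Proof. exact: finite_measure_integrable_cst. Qed.

Lemma itg_le f g : measurable_fun [set: T] f -> itg g ->
  (forall x, `|f x| <= g x) -> itg f.
Proof.
move=> mf ig fg; apply: (le_integrable measurableT _ _ ig).
  exact/measurable_EFinP.
move=> x _ /=; rewrite lee_fin (le_trans (fg x))// ler_norm//.
Qed.

Lemma itg_bnd f (c : R) : measurable_fun [set: T] f ->
  (forall x, `|f x| <= c) -> itg f.
Proof. by move=> mf; exact: itg_le (itg_cst c). Qed.

Lemma itgD f g : itg f -> itg g -> itg (fun x => f x + g x).
Proof. by move=> hf hg; exact: (integrableD measurableT hf hg). Qed.

Lemma itgB f g : itg f -> itg g -> itg (fun x => f x - g x).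
Proof. by move=> hf hg; exact: (integrableB measurableT hf hg). Qed.

Lemma itgZ (c : R) f : itg f -> itg (fun x => c * f x).
Proof. by move=> hf; exact: (integrableZl measurableT c hf). Qed.

Lemma itg_norm f : itg f -> itg (fun x => `|f x|).
Proof. by move=> hf; exact: (integrable_abse hf). Qed.

Lemma Ex_cst c : Ex (fun=> c) = c.
Proof.
rewrite /Ex Rintegral_cst// -[RHS]mulr1; congr (_ * _).
by rewrite -[RHS]/(fine 1%E); congr fine; exact: probability_setT.
Qed.

Lemma ExD f g : itg f -> itg g -> Ex (fun x => f x + g x) = Ex f + Ex g.
Proof. by move=> hf hg; rewrite /Ex RintegralD. Qed.

Lemma ExB f g : itg f -> itg g -> Ex (fun x => f x - g x) = Ex f - Ex g.
Proof. by move=> hf hg; rewrite /Ex RintegralB. Qed.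

Lemma ExZ (c : R) f : itg f -> Ex (fun x => c * f x) = c * Ex f.
Proof. by move=> hf; rewrite /Ex RintegralZl. Qed.

Lemma Ex_le f g : itg f -> itg g -> (forall x, f x <= g x) -> Ex f <= Ex g.
Proof. by move=> hf hg fg; apply: le_Rintegral. Qed.

Lemma Ex_ge0 f : (forall x, 0 <= f x) -> 0 <= Ex f.
Proof. by move=> f0; apply: Rintegral_ge0. Qed.

Lemma eq_Ex f g : f =1 g -> Ex f = Ex g.
Proof. by move=> fg; apply: eq_Rintegral => x _; exact: fg. Qed.

Lemma ExE f : itg f -> (\int[P]_x (f x)%:E)%E = (Ex f)%:E.
Proof.
by move=> hf; rewrite /Ex /Rintegral fineK//; exact: integrable_fin_num.
Qed.

Lemma itg_sum (n : nat) (f : nat -> T -> R) : (forall i, itg (f i)) ->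
  itg (fun x => \sum_(i < n) f i x).
Proof.
move=> hf; elim: n => [|n IH].
  by under eq_fun do rewrite big_ord0; exact: itg_cst.
by under eq_fun do rewrite big_ord_recr/=; exact: itgD.
Qed.

Lemma Ex_sum (n : nat) (f : nat -> T -> R) : (forall i, itg (f i)) ->
  Ex (fun x => \sum_(i < n) f i x) = \sum_(i < n) Ex (f i).
Proof.
move=> hf; elim: n => [|n IH].
  by under eq_Ex do rewrite big_ord0; rewrite Ex_cst big_ord0.
under eq_Ex do rewrite big_ord_recr/=.
by rewrite ExD//; [rewrite IH big_ord_recr | exact: itg_sum].
Qed.

(** Dominated convergence, for real valued expectations. *)
Lemma Ex_dct (u : nat -> T -> R) f g :
  (forall n, measurable_fun [set: T] (u n)) -> measurable_fun [set: T] f ->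
  (forall x, u n x @[n --> \oo] --> f x) -> itg g ->
  (forall n x, `|u n x| <= g x) ->
  Ex (u n) @[n --> \oo] --> Ex f.
Proof.
move=> mu mf uf ig ug.
have iu n : itg (u n) by exact: itg_le ig (ug n).
have fg x : `|f x| <= g x.
  have h : `|u n x| @[n --> \oo] --> `|f x| by exact: cvg_norm.
  rewrite -(cvg_lim _ h)//; apply: limr_le; first by apply/cvg_ex; exists `|f x|.
  exact: nearW.
have jf : itg f by exact: itg_le ig fg.
have [] := @dominated_convergence _ _ _ P setT measurableT
  (fun n x => (u n x)%:E) (EFin \o f) (EFin \o g).
- by move=> n; exact/measurable_EFinP.
- exact/measurable_EFinP.
- by apply: nearW => x _; exact/cvg_EFin/uf/nearW.
- exact: ig.
- by apply: nearW => x n _ /=; rewrite lee_fin.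
move=> _ _ h.
move: h; rewrite (ExE jf).
have -> : [sequence (\int[P]_x (u n x)%:E)%E]_n = fun n => (Ex (u n))%:E.
  by apply/funext => n /=; rewrite ExE.
by move=> /fine_cvgP[].
Qed.

Lemma Ex_indic (A : set T) : measurable A -> Ex (\1_A) = fine (P A).
Proof.
by move=> mA; rewrite /Ex /Rintegral integral_indic// setIT.
Qed.

Lemma itg_indic (A : set T) : measurable A -> itg (\1_A).
Proof.
move=> mA; apply: (@itg_bnd _ 1); first exact: measurable_indic.
by move=> x; rewrite indicE; case: (x \in A); rewrite ?normr1 ?normr0.
Qed.

(** It tends to 0 as [c] grows, for integrable [Y]: a form of uniform
integrability that replaces second moments below. *)
Definition trunc_mean (Y : T -> R) (c : R) : R :=
  Ex (fun w => Y w * Num.min 1 (Y w / c)).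

Lemma itg_trunc (Y : T -> R) (c : R) : (forall w, 0 <= Y w) -> itg Y -> 0 < c ->
  itg (fun w => Y w * Num.min 1 (Y w / c)).
Proof.
move=> Y0 iY c0; have mY := itg_meas iY; apply: itg_le iY _.
  apply: measurable_funM => //; apply: measurable_minr => //.
  by apply: measurable_funM => //.
move=> w; have h : 0 <= Y w / c by rewrite divr_ge0// ltW.
by rewrite ger0_norm ?mulr_ge0 ?le_min ?ler01// ler_piMr// ge_min lexx.
Qed.

Lemma trunc_mean_ge0 (Y : T -> R) (c : R) : (forall w, 0 <= Y w) -> 0 <= c ->
  0 <= trunc_mean Y c.
Proof.
move=> Y0 c0; apply: Ex_ge0 => w.
by rewrite mulr_ge0// le_min ler01 divr_ge0.
Qed.

Lemma trunc_mean_decr (Y : T -> R) (b c : R) : (forall w, 0 <= Y w) -> itg Y ->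
  0 < b -> b <= c -> trunc_mean Y c <= trunc_mean Y b.
Proof.
move=> Y0 iY b0 bc; have c0 := lt_le_trans b0 bc.
apply: Ex_le; [exact: itg_trunc|exact: itg_trunc|] => w.
rewrite ler_wpM2l// le_min !ge_min lexx/= ler_wpM2l// ?orbT//.
by rewrite lef_pV2.
Qed.

Lemma trunc_mean_cvg (Y : T -> R) : (forall w, 0 <= Y w) -> itg Y ->
  trunc_mean Y n.+1%:R @[n --> \oo] --> (0 : R).
Proof.
move=> Y0 iY; have mY := itg_meas iY.
rewrite -(Ex_cst 0); apply: (@Ex_dct _ _ Y) => //.
- by move=> n; exact: itg_meas (itg_trunc Y0 iY _).
- move=> w; rewrite -(mulr0 (Y w)); apply: cvgMr.
  have h : Y w / n.+1%:R @[n --> \oo] --> (0 : R).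
    by rewrite -(mulr0 (Y w)); apply: cvgMr; exact: cvg_harmonic.
  apply: (@squeeze_cvgr _ _ _ _ (fun=> 0) (fun n => Y w / n.+1%:R)) => //.
    by apply: nearW => n; rewrite le_min ler01 divr_ge0//= ge_min lexx orbT.
  exact: cvg_cst.
- move=> n w; have h : 0 <= Y w / n.+1%:R by rewrite divr_ge0.
  by rewrite ger0_norm ?mulr_ge0 ?le_min ?ler01// ler_piMr// ge_min lexx.
Qed.

Lemma trunc_mean_small (Y : T -> R) (e : R) : (forall w, 0 <= Y w) -> itg Y ->
  0 < e -> exists2 c, 0 < c & forall b, c <= b -> trunc_mean Y b <= e.
Proof.
move=> Y0 iY e0; have /cvgrPdist_le/(_ _ e0)[N _ hN] := trunc_mean_cvg Y0 iY.
exists N.+1%:R => // b Nb; apply: (le_trans (trunc_mean_decr Y0 iY _ Nb)) => //.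
have := hN N (leqnn _); rewrite /= sub0r normrN ger0_norm//.
exact: trunc_mean_ge0.
Qed.

End expectation.

(** * The harmonic function of a centred walk killed below zero *)
Section renewal_function.
Context (d : measure_display) (T : measurableType d) (R : realType).
Variables (P : probability T R) (X : T -> R) (a p : R).
Hypotheses (iX : itg P X) (EX0 : Ex P X = 0) (a0 : 0 < a) (p0 : 0 < p).
Hypothesis Xa : p <= Ex P (\1_[set w | a <= X w]).
Local Notation E := (Ex P).
Local Notation itg := (itg P).
Implicit Types (f : R -> R) (z : R) (n : nat).

Lemma mX : measurable_fun [set: T] X. Proof. exact: itg_meas iX. Qed.

Lemma meas_homo f z : {homo f : x y / x <= y} ->
  measurable_fun [set: T] (fun w => f (z + X w)).
Proof.
move=> hf; apply: (@measurableT_comp _ _ _ _ _ _ f _ (fun w => z + X w)).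
  by apply: nondecreasing_measurable => // x y _ _; exact: hf.
by apply: measurable_funD => //; exact: mX.
Qed.

Lemma itg_homo f z c : {homo f : x y / x <= y} -> (forall x, 0 <= f x <= c) ->
  itg (fun w => f (z + X w)).
Proof.
move=> hf fc; apply: (@itg_bnd _ _ _ _ _ c); first exact: meas_homo.
by move=> w; have /andP[? ?] := fc (z + X w); rewrite ger0_norm.
Qed.

(** The renewal function of the descending ladder process, obtained by iterating
[V |-> 1 + E V (z + X) - E V (X)] on the half line: the [n]-th term is the increment
from the [n]-th iterate to the next one. *)
Fixpoint vterm n z : R :=
  if n is m.+1 then
    (if 0 <= z then E (fun w => vterm m (z + X w)) - E (fun w => vterm m (0 + X w))
     else 0)
  else (0 <= z)%R%:R.

(** The last bound says that the iterates at [z] grow by at most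
[1 - E V_n (X)], since each increment is the expectation of the previous one minus
its value at 0; it keeps [E V_n (X)] below 1. *)
Lemma vterm_spec n : [/\ {homo vterm n : x y / x <= y},
  forall z, 0 <= vterm n z,
  forall z, z < 0 -> vterm n z = 0 &
  forall z, vterm n z <= 1 - \sum_(k < n) E (fun w => vterm k (0 + X w))].
Proof.
elim: n => [|n [hm h0 hz hB]].
  split=> /= [x y xy|z|z z0|z]; rewrite ?big_ord0 ?subr0 ?lern1 ?leq_b1//.
    by rewrite ler_nat; case: (lerP 0 x) => // x0; rewrite (le_trans x0 xy).
  by rewrite leNgt z0.
have iv z : itg (fun w => vterm n (z + X w)).
  apply: (@itg_homo _ z (1 - \sum_(k < n) E (fun w => vterm k (0 + X w))) hm).
  by move=> x; rewrite h0 hB.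
have hE y : E (fun w => vterm n (y + X w)) <=
    1 - \sum_(k < n) E (fun w => vterm k (0 + X w)).
  by rewrite -[leRHS](Ex_cst P) Ex_le//; exact: itg_cst.
split=> /= [x y xy|z|z z0|z].
- case: ifPn => [x0|_].
    rewrite (le_trans x0 xy) lerB// Ex_le// => w.
    by apply: hm; rewrite lerD2r.
  case: ifPn => // y0.
  by rewrite subr_ge0 Ex_le// => w; apply: hm; rewrite lerD2r.
- by case: ifPn => // z0; rewrite subr_ge0 Ex_le// => w; apply: hm; rewrite lerD2r.
- by rewrite leNgt z0.
- rewrite big_ord_recr/= opprD addrA.
  case: ifPn => // z0; first by rewrite lerB.
  by rewrite subr_ge0.
Qed.

Lemma vterm_homo n : {homo vterm n : x y / x <= y}.
Proof. by case: (vterm_spec n). Qed.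

Lemma vterm_ge0 n z : 0 <= vterm n z.
Proof. by case: (vterm_spec n). Qed.

Lemma vterm_neg n z : z < 0 -> vterm n z = 0.
Proof. by case: (vterm_spec n) => _ _ + _; exact. Qed.

Lemma itg_vterm n z : itg (fun w => vterm n (z + X w)).
Proof.
have [h1 h2 h3 h4] := vterm_spec n.
apply: (@itg_homo _ z (1 - \sum_(k < n) E (fun w => vterm k (0 + X w))) h1).
by move=> x; rewrite h2 h4.
Qed.

Definition Vsum N z := \sum_(i < N) vterm i z.

Lemma Vsum_homo N : {homo Vsum N : x y / x <= y}.
Proof. by move=> x y xy; apply: ler_sum => i _; exact: vterm_homo. Qed.

Lemma Vsum_ge0 N z : 0 <= Vsum N z.
Proof. by apply: sumr_ge0 => i _; exact: vterm_ge0. Qed.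

Lemma Vsum_neg N z : z < 0 -> Vsum N z = 0.
Proof. by move=> z0; rewrite /Vsum big1// => i _; exact: vterm_neg. Qed.

Lemma itg_Vsum N z : itg (fun w => Vsum N (z + X w)).
Proof. by apply: (@itg_sum _ _ _ P N (fun i w => vterm i (z + X w))) => i; exact: itg_vterm. Qed.

Lemma VsumS N z : 0 <= z ->
  Vsum N.+1 z = 1 + E (fun w => Vsum N (z + X w)) - E (fun w => Vsum N (0 + X w)).
Proof.
move=> z0; rewrite /Vsum big_ord_recl/= z0 -addrA; congr (_ + _).
rewrite !(@Ex_sum _ _ _ P N (fun i w => vterm i (_ + X w))); try by move=> i; exact: itg_vterm.
by rewrite -sumrB; apply: eq_bigr => i _; rewrite add0n.
Qed.

Lemma Vsum_le N z : Vsum N z <= Vsum N.+1 z.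
Proof. by rewrite /Vsum big_ord_recr/= lerDl vterm_ge0. Qed.

Lemma EVsum_le1 N : E (fun w => Vsum N (0 + X w)) <= 1.
Proof.
rewrite (@Ex_sum _ _ _ P N (fun i w => vterm i (0 + X w))); last by move=> i; exact: itg_vterm.
have [_ h0 _ h] := vterm_spec N; rewrite -subr_ge0.
exact: le_trans (h0 0) (h 0).
Qed.

(** Subadditivity passes from one iterate to the next because the killed part of
the walk from [y + l] stays below [l]. *)
Lemma Vsum_subadd N y l : 0 <= y -> 0 <= l ->
  Vsum N (y + l) <= Vsum N y + Vsum N l.
Proof.
elim: N y => [|N IH] y y0 l0; first by rewrite /Vsum !big_ord0 addr0.
rewrite !VsumS ?addr_ge0//.
have h : E (fun w => Vsum N (y + l + X w)) <=
   E (fun w => Vsum N (y + X w)) + Vsum N l.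
  rewrite -(Ex_cst P (Vsum N l)) -ExD; [|exact: itg_Vsum|exact: itg_cst].
  apply: Ex_le; [exact: itg_Vsum| |].
    by apply: itgD; [exact: itg_Vsum|exact: itg_cst].
  move=> w; have [yX|yX] := leP 0 (y + X w).
    by rewrite addrAC IH.
  rewrite (Vsum_neg _ yX) add0r; apply: Vsum_homo.
  by rewrite addrAC -[leRHS]add0r lerD2r ltW.
have := Vsum_le N l; rewrite VsumS//; lra.
Qed.

Lemma mXa : measurable [set w | a <= X w].
Proof.
apply: measurable_le_set => //.
exact: mX.
Qed.

(** A step of size at least [a] has probability at least [p], and
[E V_n (X) <= 1]. *)
Lemma Vsum_a N : Vsum N a <= p^-1.
Proof.
rewrite -[leRHS]mul1r ler_pdivlMr// (le_trans _ (EVsum_le1 N))//.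
apply: (@le_trans _ _ (E (fun w => Vsum N a * \1_[set w | a <= X w] w))).
  rewrite ExZ; first by rewrite ler_wpM2l// Vsum_ge0.
  by apply: itg_indic; exact: mXa.
apply: Ex_le; [|exact: itg_Vsum|].
  by apply: itgZ; apply: itg_indic; exact: mXa.
move=> w; rewrite indicE; case: (boolP (w \in _)) => [|_].
  by rewrite inE/= mulr1 add0r => /Vsum_homo; exact.
by rewrite mulr0 Vsum_ge0.
Qed.

Lemma Vsum_an N k : Vsum N (a *+ k.+1) <= p^-1 *+ k.+1.
Proof.
elim: k => [|k IH]; first exact: Vsum_a.
rewrite [a *+ _]mulrS [p^-1 *+ _]mulrS.
apply: (le_trans (Vsum_subadd _ _ _)); rewrite ?mulrn_wge0 ?(ltW a0)//.
by rewrite lerD// Vsum_a.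
Qed.

Definition Vcst := p^-1 * (1 + a^-1).

Lemma Vcst_gt0 : 0 < Vcst.
Proof. by rewrite mulr_gt0 ?invr_gt0// addr_gt0// invr_gt0. Qed.

Lemma Vsum_linear N z : 0 <= z -> Vsum N z <= Vcst * (1 + z).
Proof.
move=> z0; have za : 0 <= z / a by rewrite divr_ge0// ltW.
have := truncn_itv za => /andP[kz zk].
apply: (@le_trans _ _ (Vsum N (a *+ (Num.truncn (z / a)).+1))).
  apply: Vsum_homo; rewrite -[leLHS](divfK (lt0r_neq0 a0)) -mulr_natl.
  by rewrite ler_pM2r// ltW.
apply: (le_trans (Vsum_an _ _)).
rewrite -mulr_natl /Vcst mulrC -mulrA ler_pM2l ?invr_gt0//.
rewrite -natr1 [leRHS]mulrDr mulrDl mul1r mulr1 -!addrA.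
move: kz; set k := _%:R => kz.
have : 0 <= a^-1 by rewrite invr_ge0 ltW.
have : z / a = a^-1 * z by rewrite mulrC.
lra.
Qed.

Lemma Vsum_le_homo z : {homo Vsum ^~ z : m n / (m <= n)%N >-> m <= n}.
Proof.
move=> m n mn; rewrite -(subnK mn); elim: (n - m)%N => [|k IH]; first by [].
by rewrite addSn (le_trans IH)// Vsum_le.
Qed.

Definition Vf z : R := limn (Vsum ^~ z).

Lemma Vsum_ubound N z : Vsum N z <= Vcst * (1 + `|z|).
Proof.
have [z0|z0] := leP 0 z; first by rewrite ger0_norm// Vsum_linear.
by rewrite Vsum_neg// mulr_ge0 ?addr_ge0// ltW// Vcst_gt0.
Qed.

Lemma Vsum_cvg z : Vsum ^~ z @ \oo --> Vf z.
Proof.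
apply: nondecreasing_is_cvgn; first exact: Vsum_le_homo.
by exists (Vcst * (1 + `|z|)) => _ [N _ <-]; exact: Vsum_ubound.
Qed.

Lemma Vsum_le_V N z : Vsum N z <= Vf z.
Proof.
apply: nondecreasing_cvgn_le; first exact: Vsum_le_homo.
by apply/cvg_ex; exists (Vf z); exact: Vsum_cvg.
Qed.

Lemma V_le z c : (forall N, Vsum N z <= c) -> Vf z <= c.
Proof.
move=> h; apply: limr_le; last exact: nearW.
by apply/cvg_ex; exists (Vf z); exact: Vsum_cvg.
Qed.

Lemma V_homo : {homo Vf : x y / x <= y}.
Proof.
move=> x y xy; apply: V_le => N.
by rewrite (le_trans _ (Vsum_le_V N y))// Vsum_homo.
Qed.

Lemma V_ge0 z : 0 <= Vf z.
Proof. exact: le_trans (Vsum_ge0 0 z) (Vsum_le_V 0 z). Qed.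

Lemma V_neg z : z < 0 -> Vf z = 0.
Proof.
by move=> z0; apply/eqP; rewrite eq_le V_ge0 andbT; apply: V_le => N; rewrite Vsum_neg.
Qed.

Lemma V_ge1 z : 0 <= z -> 1 <= Vf z.
Proof.
move=> z0; apply: le_trans (Vsum_le_V 1 z).
by rewrite /Vsum big_ord_recl big_ord0/= z0 addr0.
Qed.

Lemma V_linear z : 0 <= z -> Vf z <= Vcst * (1 + z).
Proof. by move=> z0; apply: V_le => N; exact: Vsum_linear. Qed.

Lemma V_ubound z : Vf z <= Vcst * (1 + `|z|).
Proof. by apply: V_le => N; exact: Vsum_ubound. Qed.

Lemma V_subadd y l : 0 <= l -> Vf (y + l) <= Vf y + Vf l.
Proof.
move=> l0; have [y0|y0] := leP 0 y; last first.
  by rewrite (V_neg y0) add0r V_homo// -[leRHS]add0r lerD2r ltW.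
apply: V_le => N; apply: (le_trans (Vsum_subadd _ y0 l0)).
by rewrite lerD// Vsum_le_V.
Qed.

Lemma itg_lin z : itg (fun w => Vcst * (1 + (`|z| + `|X w|))).
Proof.
apply: itgZ; apply: itgD; first exact: itg_cst.
by apply: itgD; [exact: itg_cst|exact: itg_norm].
Qed.

Lemma Vlin_bound z w : Vcst * (1 + `|z + X w|) <= Vcst * (1 + (`|z| + `|X w|)).
Proof. by rewrite ler_pM2l ?Vcst_gt0// lerD2l ler_normD. Qed.

Lemma itg_V z : itg (fun w => Vf (z + X w)).
Proof.
apply: itg_le (itg_lin z) _; first exact: meas_homo V_homo.
move=> w; rewrite ger0_norm ?V_ge0//.
exact: le_trans (V_ubound _) (Vlin_bound _ _).
Qed.

Lemma EVsum_cvg z :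
  E (fun w => Vsum N (z + X w)) @[N --> \oo] --> E (fun w => Vf (z + X w)).
Proof.
apply: (@Ex_dct _ _ _ _ (fun N w => Vsum N (z + X w)) _
  (fun w => Vcst * (1 + (`|z| + `|X w|)))).
- by move=> N; exact: meas_homo (@Vsum_homo N).
- exact: meas_homo V_homo.
- by move=> w; exact: Vsum_cvg.
- exact: itg_lin.
- move=> N w; rewrite ger0_norm ?Vsum_ge0//.
  exact: le_trans (Vsum_ubound _ _) (Vlin_bound _ _).
Qed.

(** Up to the constant [E V (X)], the limit is harmonic on the half line; it
remains to see that this constant is 1. *)
Lemma V_eq z : 0 <= z ->
  Vf z = 1 + E (fun w => Vf (z + X w)) - E (fun w => Vf (0 + X w)).
Proof.
move=> z0; have h : Vsum N.+1 z @[N --> \oo] --> Vf z.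
  by have := @Vsum_cvg z; rewrite -(cvg_shiftS (Vsum ^~ z)).
rewrite -(cvg_lim _ h)//; apply: cvg_lim => //.
under eq_cvg do rewrite VsumS//.
apply: cvgB; last exact: EVsum_cvg.
by apply: cvgD; [exact: cvg_cst|exact: EVsum_cvg].
Qed.

Lemma shift_sum (F : nat -> R) M k :
  \sum_(j < M) F (j + k)%N =
  \sum_(j < M) F j + (\sum_(i < k) F (M + i)%N - \sum_(i < k) F i).
Proof.
apply/eqP; rewrite addrA eq_sym subr_eq eq_sym; apply/eqP.
transitivity (\sum_(i < M + k) F i); last by rewrite big_split_ord/=.
rewrite [in RHS]addnC big_split_ord/= addrC; congr (_ + _).
by apply: eq_bigr => i _; rewrite addnC.
Qed.

(** Averages of the increments of [V] by [x] over the starting points [j / m] below [m]. *)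
Definition avg_incr m x := (m%:R ^+ 2)^-1 *
  \sum_(j < m ^ 2) (Vf (j%:R / m%:R + x) - Vf (j%:R / m%:R)).

(** Averaged over a long interval, the increments of the nondecreasing function [V]
are almost linear in [x]: the sum telescopes, and the two boundary terms are
controlled by the linear growth of [V]. *)
Lemma avg_incr_low m x : (0 < m)%N ->
  - (3 * Vcst) * ((1 + `|x|) * Num.min 1 ((1 + `|x|) / m%:R)) <=
  avg_incr m x - Vf m%:R / m%:R * x.
Proof.
move=> m0; have C0 := Vcst_gt0.
have m1 : 0 < m%:R :> R by rewrite ltr0n.
have k0 : 0 <= Vf m%:R / m%:R by rewrite divr_ge0// V_ge0.
have k2 : Vf m%:R / m%:R <= 2 * Vcst.
  rewrite ler_pdivrMr// (le_trans (V_linear _))//.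
  have m1' : 1 <= m%:R :> R by rewrite ler1n.
  by move: m1' C0; set u := m%:R; set c := Vcst; nra.
have xk : `|Vf m%:R / m%:R * x| <= 2 * Vcst * `|x|.
  by rewrite normrM ger0_norm// ler_wpM2r.
have M0 : 0 < (m%:R ^+ 2 : R) by rewrite exprn_gt0.
set Y := 1 + `|x|; have Y1 : 1 <= Y by rewrite lerDl.
have YY : 1 <= Y * Y by move: (Y) Y1 => y y1; nra.
have bnd1 : - (Vcst * Y) <= avg_incr m x.
  rewrite /avg_incr [leRHS]mulrC ler_pdivlMr//.
  have -> : - (Vcst * Y) * m%:R ^+ 2 = \sum_(j < m ^ 2) (- (Vcst * Y)).
    by rewrite sumr_const card_ord -[RHS]mulr_natr natrX.
  apply: ler_sum => j _; set t := _ / _.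
  have VY : Vf `|x| <= Vcst * Y by exact: V_linear.
  have [x0|x0] := leP 0 x.
    have : Vf t <= Vf (t + x) by rewrite V_homo// lerDl.
    have : 0 <= Vcst * Y by rewrite mulr_ge0 ?ltW//; exact: lt_le_trans Y1.
    lra.
  have : Vf t <= Vf (t + x) + Vf `|x|.
    rewrite ltr0_norm// -[X in Vf X <= _](addrK x t) V_subadd// oppr_ge0.
    exact: ltW.
  by move: VY; rewrite -/Y; lra.
have bnd2 : Vf m%:R / m%:R * x - 3 * Vcst * (Y * (Y / m%:R)) <= avg_incr m x.
  have hF i k : (i <= k)%N -> Vf (i%:R / m%:R) <= Vf (k%:R / m%:R).
    by move=> ik; rewrite V_homo// ler_pM2r ?invr_gt0// ler_nat.
  have hM : Vf ((m ^ 2)%:R / m%:R) = Vf m%:R.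
    by rewrite natrX expr2 mulfK// gt_eqF.
  have shp x' k : (forall j, (j < m ^ 2)%N ->
      Vf ((j + k)%:R / m%:R) <= Vf (j%:R / m%:R + x')) ->
      k%:R * (Vf m%:R - Vf (k%:R / m%:R)) <= avg_incr m x' * m%:R ^+ 2.
    move=> h; rewrite /avg_incr [leRHS]mulrC mulVKf ?gt_eqF//.
    rewrite sumrB.
    apply: (@le_trans _ _ (\sum_(j < m ^ 2) Vf ((j + k)%:R / m%:R) -
       \sum_(j < m ^ 2) Vf (j%:R / m%:R))); last first.
      by rewrite lerD2r; apply: ler_sum => j _; exact: h.
    rewrite (shift_sum (fun j => Vf (j%:R / m%:R))) addrAC subrr add0r -sumrB.
    rewrite mulr_natl -[X in _ *+ X]card_ord -sumr_const.
    apply: ler_sum => i _; rewrite lerB//; last exact/hF/ltnW.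
    by rewrite -hM hF// leq_addr.
  have [x0|x0] := leP 0 x.
    have xm : 0 <= x * m%:R by rewrite mulr_ge0// ltW.
    have := truncn_itv xm; set k := Num.truncn _ => /andP[kx xk'].
    have kxm : k%:R / m%:R <= x by rewrite ler_pdivrMr.
    have {}shp : k%:R / m%:R * (Vf m%:R - Vf (k%:R / m%:R)) / m%:R <= avg_incr m x.
      rewrite -(ler_pM2r M0) (le_trans _ (shp x k _))//.
        apply: eq_ler.
        by field; rewrite gt_eqF.
      by move=> j _; rewrite V_homo// natrD mulrDl lerD2l.
    have VY : Vf (k%:R / m%:R) <= Vcst * Y.
      rewrite (le_trans (V_linear _)) ?divr_ge0// ler_pM2l// lerD2l ger0_norm//.
    have xl : x - m%:R^-1 <= k%:R / m%:R.
      by rewrite lerBlDr -[X in _ <= _ + X]mul1r -mulrDl ler_pdivlMr// natr1 ltW.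
    have u0 : 0 < (m%:R^-1 : R) by rewrite invr_gt0.
    have v0 : 0 <= k%:R / m%:R :> R by rewrite divr_ge0.
    have V0 := V_ge0 (k%:R / m%:R).
    have xY : x <= Y by rewrite /Y ger0_norm// lerDr.
    apply: le_trans shp; move: VY xl v0 kxm V0 k0 k2.
    move: (m%:R^-1) u0 (k%:R) => u u0 v.
    set v' := v * u; set V1 := Vf m%:R; set V2 := Vf v'; move=> VY xl v0 kxm V0 k0 k2.
    have h1 : v' * V2 <= Y * (Vcst * Y).
      by apply: ler_pM => //; exact: le_trans kxm xY.
    have h2 : (x - u) * (V1 * u) <= v' * (V1 * u) by rewrite ler_wpM2r.
    have h3 : u * (V1 * u) <= u * (2 * Vcst) by rewrite ler_pM2l//.
    have h4 : u * (2 * Vcst) <= u * (2 * Vcst * (Y * Y)).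
      by rewrite ler_pM2l//; move: C0 YY; move: Vcst (Y * Y) => c y c0 y1; nra.
    have h5 : u * (v' * V2) <= u * (Y * (Vcst * Y)) by rewrite ler_pM2l.
    move: Vcst h1 h2 h3 h4 h5; clearbody V1 V2 v' Y => c h1 h2 h3 h4 h5; lra.
  have xm : 0 <= - x * m%:R by rewrite mulr_ge0 ?oppr_ge0 ?ltW.
  have := truncn_itv xm; set k := (Num.truncn _).+1 => /andP[kx xk'].
  have {}kx : k%:R <= - x * m%:R + 1 by rewrite -natr1 lerD2r.
  pose G j := Vf ((j%:R - k%:R) / m%:R).
  have Glow : \sum_(j < m ^ 2) Vf (j%:R / m%:R) - k%:R * Vf m%:R <=
      \sum_(j < m ^ 2) G j.
    have e := @shift_sum G (m ^ 2) k.
    have -> : \sum_(j < m ^ 2) Vf (j%:R / m%:R) = \sum_(j < m ^ 2) G (j + k)%N.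
      by apply: eq_bigr => j _; rewrite /G natrD addrK.
    have z : \sum_(i < k) G i = 0.
      apply: big1 => i _; rewrite /G V_neg// pmulr_llt0 ?invr_gt0//.
      by rewrite subr_lt0 ltr_nat.
    rewrite e z subr0 -addrA gerDl subr_le0 mulr_natl -[X in _ *+ X]card_ord -sumr_const.
    apply: ler_sum => i _; rewrite -hM V_homo// ler_pM2r ?invr_gt0//.
    by rewrite lerBlDr -natrD ler_nat leq_add2l ltnW.
  have ps : - (k%:R * Vf m%:R) <= avg_incr m x * m%:R ^+ 2.
    rewrite /avg_incr [leRHS]mulrC mulVKf ?gt_eqF// sumrB.
    have : \sum_(j < m ^ 2) G j <= \sum_(j < m ^ 2) Vf (j%:R / m%:R + x).
      apply: ler_sum => j _; rewrite V_homo// mulrBl lerD2l lerNl.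
      by rewrite ler_pdivlMr// ltW.
    by move: Glow; lra.
  have {}ps : - (k%:R / m%:R * (Vf m%:R / m%:R)) <= avg_incr m x.
    rewrite -(ler_pM2r M0) (le_trans _ ps)//.
    apply: eq_ler.
    by field; rewrite gt_eqF.
  have u0 : 0 < (m%:R^-1 : R) by rewrite invr_gt0.
  have kx' : k%:R / m%:R <= - x + m%:R^-1.
    by rewrite -[m%:R^-1 in leRHS]mul1r ler_pdivrMr// mulrDl mul1r mulVf// gt_eqF.
  apply: le_trans ps.
  have h1 : k%:R / m%:R * (Vf m%:R / m%:R) <= (- x + m%:R^-1) * (Vf m%:R / m%:R).
    by rewrite ler_wpM2r.
  have h3 : m%:R^-1 * (Vf m%:R / m%:R) <= m%:R^-1 * (2 * Vcst) by rewrite ler_pM2l.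
  have h4 : m%:R^-1 * (2 * Vcst) <= m%:R^-1 * (3 * Vcst * (Y * Y)).
    by rewrite ler_pM2l//; move: C0 YY; move: Vcst (Y * Y) => c y c0 y1; nra.
  move: Vcst h1 h3 h4 => c h1 h3 h4; lra.
rewrite /Num.min; case: ifP => _.
  rewrite mulr1; move: xk; rewrite ler_norml => /andP[_ xk].
  suff : 2 * Vcst * `|x| <= 2 * (Vcst * Y) by move: bnd1 xk; lra.
  by rewrite -mulrA !ler_pM2l// lerDr.
by move: bnd2; lra.
Qed.

Lemma itg_avg_incr m : itg (fun w => avg_incr m (X w)).
Proof.
apply: itgZ; apply: (@itg_sum _ _ _ P (m ^ 2)
  (fun j w => Vf (j%:R / m%:R + X w) - Vf (j%:R / m%:R))) => j.
by apply: itgB; [exact: itg_V|exact: itg_cst].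
Qed.

Lemma E_avg_incr m : (0 < m)%N -> E (fun w => avg_incr m (X w)) = E (fun w => Vf (0 + X w)) - 1.
Proof.
move=> m0; rewrite ExZ; last first.
  apply: (@itg_sum _ _ _ P (m ^ 2)
    (fun j w => Vf (j%:R / m%:R + X w) - Vf (j%:R / m%:R))) => j.
  by apply: itgB; [exact: itg_V|exact: itg_cst].
rewrite (@Ex_sum _ _ _ P (m ^ 2)
    (fun j w => Vf (j%:R / m%:R + X w) - Vf (j%:R / m%:R))); last first.
  by move=> j; apply: itgB; [exact: itg_V|exact: itg_cst].
have e (j : 'I_(m ^ 2)) :
    E (fun w => Vf (j%:R / m%:R + X w) - Vf (j%:R / m%:R)) =
    E (fun w => Vf (0 + X w)) - 1.
  rewrite ExB; [|exact: itg_V|exact: itg_cst].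
  by rewrite Ex_cst [X in _ - X]V_eq ?divr_ge0//; lra.
rewrite (eq_bigr _ (fun j _ => e j)) sumr_const card_ord -[_ *+ (m ^ 2)]mulr_natl natrX mulrA.
by rewrite mulVf ?mul1r// expf_eq0/= pnatr_eq0 -lt0n.
Qed.

Lemma EV0_le1 : E (fun w => Vf (0 + X w)) <= 1.
Proof.
have h := @EVsum_cvg 0.
rewrite -(cvg_lim _ h)//; apply: limr_le; last by apply: nearW => N; exact: EVsum_le1.
by apply/cvg_ex; exists (E (fun w => Vf (0 + X w))).
Qed.

(** The average over [x = X] of the averaged increments is exactly [E V (X) - 1],
and it is almost [E X = 0] times a slope, with an error that tends to 0. *)
Lemma EV0_eq1 : E (fun w => Vf (0 + X w)) = 1.
Proof.
apply/eqP; rewrite eq_le EV0_le1 /= -subr_ge0.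
pose Y w := 1 + `|X w|.
have Y0 w : 0 <= Y w by rewrite addr_ge0.
have iY : itg Y by apply: itgD; [exact: itg_cst|exact: itg_norm].
have C0 := Vcst_gt0.
apply/ler_addgt0Pl => e e0.
have e1 : 0 < e / (3 * Vcst) by rewrite divr_gt0// mulr_gt0.
have [c c0 hc] := trunc_mean_small Y0 iY e1.
pose m := (Num.truncn c).+1.
have cm : c <= m%:R by rewrite ltW//; have /andP[] := truncn_itv (ltW c0).
have m0 : (0 < m)%N by [].
have := hc _ cm.
have it : itg (fun w => Y w * Num.min 1 (Y w / m%:R)) by apply: itg_trunc.
have : E (fun w => - (3 * Vcst) * (Y w * Num.min 1 (Y w / m%:R)) +
     Vf m%:R / m%:R * X w) <= E (fun w => avg_incr m (X w)).
  apply: Ex_le; [by apply: itgD; exact: itgZ|exact: itg_avg_incr|] => w.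
  by rewrite -lerBrDr avg_incr_low.
rewrite ExD; [|exact: itgZ..].
have -> : E (fun w => Vf m%:R / m%:R * X w) = 0.
  by rewrite (ExZ (Vf m%:R / m%:R) iX) EX0 mulr0.
rewrite (ExZ (- (3 * Vcst)) it) addr0 E_avg_incr// -/(trunc_mean P Y m%:R).
have C3 : 0 < 3 * Vcst by exact: mulr_gt0.
rewrite (ler_pdivlMr _ _ C3); lra.
Qed.

Lemma V_harmonic z : 0 <= z -> E (fun w => Vf (z + X w)) = Vf z.
Proof. by move=> z0; rewrite [RHS]V_eq// EV0_eq1; lra. Qed.

End renewal_function.

(** * Subharmonic functions with prescribed sources *)
Section potentials.
Context (d : measure_display) (T : measurableType d) (R : realType).
Variables (P : probability T R) (X : T -> R) (a p : R).
Hypotheses (iX : itg P X) (EX0 : Ex P X = 0) (a0 : 0 < a) (p0 : 0 < p).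
Hypothesis Xa : p <= Ex P (\1_[set w | a <= X w]).
Local Notation E := (Ex P).
Local Notation itg := (itg P).

Let V := Vf P X.
Let C := Vcst a p.

Let C0 : 0 < C. Proof. exact: Vcst_gt0. Qed.
Let Vhomo : {homo V : x y / x <= y}. Proof. exact: V_homo iX a0 p0 Xa. Qed.
Let V0 z : 0 <= V z. Proof. exact: V_ge0 iX a0 p0 Xa _. Qed.
Let Vlin z : 0 <= z -> V z <= C * (1 + z).
Proof. exact: V_linear iX a0 p0 Xa _. Qed.
Let Vneg z : z < 0 -> V z = 0. Proof. exact: V_neg iX a0 p0 Xa _. Qed.
Let Vsub y l : 0 <= l -> V (y + l) <= V y + V l.
Proof. exact: V_subadd iX a0 p0 Xa _ _. Qed.

(** The least majorant of [V] whose increments over [t >= 0] are at most [C * t]. It is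
subharmonic on the whole line, as a supremum of subharmonic functions. *)
Definition Vmaj_set z : set R := [set V (z + h) - C * h | h in [set h | 0 <= h]].
Definition Vmaj z : R := sup (Vmaj_set z).

Lemma Vmaj_set_ub z : has_ubound (Vmaj_set z).
Proof.
exists (V z + C) => _ [h /= h0 <-].
have := Vsub z h0; have := Vlin h0; lra.
Qed.

Lemma Vmaj_ge z h : 0 <= h -> V (z + h) - C * h <= Vmaj z.
Proof. by move=> h0; apply: ub_le_sup; [exact: Vmaj_set_ub|exists h]. Qed.

Lemma Vmaj_le z c : (forall h, 0 <= h -> V (z + h) - C * h <= c) -> Vmaj z <= c.
Proof.
move=> h; apply: ge_sup; last by move=> _ [k /= k0 <-]; exact: h.
by exists (V (z + 0) - C * 0); exists 0 => //=.
Qed.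

Lemma Vmaj_geV z : V z <= Vmaj z.
Proof. by have := Vmaj_ge z (lexx 0); rewrite addr0 mulr0 subr0. Qed.

Lemma Vmaj_leV z : Vmaj z <= V z + C.
Proof.
by apply: Vmaj_le => h h0; have := Vsub z h0; have := Vlin h0; lra.
Qed.

Lemma Vmaj_homo : {homo Vmaj : x y / x <= y}.
Proof.
move=> x y xy; apply: Vmaj_le => h h0; apply: le_trans (Vmaj_ge y h0).
by rewrite lerD2r Vhomo// lerD2r.
Qed.

Lemma Vmaj_lip z t : 0 <= t -> Vmaj (z + t) <= Vmaj z + C * t.
Proof.
move=> t0; apply: Vmaj_le => h h0.
have := Vmaj_ge z (addr_ge0 t0 h0); rewrite addrA; lra.
Qed.

Lemma Vmaj_ge0 z : 0 <= Vmaj z.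
Proof. exact: le_trans (Vmaj_geV z). Qed.

Lemma Vmaj_neg z : z <= -1 -> Vmaj z = 0.
Proof.
move=> z1; apply/eqP; rewrite eq_le Vmaj_ge0 andbT.
apply: Vmaj_le => h h0; have Ch : 0 <= C * h by rewrite mulr_ge0// ltW.
have [zh|zh] := leP 0 (z + h); last by rewrite Vneg// sub0r oppr_le0.
have := Vlin zh; have : C * (1 + z) <= 0 by rewrite pmulr_rle0//; lra.
lra.
Qed.

Lemma itg_Vmaj z : itg (fun w => Vmaj (z + X w)).
Proof.
have h : itg (fun w => V (z + X w) + C).
  by apply: itgD; [exact: (itg_V iX a0 p0 Xa z)|exact: itg_cst].
apply: itg_le h _; first exact: (meas_homo iX _ Vmaj_homo).
by move=> w; rewrite ger0_norm ?Vmaj_ge0// Vmaj_leV.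
Qed.

Lemma Vmaj_subh z : Vmaj z <= E (fun w => Vmaj (z + X w)).
Proof.
apply: Vmaj_le => h h0.
apply: (@le_trans _ _ (E (fun w => V (z + h + X w) - C * h))).
  rewrite ExB ?Ex_cst; [|exact: (itg_V iX a0 p0 Xa _)|exact: itg_cst].
  rewrite lerD2r; have [zh|zh] := leP 0 (z + h).
    by rewrite (V_harmonic iX EX0 a0 p0 Xa zh).
  by rewrite Vneg//; apply: Ex_ge0 => w; exact: V0.
apply: Ex_le; [|exact: itg_Vmaj|].
  by apply: itgB; [exact: (itg_V iX a0 p0 Xa _)|exact: itg_cst].
by move=> w; rewrite addrAC; exact: Vmaj_ge.
Qed.

(** The last of the points [- 1 + m * (a / 2)] where [Vmaj] vanishes. Once it is
translated to 0, the function vanishes on negative numbers and is positive at [a / 2]. *)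
Lemma Vmaj_threshold : exists z, [/\ z <= 0, Vmaj z = 0 & 0 < Vmaj (z + a / 2)].
Proof.
have d0 : 0 < a / 2 by rewrite divr_gt0.
pose Q m := 0 < Vmaj (- 1 + m%:R * (a / 2)).
have exQ : exists m, Q m.
  exists (Num.truncn ((a / 2)^-1)).+1; rewrite /Q.
  have /andP[_ h] := truncn_itv (ltW (eqbRL (invr_gt0 (a / 2)) d0)).
  apply: lt_le_trans (Vmaj_geV _); apply: lt_le_trans ltr01 _.
  apply: V_ge1 iX a0 p0 Xa _ _.
  by rewrite addrC subr_ge0 -ler_pdivrMr// div1r ltW.
have [m Qm mmin] := ex_minnP exQ; case: m Qm mmin => [|m] Qm mmin.
  by move: Qm; rewrite /Q mul0r addr0 Vmaj_neg ?lexx ?ltxx.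
exists (- 1 + m%:R * (a / 2)); split.
- rewrite leNgt; apply/negP => h; have := mmin m; rewrite ltnn => mm.
  suff : false by []. apply: mm; rewrite /Q.
  apply: lt_le_trans ltr01 _; apply: le_trans (Vmaj_geV _).
  by apply: V_ge1 iX a0 p0 Xa _ _; exact: ltW.
- apply/eqP; rewrite eq_le Vmaj_ge0 andbT leNgt; apply/negP => h.
  by have := mmin m h; rewrite ltnn.
- by move: Qm; rewrite /Q -natr1 mulrDl mul1r addrA.
Qed.

(** From a point above [- (a / 2)], a step of size at least [a] reaches [a / 2], where
[U] is positive: this is the source. *)
Lemma subharmonic_exists : exists (U : R -> R) (c : R), [/\ 0 < c,
  [/\ {homo U : x y / x <= y}, forall z, z <= 0 -> U z = 0 & forall z, 0 <= U z <= V z],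
  forall z t, 0 <= t -> U (z + t) <= U z + C * t,
  forall z, itg (fun w => U (z + X w)) /\ U z <= E (fun w => U (z + X w)) &
  forall z, - (a / 2) <= z -> c <= E (fun w => U (z + X w))].
Proof.
have [zs [zs0 Vzs Vza]] := Vmaj_threshold.
have k0 : 0 < (1 + C)^-1 by rewrite invr_gt0 addr_gt0.
pose U z := (1 + C)^-1 * Vmaj (z + zs).
have U0 z : 0 <= U z by rewrite mulr_ge0 ?Vmaj_ge0// ltW.
have Uh : {homo U : x y / x <= y}.
  by move=> x y xy; rewrite ler_pM2l// Vmaj_homo// lerD2r.
have Uneg z : z <= 0 -> U z = 0.
  move=> z0; apply/eqP; rewrite eq_le U0 andbT.
  by rewrite pmulr_rle0// -Vzs Vmaj_homo// gerDr.
have iU z : itg (fun w => U (z + X w)).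
  apply: itgZ.
  by under eq_fun do rewrite addrAC; exact: itg_Vmaj.
exists U, (U (a / 2) * p); split.
- by rewrite mulr_gt0// mulr_gt0// addrC.
- split => // z; rewrite U0/=; have [z0|z0] := leP z 0; first by rewrite Uneg.
  rewrite /U mulrC ler_pdivrMr ?addr_gt0//.
  have V1 : 1 <= V z by apply: V_ge1 iX a0 p0 Xa _ _; exact: ltW.
  have zz : z + zs <= z by rewrite gerDl.
  apply: (le_trans (Vmaj_homo zz)).
  apply: (le_trans (Vmaj_leV _)); rewrite mulrDr mulr1 lerD2l.
  by rewrite ler_peMl// ltW.
- move=> z t t0; have := Vmaj_lip (z + zs) t0.
  rewrite /U addrAC -(ler_pM2l k0) mulrDr => h; apply: (le_trans h).
  rewrite lerD2l; apply: ler_piMl; first by rewrite mulr_ge0// ltW.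
  by rewrite invf_le1 ?lerDl ?addr_gt0// ltW.
- move=> z; split; first exact: iU.
  rewrite ExZ; last by under eq_fun do rewrite addrAC; exact: itg_Vmaj.
  rewrite ler_pM2l//; under eq_Ex do rewrite addrAC.
  exact: Vmaj_subh.
- move=> z za; apply: (@le_trans _ _ (E (fun w => U (a / 2) * \1_[set w | a <= X w] w))).
    rewrite ExZ; first by rewrite ler_wpM2l.
    by apply: itg_indic; exact: mXa a iX.
  apply: Ex_le; [|exact: iU|].
    by apply: itgZ; apply: itg_indic; exact: mXa a iX.
  move=> w; rewrite indicE; case: (boolP (w \in _)) => [|_]; last by rewrite mulr0.
  rewrite inE/= mulr1 => aX; apply: Uh; lra.
Qed.

End potentials.

Section weighted_potential.
Context (d : measure_display) (T : measurableType d) (R : realType).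
Variables (P : probability T R) (X : T -> R) (V U : R -> R) (C c del M : R).
Variable w : nat -> R.
Local Notation E := (Ex P).
Local Notation itg := (itg P).
Hypotheses (iX : itg X) (iV : forall z, itg (fun t => V (z + X t))).
Hypotheses (C0 : 0 <= C) (c0 : 0 <= c) (del0 : 0 < del).
Hypothesis Uhomo : {homo U : x y / x <= y}.
Hypothesis Uneg : forall z, z <= 0 -> U z = 0.
Hypothesis UV : forall z, 0 <= U z <= V z.
Hypothesis Ulip : forall z t, 0 <= t -> U (z + t) <= U z + C * t.
Hypothesis Usub : forall z, itg (fun t => U (z + X t)) /\ U z <= E (fun t => U (z + X t)).
Hypothesis Usrc : forall z, - del <= z -> c <= E (fun t => U (z + X t)).
Hypotheses (w0 : forall i, 0 <= w i) (wM : forall n, \sum_(i < n) w i <= M).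

Let cut z := (Num.truncn (z / del)).+1.
Let part n z := \sum_(i < n) w i * U (z - i.+1%:R * del).
(** The superposition of the translates of [U] with weights [w i], one for each
interval of length [del]; only finitely many terms are nonzero at [z]. *)
Definition wpot z := part (cut z) z.

Let part_homo n : {homo part n : x y / x <= y}.
Proof.
move=> x y xy; apply: ler_sum => i _; rewrite ler_wpM2l//.
by rewrite Uhomo// lerD2r.
Qed.

Let term0 i z : 0 <= w i * U (z - i.+1%:R * del).
Proof. by rewrite mulr_ge0//; have /andP[] := UV (z - i.+1%:R * del). Qed.

Let part_mono m n z : (m <= n)%N -> part m z <= part n z.
Proof.
move=> /subnK <-; elim: (n - m)%N => [|k IH] //.
by rewrite addSn /part big_ord_recr/= -[leLHS]addr0 lerD.
Qed.

Let part_cut n z : (cut z <= n)%N -> part n z = wpot z.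
Proof.
move=> /subnK <-; elim: (n - _)%N => [|k IH] //.
rewrite addSn /part big_ord_recr/= -/(part _ _) IH Uneg ?mulr0 ?addr0//.
rewrite subr_le0 -ler_pdivrMr//; have [z0|z0] := leP 0 (z / del).
  have /andP[_ /ltW/le_trans] := truncn_itv z0; apply.
  by rewrite ler_nat ltnS -ltnS -/(cut z) leqW// leq_addl.
by rewrite (le_trans (ltW z0)).
Qed.

Let part_le n z : part n z <= wpot z.
Proof.
have [nz|zn] := leqP n (cut z); first exact: part_mono.
by rewrite part_cut// ltnW.
Qed.

Lemma wpot_homo : {homo wpot : x y / x <= y}.
Proof. by move=> x y xy; apply: le_trans (part_le (cut x) y); exact: part_homo. Qed.

Lemma wpot_neg z : z <= 0 -> wpot z = 0.
Proof.
move=> z0; apply: big1 => i _; rewrite Uneg ?mulr0// subr_le0 (le_trans z0)//.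
by rewrite mulr_ge0// ltW.
Qed.

Lemma wpot_ge0 z : 0 <= wpot z.
Proof. exact: sumr_ge0. Qed.

Lemma wpot_leV z : wpot z <= M * V z.
Proof.
have Uz : 0 <= U z <= V z := UV z; have /andP[U0 UVz] := Uz.
apply: (@le_trans _ _ (\sum_(i < cut z) w i * V z)).
  apply: ler_sum => i _; rewrite ler_wpM2l//; apply: le_trans UVz.
  by rewrite Uhomo// gerBl mulr_ge0// ltW.
by rewrite -mulr_suml ler_wpM2r// (le_trans U0).
Qed.

Lemma wpot_lip z t : 0 <= t -> wpot (z + t) <= wpot z + C * M * t.
Proof.
move=> t0; apply: (@le_trans _ _ (part (cut (z + t)) z + C * M * t)); last first.
  by rewrite lerD2r part_le.
apply: (@le_trans _ _ (part (cut (z + t)) z + (\sum_(i < cut (z + t)) w i) * (C * t))).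
  rewrite mulr_suml /wpot /part -big_split/=; apply: ler_sum => i _.
  by rewrite -mulrDr ler_wpM2l// addrAC Ulip.
by rewrite lerD2l [C * M]mulrC -mulrA ler_wpM2r// mulr_ge0.
Qed.

Lemma itg_wpot z : itg (fun t => wpot (z + X t)).
Proof.
have h : itg (fun t => M * V (z + X t)) by exact: itgZ.
apply: itg_le h _; first exact: (meas_homo iX _ wpot_homo).
by move=> t; rewrite ger0_norm ?wpot_ge0// wpot_leV.
Qed.

Let itg_part n z : itg (fun t => part n (z + X t)).
Proof.
apply: (@itg_sum _ _ _ P n (fun i t => w i * U (z + X t - i.+1%:R * del))) => i.
apply: itgZ; under eq_fun do rewrite addrAC.
by have [] := Usub (z - i.+1%:R * del).
Qed.

Let Epart n z : E (fun t => part n (z + X t)) =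
  \sum_(i < n) w i * E (fun t => U (z - i.+1%:R * del + X t)).
Proof.
rewrite (@Ex_sum _ _ _ P n (fun i t => w i * U (z + X t - i.+1%:R * del))).
  apply: eq_bigr => i _; rewrite ExZ; last first.
    under eq_fun do rewrite addrAC.
    by have [] := Usub (z - i.+1%:R * del).
  by congr (_ * _); apply: eq_Ex => t; rewrite addrAC.
move=> i; apply: itgZ; under eq_fun do rewrite addrAC.
by have [] := Usub (z - i.+1%:R * del).
Qed.

(** In the [i]-th interval the translate with weight [w i] vanishes, but its mean
after one step is at least [c]; all the others are subharmonic. *)
Lemma wpot_src i z : i%:R * del <= z < i.+1%:R * del ->
  wpot z + c * w i <= E (fun t => wpot (z + X t)).
Proof.
move=> /andP[iz zi].
have ci : cut z = i.+1.
  by rewrite /cut (@truncn_def _ _ i)// ler_pdivlMr// iz ltr_pdivrMr.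
apply: (@le_trans _ _ (E (fun t => part i.+1 (z + X t)))); last first.
  by apply: Ex_le; [exact: itg_part|exact: itg_wpot|] => t; exact: part_le.
rewrite Epart /wpot /part ci !big_ord_recr/= -addrA lerD//.
  apply: ler_sum => k _; rewrite ler_wpM2l//.
  by have [] := Usub (z - k.+1%:R * del).
rewrite Uneg ?subr_le0 ?(ltW zi)// mulr0 add0r mulrC ler_wpM2l// Usrc//.
by move: iz; rewrite -natr1; lra.
Qed.

End weighted_potential.

(** * Cutoffs and dyadic scales *)
Section cutoff.
Variable R : realType.
Implicit Types u v : R.

Definition chi u : R := Num.min 1 (Num.max 0 (2 - u)).

Lemma chiE u : chi u = if u <= 1 then 1 else if 2 <= u then 0 else 2 - u.
Proof. by rewrite /chi maxEle minEle; do !case: ifPn; rewrite ?subr_ge0; lra. Qed.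

Lemma chi01 u : 0 <= chi u <= 1.
Proof. by rewrite chiE; do !case: ifPn; lra. Qed.

Lemma chi_homo u v : u <= v -> chi v <= chi u.
Proof. by rewrite !chiE; do !case: ifPn; lra. Qed.

Lemma chi_lip u v : u <= v -> chi u - chi v <= v - u.
Proof. by rewrite !chiE; do !case: ifPn; lra. Qed.

Lemma chi_eq1 u : u <= 1 -> chi u = 1.
Proof. by rewrite chiE => ->. Qed.

Lemma chi_eq0 u : 2 <= u -> chi u = 0.
Proof. by rewrite chiE; do !case: ifPn; lra. Qed.

Lemma chi_gt0 u : 0 < chi u -> u < 2.
Proof. by rewrite ltNge => h; rewrite ltNge; apply: contra h => /chi_eq0 ->. Qed.

Lemma measurable_chi : measurable_fun [set: R] chi.
Proof.
apply: measurable_minr => //; apply: measurable_maxr => //.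
by apply: measurable_funB => //.
Qed.

Definition two j : R := 2 ^+ j.

Lemma two_gt0 j : 0 < two j. Proof. by rewrite exprn_gt0. Qed.
Lemma twoS j : two j.+1 = 2 * two j. Proof. by rewrite /two exprS. Qed.
Lemma two_ge1 j : 1 <= two j. Proof. by rewrite exprn_ege1// ler1n. Qed.

Lemma two_unbounded (c : R) : exists j, c <= two j.
Proof.
exists (Num.truncn `|c|).+1.
have := truncn_itv (normr_ge0 c) => /andP[_ h].
apply: (le_trans (ler_norm c)); apply: (le_trans (ltW h)).
by rewrite /two -natrX ler_nat ltnW// ltn_expl.
Qed.

Lemma two_between (c : R) : 1 <= c -> exists j, c <= two j < 2 * c.
Proof.
move=> c1; have := two_unbounded c => h.
have [j hj mj] := find_ex_minn h; exists j; rewrite hj/=.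
case: j hj mj => [|j] hj mj; first by rewrite /two expr0; lra.
rewrite twoS ltr_pM2l// ltNge; apply/negP => /mj; rewrite ltnn //.
Qed.

Lemma two_homo i j : (i <= j)%N -> two i <= two j.
Proof. by move=> ij; rewrite /two ler_eXn2l// ltr1n. Qed.

End cutoff.

Section scales.
Context d (T : measurableType d) (R : realType).
Variables (P : probability T R) (Y : T -> R).
Hypotheses (iY : itg P Y) (Y1 : forall w, 1 <= Y w).
Local Notation E := (Ex P).
Local Notation two := (@two R).

Let mY : measurable_fun [set: T] Y := itg_meas iY.

Definition sq j w : R := Num.min 1 ((Y w / two j) ^+ 2).
(** The weight of the scale [2 ^ j]. It dominates the probability of a step larger
than [2 ^ j], and changes by a bounded factor from one scale to the next. *)
Definition mass j : R := E (sq j).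

Lemma sq01 j w : 0 <= sq j w <= 1.
Proof. by rewrite /sq le_min ler01 sqr_ge0/= ge_min lexx. Qed.

Lemma itg_sq j : itg P (sq j).
Proof.
apply: (@itg_bnd _ _ _ _ _ 1).
  apply: measurable_minr => //; apply: measurable_funX.
  by apply: measurable_funM.
by move=> w; have /andP[h1 h2] := sq01 j w; rewrite ger0_norm.
Qed.

Lemma mass_gt0 j : 0 < mass j.
Proof.
have c0 : 0 < Num.min 1 ((1 / two j) ^+ 2) :> R.
  by rewrite lt_min ltr01 exprn_gt0// divr_gt0// two_gt0.
apply: (lt_le_trans c0); rewrite -(Ex_cst P (Num.min _ _)); apply: Ex_le => //.
- exact: itg_cst.
- exact: itg_sq.
move=> w; rewrite /sq le_min ge_min lexx/= ge_min; apply/orP; right.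
have y0 := le_trans ler01 (Y1 w); have t0 := ltW (two_gt0 R j).
by apply: lerXn2r; rewrite ?nnegrE ?divr_ge0// ler_wpM2r ?invr_ge0.
Qed.

Lemma mass_le j : mass j <= 4 * mass j.+1.
Proof.
have h : itg P (fun w => 4 * sq j.+1 w) by apply: itgZ; exact: itg_sq.
rewrite -ExZ; last exact: itg_sq.
refine (Ex_le (itg_sq j) h _) => w.
rewrite /sq twoS invfM mulrCA exprMn.
have : 0 <= (Y w / two j) ^+ 2 by rewrite sqr_ge0.
move: (_ ^+ 2) => t t0; rewrite !minEle; do !case: ifPn; lra.
Qed.

Lemma mass_tail j c : 1 <= c -> E (\1_[set w | two j <= c * Y w]) <= c ^+ 2 * mass j.
Proof.
move=> c1; rewrite -ExZ; last exact: itg_sq.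
have mA : measurable [set w | two j <= c * Y w].
  apply: measurable_le_set => //.
  exact: measurable_funM.
have h : itg P (fun w => c ^+ 2 * sq j w) by apply: itgZ; exact: itg_sq.
refine (Ex_le (itg_indic P mA) h _) => w.
rewrite indicE; have := sq01 j w => /andP[s0 s1].
case: (boolP (w \in _)) => [/set_mem/= hj|_]; last by rewrite mulr_ge0// exprn_ge0// (le_trans ler01).
rewrite mulr1n/=.
rewrite /sq; case: (leP 1 ((Y w / two j) ^+ 2)) => _; rewrite ?mulr1.
  by rewrite exprn_ege1.
by rewrite -exprMn exprn_ege1// mulrA ler_pdivlMr ?two_gt0// mul1r.
Qed.

(** Scales below [y] contribute a geometric sum of size [y], and so do those above;
the two bounds are proved together to pass the critical scale. *)
Lemma sq_sum_aux (y : R) N : 1 <= y ->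
  \sum_(j < N) two j * Num.min 1 ((y / two j) ^+ 2) <= two N /\
  (y <= two N -> \sum_(j < N) two j * Num.min 1 ((y / two j) ^+ 2) <=
     4 * y - 2 * y ^+ 2 / two N).
Proof.
move=> y1; elim: N => [|N [IH1 IH2]].
  rewrite big_ord0 /two expr0; split=> // y2; rewrite divr1; nra.
rewrite big_ord_recr/=; set S := \sum_(_ < _) _ in IH1 IH2 *.
have t0 := two_gt0 R N; rewrite twoS.
have hE : two N * (y / two N) ^+ 2 = y ^+ 2 / two N.
  rewrite expr2; field; exact: lt0r_neq0.
have h1 : two N * Num.min 1 ((y / two N) ^+ 2) <= two N.
  by rewrite -[leRHS]mulr1 ler_pM2l// ge_min lexx.
have h2 : two N * Num.min 1 ((y / two N) ^+ 2) <= y ^+ 2 / two N.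
  by rewrite -hE ler_pM2l// ge_min lexx orbT.
split; first lra.
move=> y2; rewrite invfM.
have [yN|yN] := leP y (two N).
  have := IH2 yN; set m := _ * Num.min _ _ in h2 *.
  have -> : 2 * y ^+ 2 * (2^-1 * (two N)^-1) = y ^+ 2 / two N by field; exact: lt0r_neq0.
  have -> : 2 * y ^+ 2 / two N = 2 * (y ^+ 2 / two N) by rewrite mulrA.
  by lra.
have -> : 2 * y ^+ 2 * (2^-1 * (two N)^-1) = y ^+ 2 / two N by field; exact: lt0r_neq0.
apply: (@le_trans _ _ (2 * two N)); first lra.
rewrite -subr_ge0.
have -> : 4 * y - y ^+ 2 / two N - 2 * two N = (4 * y * two N - y ^+ 2 - 2 * (two N) ^+ 2) / two N.
  by field; exact: lt0r_neq0.
apply: divr_ge0; last exact: ltW.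
move: y2; move: (two N) t0 yN => t; nra.
Qed.

Lemma mass_sum N : \sum_(j < N) two j * mass j <= 4 * E Y.
Proof.
rewrite -ExZ//.
have -> : \sum_(j < N) two j * mass j = E (fun w => \sum_(j < N) two j * sq j w).
  rewrite (@Ex_sum _ _ _ P N (fun j w => two j * sq j w)); last first.
    by move=> j; apply: itgZ; exact: itg_sq.
  by apply: eq_bigr => j _; rewrite ExZ//; exact: itg_sq.
apply: Ex_le; [|exact: itgZ|] => [|w].
  by apply: (@itg_sum _ _ _ P N (fun j w => two j * sq j w)) => j; apply: itgZ; exact: itg_sq.
have [M YM] := two_unbounded (Y w).
have NM : (N <= maxn N M)%N by rewrite leq_maxl.
have [_ h] := sq_sum_aux (maxn N M) (Y1 w).
apply: (@le_trans _ _ (\sum_(j < maxn N M) two j * sq j w)).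
  rewrite -!(big_mkord xpredT (fun j => two j * sq j w)) (big_cat_nat (leq0n N) NM)/= lerDl.
  by apply: sumr_ge0 => j _; apply: mulr_ge0; [exact: ltW (two_gt0 R j)|case/andP: (sq01 j w)].
apply: (le_trans (h _)).
  by apply: (le_trans YM); apply: two_homo; rewrite leq_maxr.
by rewrite gerBl; apply: divr_ge0; [rewrite mulr_ge0 ?sqr_ge0|exact: ltW (two_gt0 R _)].
Qed.

Definition scumul N A : R := \sum_(j < N) chi (A / two j) * mass j.
(** Total weight of the scales that are not cut off at [A], which measures all the
errors and gains below. *)
Definition scut A : R := limn (scumul ^~ A).

Lemma chim_ge0 A j : 0 <= chi (A / two j) * mass j.
Proof.
by apply: mulr_ge0; [case/andP: (chi01 (A / two j))|exact: ltW (mass_gt0 j)].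
Qed.

Lemma scumul_homo A : {homo scumul ^~ A : m n / (m <= n)%N >-> m <= n}.
Proof.
apply: homo_leq => // [? ? ?|n]; first exact: le_trans.
by rewrite /scumul big_ord_recr/= lerDl chim_ge0.
Qed.

Lemma scumul_cvg A : scumul N A @[N --> \oo] --> scut A.
Proof.
apply: nondecreasing_is_cvgn => [|]; first exact: scumul_homo.
exists (4 * E Y) => _ [N _ <-]; apply: le_trans (mass_sum N).
apply: ler_sum => j _; rewrite ler_pM2r ?mass_gt0//.
by have /andP[_ h] := chi01 (A / two j); apply: (le_trans h); exact: two_ge1.
Qed.

Lemma scumul_le N A : scumul N A <= scut A.
Proof.
apply: nondecreasing_cvgn_le; first exact: scumul_homo.
exact: (cvgP _ (@scumul_cvg A)).
Qed.

Lemma scut_ge0 A : 0 <= scut A.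
Proof. by apply: le_trans (scumul_le 0 A); rewrite /scumul big_ord0. Qed.

Lemma scut_ge j A : A <= two j -> mass j <= scut A.
Proof.
move=> h; apply: le_trans (scumul_le j.+1 A).
rewrite /scumul big_ord_recr/= chi_eq1 ?ler_pdivrMr ?two_gt0 ?mul1r//.
by rewrite lerDr sumr_ge0// => i _; exact: chim_ge0.
Qed.

(** Halving [A] shifts the scales by one. *)
Lemma half_sum N A : \sum_(j < N) chi (A / 2 / two j) * mass j <= 4 * scut A.
Proof.
apply: (@le_trans _ _ (4 * scumul N.+1 A)); last by rewrite ler_pM2l ?scumul_le.
rewrite /scumul big_ord_recl/= mulrDr mulr_sumr.
apply: (@le_trans _ _ (\sum_(i < N) 4 * (chi (A / two i.+1) * mass i.+1))); last first.
  by rewrite lerDr mulr_ge0// chim_ge0.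
apply: ler_sum => j _.
have -> : A / two j.+1 = A / 2 / two j by rewrite twoS invfM mulrA.
rewrite mulrCA.
by apply: ler_wpM2l; [case/andP: (chi01 (A / 2 / two j))|exact: mass_le].
Qed.

Lemma quarter_sum N A : \sum_(j < N) (A / 4 <= two j)%R%:R * mass j <= 16 * scut A.
Proof.
apply: (@le_trans _ _ (16 * scumul N.+2 A)); last by rewrite ler_pM2l ?scumul_le.
rewrite /scumul 2!big_ord_recl/= !mulrDr mulr_sumr.
apply: (@le_trans _ _ (\sum_(i < N) 16 * (chi (A / two i.+2) * mass i.+2))); last first.
  by rewrite addrA lerDr addr_ge0// mulr_ge0// chim_ge0.
apply: ler_sum => j _.
have := mass_le j; have := mass_le j.+1; have := mass_gt0 j.+2; have := mass_gt0 j.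
have /andP[c0 c1] := chi01 (A / two j.+2).
case: (leP (A / 4) (two j)) => h; last by move=> *; rewrite mul0r !mulr_ge0// ltW.
rewrite chi_eq1 ?mul1r; first by move: (mass j) (mass j.+1) (mass j.+2) => *; lra.
by rewrite ler_pdivrMr ?two_gt0// !twoS; lra.
Qed.

Lemma mass_tail_cvg (e : R) : 0 < e ->
  exists j0, forall N, \sum_(j < N) (j0 <= j)%N%:R * (two j * mass j) <= e.
Proof.
move=> e0; pose u := fun N => \sum_(j < N) two j * mass j.
have u0 j : 0 <= two j * mass j.
  by apply: mulr_ge0; apply: ltW; [exact: two_gt0|exact: mass_gt0].
have uh : {homo u : m n / (m <= n)%N >-> m <= n}.
  apply: homo_leq => // [? ? ?|n]; first exact: le_trans.
  by rewrite /u big_ord_recr/= lerDl.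
have cu : cvgn u.
  by apply: nondecreasing_is_cvgn => //; exists (4 * E Y) => _ [N _ <-]; exact: mass_sum.
have /cvgrPdist_le/(_ _ e0)[j0 _ h] := cu; exists j0 => N.
have {}h : limn u - u j0 <= e by apply: le_trans (h j0 _); [exact: ler_norm|rewrite /=].
apply: le_trans h.
have [Nj|jN] := leqP N j0.
  rewrite big1 ?subr_ge0 ?nondecreasing_cvgn_le// => j _.
  by rewrite leqNgt (leq_trans (ltn_ord j) Nj) mul0r.
have -> : \sum_(j < N) (j0 <= j)%N%:R * (two j * mass j) = u N - u j0.
  rewrite /u -!(big_mkord xpredT (fun j => two j * mass j)).
  rewrite -(big_mkord xpredT (fun j => (j0 <= j)%N%:R * (two j * mass j))).
  rewrite !(big_cat_nat (leq0n _) (ltnW jN))//= big_nat big1 ?add0r; last first.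
    by move=> j /andP[_ jj]; rewrite leqNgt jj mul0r.
  rewrite addrAC subrr add0r big_nat [RHS]big_nat; apply: eq_bigr => j /andP[jj _].
  by rewrite jj mul1r.
by rewrite lerD2r nondecreasing_cvgn_le.
Qed.

End scales.

(** * One-step estimates for the barrier function *)
Section barrier.
Context d (T : measurableType d) (R : realType).
Variables (P : probability T R) (X Y q : T -> R).
Local Notation E := (Ex P).
Local Notation itg := (itg P).
Local Notation two := (@two R).
Local Notation mass := (mass P Y).
Local Notation scut := (scut P Y).
Local Notation scumul := (scumul P Y).
Hypotheses (iX : itg X) (iY : itg Y) (EX0 : E X = 0).
Hypothesis mq : measurable_fun [set: T] q.
Hypothesis YX : forall w, 1 + `|X w| <= Y w.

Variables (V U : R -> R) (C c del Vc : R).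
Hypotheses (C0 : 0 <= C) (c0 : 0 < c) (del0 : 0 < del) (del1 : del <= 1) (Vc0 : 0 <= Vc).
Hypothesis Vhomo : {homo V : x y / x <= y}.
Hypothesis Vneg : forall z, z < 0 -> V z = 0.
Hypothesis Vge1 : forall z, 0 <= z -> 1 <= V z.
Hypothesis Vlin : forall z, 0 <= z -> V z <= Vc * (1 + z).
Hypothesis Vsub : forall y l, 0 <= l -> V (y + l) <= V y + V l.
Hypothesis iV : forall z, itg (fun t => V (z + X t)).
Hypothesis Vharm : forall z, 0 <= z -> E (fun t => V (z + X t)) = V z.
Hypothesis Uhomo : {homo U : x y / x <= y}.
Hypothesis Uneg : forall z, z <= 0 -> U z = 0.
Hypothesis UV : forall z, 0 <= U z <= V z.
Hypothesis Ulip : forall z t, 0 <= t -> U (z + t) <= U z + C * t.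
Hypothesis Usub : forall z, itg (fun t => U (z + X t)) /\ U z <= E (fun t => U (z + X t)).
Hypothesis Usrc : forall z, - del <= z -> c <= E (fun t => U (z + X t)).

Variables (L th NN : R) (om : nat -> nat -> R).
Hypotheses (L0 : 0 < L) (th0 : 0 < th) (NN0 : 0 <= NN) (thNN : th * NN <= 1).
Hypothesis om0 : forall j i, 0 <= om j i.
Hypothesis omM : forall j n, \sum_(i < n) om j i <= 2 * L * mass j.

Let Y1 w : 1 <= Y w. Proof. by apply: le_trans (YX w); rewrite lerDl. Qed.
Let mX : measurable_fun [set: T] X := itg_meas iX.
Let mY : measurable_fun [set: T] Y := itg_meas iY.
Let m0 j : 0 < mass j := mass_gt0 iY Y1 j.

Definition pot j := wpot U del (om j).
(** Linear growth is brought by [V], with a total weight that exceeds the one of the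
subtracted potential; the difference [L * mass j] makes the bracket positive
([bracket_ge]). *)
Definition bracket j s z : R := 3 * L * mass j * V (s + 2 * two j) - pot j z.
Definition term j z s l : R :=
  chi ((z - s) / two j) * (bracket j s z + L * mass j * th * l).
Definition barrier N z s l : R := \sum_(j < N) term j z s l.

Let pot_homo j : {homo pot j : x y / x <= y}.
Proof. exact: (wpot_homo del0 Uhomo Uneg UV (om0 j)). Qed.
Let pot_ge0 j z : 0 <= pot j z. Proof. exact: (wpot_ge0 del UV (om0 j)). Qed.
Let pot_neg j z : z <= 0 -> pot j z = 0. Proof. exact: (wpot_neg (om j) del0 Uneg). Qed.
Let pot_leV j z : pot j z <= 2 * L * mass j * V z.
Proof. exact: (wpot_leV del0 Uhomo UV (om0 j) (omM j)). Qed.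
Let pot_lip j z t : 0 <= t -> pot j (z + t) <= pot j z + C * (2 * L * mass j) * t.
Proof. exact: (wpot_lip C0 del0 Uneg UV Ulip (om0 j) (omM j)). Qed.
Let itg_pot j z : itg (fun t => pot j (z + X t)).
Proof. exact: (itg_wpot iX iV del0 Uhomo Uneg UV (om0 j) (omM j)). Qed.
Let V_ge0 z : 0 <= V z.
Proof. by have /andP[h1 h2] := UV z; exact: le_trans h1 h2. Qed.
Let L3 j : 0 <= 3 * L * mass j.
Proof. by rewrite mulr_ge0// ?mulr_ge0// ltW. Qed.

Let chi_gt0_lt j z s : chi ((z - s) / two j) != 0 -> z < s + 2 * two j.
Proof.
move=> h; have : 0 < chi ((z - s) / two j) by rewrite lt_neqAle eq_sym h; case/andP: (chi01 ((z - s) / two j)).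
by move/chi_gt0; rewrite ltr_pdivrMr ?two_gt0// ltrBlDl.
Qed.

Lemma bracket_ge j s z : z < s + 2 * two j -> L * mass j * V (s + 2 * two j) <= bracket j s z.
Proof.
move=> zs; rewrite /bracket lerBrDr -lerBrDl.
apply: (le_trans (pot_leV j z)).
have h : V z <= V (s + 2 * two j) by apply: Vhomo; exact: ltW.
have -> : 3 * L * mass j * V (s + 2 * two j) - L * mass j * V (s + 2 * two j) =
  2 * L * mass j * V (s + 2 * two j) by ring.
by rewrite ler_wpM2l// mulr_ge0 ?mulr_ge0// ltW.
Qed.

Lemma bracket_ge0 j s z : z < s + 2 * two j -> 0 <= bracket j s z.
Proof.
move=> h; apply: le_trans (bracket_ge h).
by rewrite mulr_ge0// mulr_ge0// ltW.
Qed.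

Lemma bracket_le j s z : bracket j s z <= 3 * L * mass j * V (s + 2 * two j).
Proof. by rewrite /bracket gerBl pot_ge0. Qed.

Lemma term_ge j z s l : 0 <= z -> 0 <= l ->
  L * (chi ((z - s) / two j) * mass j) <= term j z s l.
Proof.
move=> z0 l0; rewrite /term mulrCA.
have [->|h] := eqVneq (chi ((z - s) / two j)) 0; first by rewrite !mul0r.
have /andP[h0 _] := chi01 ((z - s) / two j); apply: ler_wpM2l => //.
have zs := chi_gt0_lt h.
apply: (@le_trans _ _ (bracket j s z)).
  apply: le_trans (bracket_ge zs); rewrite ler_peMr//; first by rewrite mulr_ge0// ltW.
  by apply: Vge1; apply: (le_trans z0); exact: ltW.
by rewrite lerDl mulr_ge0// mulr_ge0// ?mulr_ge0// ltW.
Qed.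

Lemma term_ge0 j z s l : 0 <= z -> 0 <= l -> 0 <= term j z s l.
Proof.
move=> z0 l0; apply: le_trans (term_ge j s z0 l0).
by apply: mulr_ge0; [exact: ltW|exact: chim_ge0].
Qed.

Lemma barrier_homo z s l : 0 <= z -> 0 <= l ->
  {homo (fun N => barrier N z s l) : m n / (m <= n)%N >-> m <= n}.
Proof.
move=> z0 l0; apply: homo_leq => // [? ? ?|n]; first exact: le_trans.
by rewrite /barrier big_ord_recr/= lerDl term_ge0.
Qed.

Lemma barrier_ge N z s l : 0 <= z -> 0 <= l -> L * scumul N (z - s) <= barrier N z s l.
Proof. by move=> z0 l0; rewrite mulr_sumr; apply: ler_sum => j _; exact: term_ge. Qed.

Lemma barrier_ge0 N z s l : 0 <= z -> 0 <= l -> 0 <= barrier N z s l.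
Proof. by move=> z0 l0; apply: sumr_ge0 => j _; exact: term_ge0. Qed.

Lemma cutbr_ge0 j z s : 0 <= chi ((z - s) / two j) * bracket j s z.
Proof.
have [->|h] := eqVneq (chi ((z - s) / two j)) 0; first by rewrite !mul0r.
by rewrite mulr_ge0//; [case/andP: (chi01 ((z - s) / two j))|exact: bracket_ge0 (chi_gt0_lt h)].
Qed.

(** An upward move only decreases the barrier. *)
Lemma cutbr_homo j s z1 z2 : z1 <= z2 ->
  chi ((z2 - s) / two j) * bracket j s z2 <= chi ((z1 - s) / two j) * bracket j s z1.
Proof.
move=> z12; have cc : chi ((z2 - s) / two j) <= chi ((z1 - s) / two j).
  by apply: chi_homo; rewrite ler_pM2r ?invr_gt0 ?two_gt0// lerD2r.
have bb : bracket j s z2 <= bracket j s z1 by rewrite lerD2l lerN2 pot_homo.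
have [->|h] := eqVneq (chi ((z2 - s) / two j)) 0; first by rewrite mul0r cutbr_ge0.
have b0 := bracket_ge0 (chi_gt0_lt h).
by apply: ler_pM => //; case/andP: (chi01 ((z2 - s) / two j)).
Qed.

Definition lossK : R := 24 * Vc + 2 * C.

Lemma lossK_ge0 : 0 <= lossK.
Proof. by rewrite /lossK addr_ge0// mulr_ge0. Qed.

(** The cost of a downward move by [lam]: only the scales with [A / 4 <= 2 ^ j] are
concerned, those below are cut off. *)
Lemma cutbr_loss j s z lam : 1 <= z - s -> 0 <= lam -> lam <= (z - s) / 2 -> 0 <= z ->
  chi ((z - lam - s) / two j) * bracket j s (z - lam) <=
  chi ((z - s) / two j) * bracket j s z +
  L * ((((z - s) / 4 <= two j)%R%:R * mass j) * (lossK * (lam * (1 + z / (z - s))))).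
Proof.
set A := z - s => A1 l0 lA z0.
have A0 : 0 < A by apply: lt_le_trans A1.
have -> : z - lam - s = A - lam by rewrite /A addrAC.
have t0 := two_gt0 R j.
have zA : 0 <= z / A by rewrite divr_ge0// ltW.
have X0 : 0 <= lam * (1 + z / A) by rewrite mulr_ge0// addr_ge0.
have Km : 0 <= lossK * (lam * (1 + z / A)) by rewrite mulr_ge0// lossK_ge0.
case: (leP (A / 4) (two j)) => h; last first.
  rewrite !mul0r mulr0 addr0 chi_eq0 ?mul0r ?cutbr_ge0//.
  rewrite ler_pdivlMr//; lra.
rewrite mul1r.
have hx : chi ((A - lam) / two j) * bracket j s (z - lam) =
  chi (A / two j) * bracket j s z + (chi ((A - lam) / two j) - chi (A / two j)) * bracket j s z +
  chi ((A - lam) / two j) * (pot j z - pot j (z - lam)).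
  by rewrite /bracket; ring.
rewrite hx -addrA lerD2l.
have hp : pot j z - pot j (z - lam) <= C * (2 * L * mass j) * lam.
  by rewrite lerBlDl; have := pot_lip j (z - lam) l0; rewrite subrK.
have hp0 : 0 <= pot j z - pot j (z - lam) by rewrite subr_ge0 pot_homo// gerBl.
have /andP[c1 c2] := chi01 ((A - lam) / two j).
have h2 : chi ((A - lam) / two j) * (pot j z - pot j (z - lam)) <= L * mass j * (2 * C) * (lam * (1 + z / A)).
  apply: (@le_trans _ _ (pot j z - pot j (z - lam))).
    by rewrite ler_piMl.
  apply: (le_trans hp).
  have -> : C * (2 * L * mass j) * lam = L * mass j * (2 * C) * lam by ring.
  apply: ler_wpM2l; first by rewrite mulr_ge0// mulr_ge0// ltW.
  by rewrite ler_peMr// lerDl.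
have h1 : (chi ((A - lam) / two j) - chi (A / two j)) * bracket j s z <=
    L * mass j * (24 * Vc) * (lam * (1 + z / A)).
  have Lm : 0 <= L * mass j by rewrite mulr_ge0// ltW.
  have R0 : 0 <= L * mass j * (24 * Vc) * (lam * (1 + z / A)).
    by rewrite mulr_ge0// mulr_ge0// mulr_ge0.
  have [At|tA] := leP A (two j).
    rewrite chi_eq1; last by rewrite ler_pdivrMr// mul1r lerBlDr (le_trans At)// lerDl.
    by rewrite chi_eq1 ?subrr ?mul0r// ler_pdivrMr// mul1r.
  have Ve : V (s + 2 * two j) <= Vc * (1 + (z + A)).
    have hs : s + 2 * two j <= z + A by rewrite /A in tA *; lra.
    apply: (le_trans (Vhomo hs)); apply: Vlin; rewrite addr_ge0// ltW //.
  have d0 : 0 <= chi ((A - lam) / two j) - chi (A / two j).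
    by rewrite subr_ge0 chi_homo// ler_pM2r ?invr_gt0// gerBl.
  have dl : chi ((A - lam) / two j) - chi (A / two j) <= 4 * lam / A.
    apply: (@le_trans _ _ (A / two j - (A - lam) / two j)).
      by apply: chi_lip; rewrite ler_pM2r ?invr_gt0// gerBl.
    rewrite -mulrBl opprB addrC subrK ler_pdivrMr// mulrAC ler_pdivlMr//.
    rewrite -mulrA mulrCA; apply: ler_wpM2l => //; lra.
  apply: (@le_trans _ _ (4 * lam / A * (3 * L * mass j * (Vc * (1 + (z + A)))))).
    apply: (@le_trans _ _ ((chi ((A - lam) / two j) - chi (A / two j)) * (3 * L * mass j * V (s + 2 * two j)))).
      by apply: ler_wpM2l => //; exact: bracket_le.
    apply: ler_pM => //; first by rewrite mulr_ge0.
    by rewrite ler_wpM2l.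
  have -> : 4 * lam / A * (3 * L * mass j * (Vc * (1 + (z + A)))) =
     L * mass j * (12 * Vc) * (lam * (A^-1 + z / A + 1)).
    by field; exact: lt0r_neq0.
  have -> : L * mass j * (24 * Vc) * (lam * (1 + z / A)) =
    L * mass j * (12 * Vc) * (lam * (2 * (1 + z / A))) by ring.
  apply: ler_wpM2l; first by rewrite mulr_ge0// mulr_ge0.
  apply: ler_wpM2l => //.
  have : A^-1 <= 1 by rewrite invf_le1.
  lra.
apply: (le_trans (lerD h1 h2)).
apply: eq_ler; rewrite /lossK; ring.
Qed.

Lemma measurable_barrier d1 (S : measurableType d1) (z s l : S -> R) N :
  measurable_fun [set: S] z -> measurable_fun [set: S] s -> measurable_fun [set: S] l ->
  measurable_fun [set: S] (fun u => barrier N (z u) (s u) (l u)).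
Proof.
move=> mz ms ml.
have mV : measurable_fun [set: R] V by apply: nondecreasing_measurable => // x y _ _; exact: Vhomo.
have mH j : measurable_fun [set: R] (pot j).
  by apply: nondecreasing_measurable => // x y _ _; exact: pot_homo.
rewrite /barrier /term; apply: (measurable_sum (index_enum 'I_N)) => j.
apply: measurable_funM.
  apply: (measurableT_comp (f := @chi R)); first exact: measurable_chi.
  apply: measurable_funM => //.
  exact: measurable_funB.
apply: measurable_funD; last exact: measurable_funM.
apply: measurable_funB; last by apply: (measurableT_comp (f := pot j)).
apply: measurable_funM => //; apply: (measurableT_comp (f := V)) => //.
exact: measurable_funD.
Qed.

(** The profile of the damage done by a step, which is concentrated at the heights
close to the height [q] of its translation part. *)
Definition peak i w : R := expR (- (`|i%:R * del - q w| / 2)).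
Definition peak_mean i : R := E (fun w => Y w * peak i w).
Definition far_prob i : R := E (\1_[set w | i%:R * del <= Y w]).
Definition big_mean j i : R := E (fun w => \1_[set w | two j <= 4 * Y w] w * peak i w).

Lemma peak01 i w : 0 <= peak i w <= 1.
Proof.
rewrite /peak expR_ge0 -[leRHS](expR0 R) ler_expR oppr_le0 divr_ge0//.
Qed.

Lemma measurable_peak i : measurable_fun [set: T] (peak i).
Proof.
apply: measurableT_comp => //; apply: measurableT_comp => //.
apply: measurable_funM => //; apply: measurableT_comp => //.
exact: measurable_funB.
Qed.

Lemma itg_peak_mean i : itg (fun w => Y w * peak i w).
Proof.
apply: itg_le iY _; first by apply: measurable_funM => //; exact: measurable_peak.
move=> w; have /andP[h1 h2] := peak01 i w; have y0 := le_trans ler01 (Y1 w).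
by rewrite normrM !ger0_norm// ler_piMr.
Qed.

Lemma itg_far_prob i : itg (\1_[set w | i%:R * del <= Y w]).
Proof. by apply: itg_indic; apply: measurable_le_set. Qed.

Lemma itg_big_mean j i : itg (fun w => \1_[set w | two j <= 4 * Y w] w * peak i w).
Proof.
apply: (@itg_bnd _ _ _ _ _ 1).
  apply: measurable_funM; last exact: measurable_peak.
  by apply: measurable_indic; apply: measurable_le_set => //; exact: measurable_funM.
move=> w; have /andP[h1 h2] := peak01 i w.
rewrite indicE; case: (w \in _); rewrite ?mul1r ?mul0r ?normr0//.
by rewrite ger0_norm.
Qed.

Lemma peak_near i z w : i%:R * del <= z < i.+1%:R * del ->
  expR (- (`|z - q w| / 2)) <= 2 * peak i w.
Proof.
move=> /andP[z1 z2]; have h : expR (1 / 2) <= 2 :> R.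
  have := expR_ge1Dx (- (1 / 2) : R); rewrite expRN.
  have := expR_gt0 (1 / 2 : R); move: (expR _) => e e0 h.
  have : (1 + - (1 / 2)) * e <= e^-1 * e by rewrite ler_wpM2r// ltW.
  rewrite mulVf ?gt_eqF//; lra.
apply: (@le_trans _ _ (expR (1 / 2) * peak i w)); last first.
  by rewrite ler_wpM2r//; case/andP: (peak01 i w).
rewrite /peak -expRD ler_expR.
have : `|i%:R * del - q w| <= `|z - q w| + 1.
  have -> : i%:R * del - q w = (z - q w) - (z - i%:R * del) by ring.
  apply: (le_trans (ler_normB _ _)); rewrite lerD2l ger0_norm ?subr_ge0//.
  rewrite -natr1 mulrDl mul1r in z2.
  by rewrite lerBlDl (le_trans (ltW z2))// lerD2l.
by lra.
Qed.

Definition loss_coef : R := 128 * lossK + 16.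

Hypothesis om_src : forall j i,
  c * om j i = L * mass j * (loss_coef * peak_mean i + 4 * NN * th * far_prob i) + 4 * big_mean j i.

(** How far a step may bring the height below its nominal value [z + X w]: not at all,
by a little, or arbitrarily when the step is larger than the nominal height and [q] is
close to [z]. *)
Definition height_drop z w (z' : R) := [\/ z + X w <= z',
  z + X w - z' <= 1 /\ (z + X w - z') * (1 + (z + X w)) <= 4 * (Y w * expR (- (`|z - q w| / 2))) |
  z + X w <= Y w /\ 1 <= 2 * expR (- (`|z - q w| / 2))].

(** Outside the ball, losses are paid by the source of the potentials. *)
Section far_step.
Variables (z s : R) (i j1 N : nat) (Z' l' : T -> R).
Hypotheses (z0 : 0 < z) (zi : i%:R * del <= z < i.+1%:R * del) (A2 : 2 <= z - s).
Hypotheses (mZ : measurable_fun [set: T] Z') (ml : measurable_fun [set: T] l').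
Hypotheses (Z0 : forall w, 0 <= Z' w) (l0 : forall w, 0 <= l' w <= NN).
Hypothesis dropZ : forall w, height_drop z w (Z' w).
Hypothesis enter : forall w, 0 < l' w -> z <= Y w \/ 1 <= 2 * expR (- (`|z - q w| / 2)).
Hypotheses (j1A : z - s <= two j1 < 2 * (z - s)) (j1N : (j1 < N)%N).

Let A := z - s.
Let rhs w : R := \sum_(j < N) chi (A / two j) * bracket j (s + X w) (z + X w) +
  (L * scut A * loss_coef * (Y w * peak i w) + 4 * L * th * NN * scut A * \1_[set w | i%:R * del <= Y w] w +
   chi (A / two j1) * (4 * (\1_[set w | two j1 <= 4 * Y w] w * peak i w))).

Let AX w : z + X w - (s + X w) = A. Proof. by rewrite /A opprD addrACA subrr addr0. Qed.

(** Small drops cost in proportion to [scut A] and to the peak of the step. *)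
Let far_drop w lam : 0 <= lam -> lam <= A / 2 -> lam <= z + X w ->
   lam * (1 + (z + X w) / A) <= 4 * (Y w * expR (- (`|z - q w| / 2))) ->
   z + X w - lam <= Z' w ->
   \sum_(j < N) chi ((Z' w - (s + X w)) / two j) * bracket j (s + X w) (Z' w) <=
   \sum_(j < N) chi (A / two j) * bracket j (s + X w) (z + X w) +
   L * scut A * (128 * lossK) * (Y w * peak i w).
Proof.
move=> lam0 lamA lamz hl zZ.
have A0 : 0 < A by move: A2; rewrite /A; lra.
have S0 := scut_ge0 iY Y1 A.
have /andP[pk0 pk1] := peak01 i w.
have y0 := le_trans ler01 (Y1 w).
have Yp : 0 <= Y w * peak i w by rewrite mulr_ge0.
have hpk := peak_near w zi.
have hl2 : lam * (1 + (z + X w) / A) <= 8 * (Y w * peak i w).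
  apply: (le_trans hl).
  have -> : 8 * (Y w * peak i w) = 4 * (Y w * (2 * peak i w)) by ring.
  by rewrite ler_pM2l// ler_wpM2l.
have hl3 : 0 <= lam * (1 + (z + X w) / A).
  by rewrite mulr_ge0// addr_ge0// divr_ge0 ?(ltW A0)// (le_trans lam0).
apply: (@le_trans _ _ (\sum_(j < N) (chi (A / two j) * bracket j (s + X w) (z + X w) +
   L * (((A / 4 <= two j)%R%:R * mass j) * (lossK * (lam * (1 + (z + X w) / A))))))).
  apply: ler_sum => j _; apply: (le_trans (cutbr_homo _ _ zZ)).
  have := @cutbr_loss j (s + X w) (z + X w) lam; rewrite AX; apply => //.
    by move: A2; rewrite /A; lra.
  exact: le_trans lamz.
rewrite big_split/= lerD2l -mulr_sumr -mulr_suml -!mulrA ler_pM2l//.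
apply: (@le_trans _ _ ((16 * scut A) * (lossK * (8 * (Y w * peak i w))))).
  apply: ler_pM; [|by rewrite mulr_ge0// lossK_ge0|exact: quarter_sum|].
    by apply: sumr_ge0 => j _; rewrite mulr_ge0// ltW.
  by rewrite ler_wpM2l// lossK_ge0.
apply: eq_ler; ring.
Qed.

Let far_loss w :
   \sum_(j < N) chi ((Z' w - (s + X w)) / two j) * bracket j (s + X w) (Z' w) <=
   \sum_(j < N) chi (A / two j) * bracket j (s + X w) (z + X w) +
   L * scut A * (128 * lossK) * (Y w * peak i w) ->
   z + X w - A / 2 <= Z' w -> barrier N (Z' w) (s + X w) (l' w) <= rhs w.
Proof.
move=> t2 zZ; have /andP[l1 l2] := l0 w.
have A0 : 0 < A by move: A2; rewrite /A; lra.
have S0 := scut_ge0 iY Y1 A.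
have /andP[pk0 pk1] := peak01 i w.
have y0 := le_trans ler01 (Y1 w).
have Yp : 0 <= Y w * peak i w by rewrite mulr_ge0.
have hpk := peak_near w zi.
have t1 : barrier N (Z' w) (s + X w) (l' w) =
   \sum_(j < N) chi ((Z' w - (s + X w)) / two j) * bracket j (s + X w) (Z' w) +
   L * th * l' w * \sum_(j < N) chi ((Z' w - (s + X w)) / two j) * mass j.
  rewrite mulr_sumr -big_split/=; apply: eq_bigr => j _; rewrite /term; ring.
have t3 : L * th * l' w * \sum_(j < N) chi ((Z' w - (s + X w)) / two j) * mass j <=
   L * scut A * 16 * (Y w * peak i w) +
   4 * L * th * NN * scut A * \1_[set w | i%:R * del <= Y w] w.
  have ind0 : 0 <= \1_[set w | i%:R * del <= Y w] w :> R by rewrite indicE.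
  have R1 : 0 <= L * scut A * 16 * (Y w * peak i w) by rewrite mulr_ge0// mulr_ge0// mulr_ge0// ltW.
  have R2 : 0 <= 4 * L * th * NN * scut A by rewrite !mulr_ge0// ltW.
  move: l1; rewrite le_eqVlt => /orP[/eqP<-|lp].
    by rewrite mulr0 mul0r addr_ge0// mulr_ge0.
  have Ll : L * th * l' w <= L * th * NN.
    by apply: ler_wpM2l => //; rewrite mulr_ge0// ltW.
  have sm : \sum_(j < N) chi ((Z' w - (s + X w)) / two j) * mass j <= 4 * scut A.
    apply: le_trans (half_sum iY Y1 N A); apply: ler_sum => j _.
    apply: ler_wpM2r; first exact: ltW.
    apply: chi_homo; rewrite ler_pM2r ?invr_gt0 ?two_gt0//.
    by have := AX w; move: zZ; lra.
  have sm0 : 0 <= \sum_(j < N) chi ((Z' w - (s + X w)) / two j) * mass j.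
    by apply: sumr_ge0 => j _; exact: chim_ge0.
  have hh : L * th * l' w * \sum_(j < N) chi ((Z' w - (s + X w)) / two j) * mass j <=
      (L * th * NN) * (4 * scut A).
    by apply: ler_pM => //; rewrite mulr_ge0// ?mulr_ge0// ltW.
  apply: (le_trans hh); have [zY|pz] := enter lp.
    rewrite indicE mem_set/=; last by case/andP: zi => h _; exact: le_trans zY.
    rewrite mulr1; apply: (@le_trans _ _ (4 * L * th * NN * scut A)); last by rewrite lerDr.
    apply: eq_ler; ring.
  apply: (@le_trans _ _ (L * scut A * 16 * (Y w * peak i w))); last by rewrite lerDl mulr_ge0.
  have p4 : 1 <= 4 * (Y w * peak i w).
    apply: (@le_trans _ _ (4 * peak i w)); first by move: hpk pz; lra.
    by rewrite ler_pM2l// ler_peMl.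
  have -> : L * th * NN * (4 * scut A) = L * scut A * 4 * (th * NN) by ring.
  have -> : L * scut A * 16 * (Y w * peak i w) = L * scut A * 4 * (4 * (Y w * peak i w)) by ring.
  by apply: ler_wpM2l; [rewrite mulr_ge0// mulr_ge0// ltW|exact: le_trans p4].
have t4 : 0 <= chi (A / two j1) * (4 * (\1_[set w | two j1 <= 4 * Y w] w * peak i w)).
  apply: mulr_ge0; first by case/andP: (chi01 (A / two j1)).
  by rewrite mulr_ge0// mulr_ge0// indicE.
rewrite t1; apply: (le_trans (lerD t2 t3)).
rewrite /rhs /loss_coef mulrDr mulrDl; move: t4; lra.
Qed.

(** A drop larger than [A / 2] is caused by a step larger than [A / 2]; it costs at
most 1 because of the truncation, and one scale of the source pays for it. *)
Let far_ptw w : Num.min 1 (barrier N (Z' w) (s + X w) (l' w)) <= rhs w.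
Proof.
have A0 : 0 < A by move: A2; rewrite /A; lra.
have S0 := scut_ge0 iY Y1 A.
have /andP[pk0 pk1] := peak01 i w.
have y0 := le_trans ler01 (Y1 w).
have e0 : 0 <= 4 * (Y w * expR (- (`|z - q w| / 2))) by rewrite mulr_ge0// mulr_ge0// expR_ge0.
have hpk := peak_near w zi.
rewrite ge_min; have [h|hz] := leP (z + X w) (Z' w).
  apply/orP; right; apply: far_loss; last by apply: le_trans h; rewrite gerBl divr_ge0// ltW.
  apply: (@le_trans _ _ (\sum_(j < N) chi (A / two j) * bracket j (s + X w) (z + X w))).
    by apply: ler_sum => j _; apply: (le_trans (cutbr_homo _ _ h)); rewrite AX.
  by rewrite lerDl !mulr_ge0// ?lossK_ge0// ltW.
have zp : 0 < z + X w by exact: le_lt_trans (Z0 w) hz.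
set lam := z + X w - Z' w.
have lam0 : 0 <= lam by rewrite subr_ge0 ltW.
have lamz : lam <= z + X w by rewrite gerBl.
have zA : 0 <= (z + X w) / A by rewrite divr_ge0 ?ltW.
have zz : z + X w - lam <= Z' w by rewrite /lam opprB addrC subrK.
have A1 : 1 <= A by move: A2; rewrite /A; lra.
have zA1 : (z + X w) / A <= z + X w by rewrite ler_pdivrMr// ler_peMr// ltW.
case: (dropZ w) => [h|[lam1 hl]|[zY p2]]; first by have := lt_le_trans hz h; rewrite ltxx.
  have lA : lam <= A / 2 by apply: (le_trans lam1); move: A2; rewrite /A; lra.
  apply/orP; right; apply: far_loss; last by move: zz lA; lra.
  apply: (@far_drop w lam) => //.
  by apply: le_trans hl; rewrite ler_wpM2l// lerD2l.
have [lA|Al] := leP lam (A / 2).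
  apply/orP; right; apply: far_loss; last by move: zz lA; lra.
  apply: (@far_drop w lam) => //.
  have h1 : lam * ((z + X w) / A) <= (z + X w) / 2.
    by rewrite mulrCA; apply: ler_wpM2l; [exact: ltW|rewrite ler_pdivrMr// mulrC].
  have h2 : Y w <= Y w * (2 * expR (- (`|z - q w| / 2))) by rewrite ler_peMr.
  rewrite mulrDr mulr1; lra.
apply/orP; left.
have hY : two j1 <= 4 * Y w by case/andP: j1A => _ h; rewrite /A in Al; lra.
have c1 : chi (A / two j1) = 1.
  by case/andP: j1A => h _; rewrite chi_eq1// ler_pdivrMr ?two_gt0// mul1r.
rewrite /rhs c1 mul1r [X in 4 * (X * _)]indicE mem_set//= mul1r.
have : 0 <= \sum_(j < N) chi (A / two j) * bracket j (s + X w) (z + X w).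
  by apply: sumr_ge0 => j _; rewrite -(AX w) cutbr_ge0.
have : 0 <= L * scut A * loss_coef * (Y w * peak i w).
  rewrite mulr_ge0// ?mulr_ge0//; first exact: ltW.
  by rewrite /loss_coef addr_ge0// mulr_ge0// lossK_ge0.
have : 0 <= 4 * L * th * NN * scut A * \1_[set w | i%:R * del <= Y w] w.
  by rewrite mulr_ge0// ?indicE// !mulr_ge0// ltW.
lra.
Qed.

Let nominal j w : R := chi (A / two j) * bracket j (s + X w) (z + X w).

Let bracketE j w : bracket j (s + X w) (z + X w) =
  3 * L * mass j * V (s + 2 * two j + X w) - pot j (z + X w).
Proof. by rewrite /bracket addrAC. Qed.

Let itg_bracket j : itg (fun w => bracket j (s + X w) (z + X w)).
Proof.
by under eq_fun do rewrite bracketE; apply: itgB; [exact: itgZ|exact: itg_pot].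
Qed.

Let E_nominal j : E (nominal j) <= chi (A / two j) * (bracket j s z - c * om j i).
Proof.
rewrite /nominal ExZ//.
have [->|h] := eqVneq (chi (A / two j)) 0; first by rewrite !mul0r.
apply: ler_wpM2l; first by case/andP: (chi01 (A / two j)).
have zs := chi_gt0_lt h.
rewrite (eq_Ex P (bracketE j)) ExB; [|exact: itgZ|exact: itg_pot].
rewrite ExZ// Vharm; last by apply: ltW; exact: lt_trans z0 zs.
rewrite /bracket -addrA lerD2l -opprD lerN2.
exact: (wpot_src iX iV del0 Uhomo Uneg UV Usub Usrc (om0 j) (omM j) zi).
Qed.

Lemma far_step :
  E (fun w => Num.min 1 (barrier N (Z' w) (s + X w) (l' w))) <=
  barrier N z s 0 + (scut A - scumul N A) * (L * (loss_coef * peak_mean i + 4 * NN * th * far_prob i)).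
Proof.
have iN j : itg (nominal j) by exact: itgZ.
have iS : itg (fun w => \sum_(j < N) nominal j w) by exact: (@itg_sum _ _ _ P N nominal iN).
have i1 : itg (fun w => L * scut A * loss_coef * (Y w * peak i w)) by apply: itgZ; exact: itg_peak_mean.
have i2 : itg (fun w => 4 * L * th * NN * scut A * \1_[set w | i%:R * del <= Y w] w).
  by apply: itgZ; exact: itg_far_prob.
have i3' : itg (fun w => 4 * (\1_[set w | two j1 <= 4 * Y w] w * peak i w)).
  by apply: itgZ; exact: itg_big_mean.
have i3 : itg (fun w => chi (A / two j1) * (4 * (\1_[set w | two j1 <= 4 * Y w] w * peak i w))).
  exact: itgZ.
have i12 := itgD i1 i2; have i123 := itgD i12 i3.
have iR : itg rhs by exact: itgD iS i123.
have mb : measurable_fun [set: T] (fun w => barrier N (Z' w) (s + X w) (l' w)).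
  by apply: measurable_barrier => //; exact: measurable_funD.
have ib : itg (fun w => Num.min 1 (barrier N (Z' w) (s + X w) (l' w))).
  apply: (@itg_bnd _ _ _ _ _ 1); first exact: measurable_minr.
  move=> w; have /andP[l1 _] := l0 w.
  by rewrite ger0_norm ?ge_min ?lexx// le_min ler01 barrier_ge0.
apply: (le_trans (Ex_le ib iR far_ptw)).
rewrite /rhs (ExD iS i123) (ExD i12 i3) (ExD i1 i2).
rewrite (ExZ _ (itg_peak_mean i)) (ExZ _ (itg_far_prob i)) (ExZ _ i3') (ExZ _ (itg_big_mean j1 i)).
rewrite (@Ex_sum _ _ _ P N nominal iN) -/(peak_mean i) -/(far_prob i) -/(big_mean j1 i).
have hs : \sum_(j < N) E (nominal j) <= barrier N z s 0 -
    L * (loss_coef * peak_mean i + 4 * NN * th * far_prob i) * scumul N A - chi (A / two j1) * (4 * big_mean j1 i).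
  have big0 j : 0 <= big_mean j i.
    apply: Ex_ge0 => w; rewrite mulr_ge0 ?indicE//; by case/andP: (peak01 i w).
  have -> : barrier N z s 0 = \sum_(j < N) chi (A / two j) * bracket j s z.
    by apply: eq_bigr => j _; rewrite /term mulr0 addr0.
  have h1 : chi (A / two j1) * (4 * big_mean j1 i) <= \sum_(j < N) chi (A / two j) * (4 * big_mean j i).
    rewrite (bigD1 (Ordinal j1N))//= lerDl sumr_ge0// => j _.
    apply: mulr_ge0; first by case/andP: (chi01 (A / two j)).
    by rewrite mulr_ge0.
  rewrite -addrA -opprD lerBrDr;
  have h2 : \sum_(j < N) E (nominal j) <= \sum_(j < N) chi (A / two j) * (bracket j s z - c * om j i).
    by apply: ler_sum => j _; exact: E_nominal.
  apply: (le_trans (lerD h2 (lerD (lexx _) h1))).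
  rewrite /scumul mulr_sumr -!big_split/= le_eqVlt; apply/orP; left; apply/eqP.
  apply: eq_bigr => j _; rewrite om_src; ring.
rewrite -/A in hs *.
apply: (le_trans (lerD hs (lexx _))).
apply: eq_ler; ring.
Qed.

End far_step.

Lemma min1_ge (y A b : R) : 0 <= b -> b <= y -> b <= A * (3 / 2) -> 0 < A ->
  b / A <= 3 / 2 * Num.min 1 (y / A).
Proof.
move=> b0 by_ bA A0; rewrite minEle; case: ifPn => _.
  by rewrite mulr1 ler_pdivrMr// mulrC.
apply: (@le_trans _ _ (y / A)); first by rewrite ler_pM2r ?invr_gt0.
have yA0 : 0 <= y / A by apply: divr_ge0; [exact: le_trans by_|exact: ltW].
by move: yA0; move: (y / A) => k; lra.
Qed.

(** Moving the cutoff from [A] to [A - x] has a first order effect, linear in [x],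
whose expectation vanishes for centred [x]; the rest is a truncated mean. *)
Lemma cutV_shift (A x y t : R) : 2 <= A -> x <= A / 2 -> 1 + `|x| <= y -> 0 < t ->
  chi ((A - x) / t) * V (2 * t - A + x) <=
  chi (A / t) * V (2 * t - A + x) +
  (A / 4 <= t < A)%R%:R * (x / t * V (2 * t - A) + 8 * Vc * (y * Num.min 1 (y / A))).
Proof.
move=> A2 xA xy t0; have A0 : 0 < A by lra.
have x0 := normr_ge0 x; have y0 : 0 <= y by lra.
have mn0 : 0 <= Num.min 1 (y / A) by rewrite le_min ler01 divr_ge0// ltW.
have [tA|tA] := leP A t.
  rewrite andbF mul0r addr0 (@chi_eq1 _ (A / t)); last by rewrite ler_pdivrMr// mul1r.
  by apply: ler_wpM2r => //; case/andP: (chi01 ((A - x) / t)).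
have [At|At] := leP (A / 4) t; last first.
  rewrite mul0r addr0 chi_eq0 ?mul0r; last by rewrite ler_pdivlMr//; lra.
  by apply: mulr_ge0 => //; case/andP: (chi01 (A / t)).
rewrite mul1r.
have tinv : t^-1 <= 4 / A.
  by rewrite ler_pdivlMr// mulrC ler_pdivrMr//; lra.
(* the error terms are all of the form x * V(b) / t with b below both x and A *)
have err b : 0 <= b -> b <= `|x| -> b <= A -> `|x| / t * V b <= 8 * Vc * (y * Num.min 1 (y / A)).
  move=> b0 bx bA; apply: (@le_trans _ _ (`|x| * (4 / A) * (Vc * (1 + b)))).
    apply: ler_pM => //; first by rewrite divr_ge0// ltW.
      by rewrite ler_wpM2l.
    exact: Vlin.
  have -> : `|x| * (4 / A) * (Vc * (1 + b)) = 4 * Vc * (`|x| * ((1 + b) / A)) by ring.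
  apply: (@le_trans _ _ (4 * Vc * (y * (3 / 2 * Num.min 1 (y / A))))).
    apply: ler_wpM2l; first by rewrite mulr_ge0.
    apply: ler_pM => //; [by rewrite divr_ge0 ?addr_ge0// ltW|by lra|].
    apply: min1_ge => //; [by rewrite addr_ge0|by lra|by lra].
  have -> : 4 * Vc * (y * (3 / 2 * Num.min 1 (y / A))) = 6 * (Vc * (y * Num.min 1 (y / A))) by move: (Num.min _ _) => k; field.
  have -> : 8 * Vc * (y * Num.min 1 (y / A)) = 8 * (Vc * (y * Num.min 1 (y / A))) by ring.
  by apply: ler_wpM2r; rewrite ?mulr_ge0// ler_nat.
rewrite -lerBlDl -mulrBl.
have err0 : 0 <= 8 * Vc * (y * Num.min 1 (y / A)) by rewrite !mulr_ge0.
have [xp|xn] := leP 0 x.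
  rewrite ger0_norm// in err.
  have d0 : 0 <= chi ((A - x) / t) - chi (A / t).
    by rewrite subr_ge0 chi_homo// ler_pM2r ?invr_gt0// gerBl.
  have dx : chi ((A - x) / t) - chi (A / t) <= x / t.
    have -> : x / t = A / t - (A - x) / t by rewrite -mulrBl opprB addrC subrK.
    by apply: chi_lip; rewrite ler_pM2r ?invr_gt0// gerBl.
  apply: (@le_trans _ _ (x / t * (V (2 * t - A) + V x))).
    by apply: ler_pM => //; exact: Vsub.
  by rewrite mulrDr lerD2l; apply: err => //; lra.
have {}x0 : 0 < - x by rewrite oppr_gt0.
rewrite ltr0_norm// in err.
have cc : chi ((A - x) / t) - chi (A / t) <= 0.
  by rewrite subr_le0 chi_homo// ler_pM2r ?invr_gt0//; lra.
have cV : (chi ((A - x) / t) - chi (A / t)) * V (2 * t - A + x) <= 0 by rewrite mulr_le0_ge0.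
have [yn|yp] := ltP (2 * t - A) 0.
  by rewrite (Vneg yn) mulr0 add0r; exact: le_trans cV err0.
have [xy2|xy2] := leP (- x) (2 * t - A); last first.
  apply: (le_trans cV).
  have := err (2 * t - A) yp (ltW xy2); rewrite mulNr mulNr => h; rewrite addrC -lerBlDr sub0r; apply: h.
  by move: tA; lra.
have -> : chi ((A - x) / t) - chi (A / t) = x / t.
  have e1 : chi (A / t) = 2 - A / t.
    rewrite chiE; have -> : (A / t <= 1) = false by rewrite ler_pdivrMr// mul1r leNgt tA.
    case: ifPn => //; rewrite ler_pdivlMr// => h.
    have -> : A = 2 * t by apply/eqP; rewrite eq_le h andbT; lra.
    by rewrite mulfK ?subrr// gt_eqF.
  have e2 : chi ((A - x) / t) = 2 - (A - x) / t.
    rewrite chiE; have -> : ((A - x) / t <= 1) = false.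
      by rewrite ler_pdivrMr// mul1r; apply/negbTE; rewrite -ltNge; lra.
    case: ifPn => //; rewrite ler_pdivlMr// => h.
    have -> : A - x = 2 * t by apply/eqP; rewrite eq_le h andbT; lra.
    by rewrite mulfK ?subrr// gt_eqF.
  by rewrite e1 e2 mulrBl; ring.
have vs : V (2 * t - A) <= V (2 * t - A + x) + V (- x).
  by have := Vsub (2 * t - A + x) (ltW x0); rewrite addrK.
have xt : x / t <= 0 by rewrite mulr_le0_ge0 ?invr_ge0// ltW.
have := err (- x) (ltW x0) (lexx _).
have h1 : x / t * V (2 * t - A + x) <= x / t * (V (2 * t - A) - V (- x)).
  by rewrite ler_wnM2l// lerBlDr.
rewrite mulrBr in h1; rewrite mulNr mulNr => h; apply: (le_trans h1); rewrite lerD2l; apply: h.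
by move: tA; lra.
Qed.

Lemma cut_shift (A x y t : R) : 0 < A -> x <= A / 2 -> `|x| <= y -> 0 < t ->
  chi ((A - x) / t) <= chi (A / t) + (A / 4 <= t)%R%:R * (4 * y / A).
Proof.
move=> A0 xA xy t0; have [At|At] := leP (A / 4) t; last first.
  by rewrite mul0r addr0 chi_eq0 ?ler_pdivlMr//; [case/andP: (chi01 (A / t))|lra].
have y0 : 0 <= y := le_trans (normr_ge0 _) xy.
have xn := le_trans (ler_norm x) xy.
rewrite mul1r -lerBlDl.
have hy : y / t <= 4 * y / A.
  rewrite ler_pdivrMr// mulrAC ler_pdivlMr//.
  by rewrite [leRHS]mulrAC mulrC; apply: ler_wpM2r => //; lra.
have [x0|x0] := leP 0 x.
  apply: le_trans hy; apply: (@le_trans _ _ (x / t)); last by rewrite ler_pM2r ?invr_gt0.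
  have -> : x / t = A / t - (A - x) / t by rewrite -mulrBl opprB addrC subrK.
  by apply: chi_lip; rewrite ler_pM2r ?invr_gt0// gerBl.
apply: (@le_trans _ _ 0); last by apply: le_trans hy; rewrite divr_ge0// ltW.
by rewrite subr_le0 chi_homo// ler_pM2r ?invr_gt0//; lra.
Qed.

(** In the ball, the errors due to the cutoffs are compensated by the function [l]. *)
Section ball_step.
Variables (s l eta : R) (j1 N : nat) (Z' l' : T -> R).
Local Notation A := (- s).
Hypothesis A2 : 2 <= A.
Hypotheses (mZ : measurable_fun [set: T] Z') (ml : measurable_fun [set: T] l').
Hypotheses (Z0 : forall w, 0 <= Z' w) (l0 : forall w, 0 <= l' w <= NN).
Hypothesis El : E l' <= l - eta.
Hypotheses (j1A : A <= two j1 < 2 * A).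
Hypothesis small1 : 384 * Vc * trunc_mean P Y A <= th * eta / 8.
Hypothesis small2 : 64 * NN * (E Y / A) <= eta / 8.
Hypothesis Lbig : 16 <= L * th * eta / 4.

Let b j : R := (A / 4 <= two j < A)%R%:R.
Let tY w : R := Y w * Num.min 1 (Y w / A).
Let part j w : R := chi (A / two j) * (3 * L * mass j * V (s + 2 * two j + X w)) +
   (b j * (3 * L * mass j) * (V (s + 2 * two j) / two j * X w + 8 * Vc * tY w) +
    L * th * (chi (A / two j) * mass j) * l' w).
Let hit w : R := \1_[set w | two j1 <= 4 * Y w] w.

Let A0 : 0 < A. Proof. by apply: lt_le_trans A2. Qed.
Let S0 : 0 <= scut A. Proof. exact: scut_ge0. Qed.
Let b0 j : 0 <= b j. Proof. by rewrite /b. Qed.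
Let tY0 w : 0 <= tY w.
Proof.
have y0 := le_trans ler01 (Y1 w).
by rewrite mulr_ge0// le_min ler01 divr_ge0// ltW.
Qed.

(** A step larger than [A / 2] costs at most 1, and its probability is of order
[scut A]. *)
Let ball_ptw w : Num.min 1 (barrier N (Z' w) (s + X w) (l' w)) <=
  \sum_(j < N) part j w + (64 * L * th * NN * scut A / A * Y w + hit w).
Proof.
have /andP[l1 l2] := l0 w; have yx := YX w; have y0 := le_trans ler01 (Y1 w).
have Lt : 0 <= L * th by rewrite mulr_ge0// ltW.
have c64 : 0 <= 64 * L * th * NN * scut A / A * Y w.
  by apply: mulr_ge0 => //; apply: divr_ge0; [rewrite !mulr_ge0// ltW|exact: ltW].
have hit0 : 0 <= hit w by rewrite /hit indicE.
rewrite ge_min; have [xA|Ax] := leP (X w) (A / 2); apply/orP; [right|left]; last first.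
  have xp : 0 < X w by apply: le_lt_trans Ax; rewrite divr_ge0// ltW.
  have -> : hit w = 1.
    rewrite /hit indicE mem_set//=; case/andP: j1A => _ h.
    by have := ler_norm (X w); lra.
  rewrite addrA lerDr addr_ge0// sumr_ge0// => j _.
  have cj : 0 <= chi (A / two j) by case/andP: (chi01 (A / two j)).
  have t0 := two_gt0 R j.
  have p1 : 0 <= chi (A / two j) * (3 * L * mass j * V (s + 2 * two j + X w)).
    by apply: mulr_ge0 => //; exact: mulr_ge0.
  have p2 : 0 <= V (s + 2 * two j) / two j * X w + 8 * Vc * tY w.
    apply: addr_ge0; last exact: mulr_ge0 (mulr_ge0 (ler0n _ 8) Vc0) (tY0 w).
    exact: mulr_ge0 (divr_ge0 (V_ge0 _) (ltW t0)) (ltW xp).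
  have p3 : 0 <= L * th * (chi (A / two j) * mass j) * l' w.
    by apply: mulr_ge0 => //; apply: mulr_ge0 => //; exact: chim_ge0.
  rewrite /part; apply: addr_ge0 => //; apply: addr_ge0 => //.
  by apply: mulr_ge0 => //; exact: mulr_ge0.
have AX : 0 - (s + X w) = A - X w by rewrite sub0r opprD.
have h1 j : term j (Z' w) (s + X w) (l' w) <=
    chi ((A - X w) / two j) * (3 * L * mass j * V (s + X w + 2 * two j)) +
    chi ((A - X w) / two j) * (L * mass j * th * l' w).
  rewrite /term mulrDr lerD//.
    apply: (le_trans (cutbr_homo _ _ (Z0 w))); rewrite AX ler_wpM2l//.
      by case/andP: (chi01 ((A - X w) / two j)).
    exact: bracket_le.
  apply: ler_wpM2r; first by rewrite mulr_ge0// mulr_ge0 ?mulr_ge0// ltW.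
  by apply: chi_homo; rewrite ler_pM2r ?invr_gt0 ?two_gt0//; have := Z0 w; lra.
have h2 j : chi ((A - X w) / two j) * (3 * L * mass j * V (s + X w + 2 * two j)) <=
   chi (A / two j) * (3 * L * mass j * V (s + 2 * two j + X w)) +
   b j * (3 * L * mass j) * (V (s + 2 * two j) / two j * X w + 8 * Vc * tY w).
  have := cutV_shift A2 xA yx (two_gt0 R j).
  have -> : 2 * two j - A + X w = s + X w + 2 * two j by ring.
  have -> : 2 * two j - A = s + 2 * two j by ring.
  rewrite -/(b j) -/(tY w) => h.
  rewrite mulrCA; apply: (le_trans (ler_wpM2l (L3 j) h)).
  have -> : s + 2 * two j + X w = s + X w + 2 * two j by ring.
  apply: eq_ler; ring.
have h3 j : chi ((A - X w) / two j) * (L * mass j * th * l' w) <=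
   L * th * (chi (A / two j) * mass j) * l' w +
   L * th * NN * (4 * Y w / A) * ((A / 4 <= two j)%R%:R * mass j).
  have xy : `|X w| <= Y w by move: yx; lra.
  have Lm : 0 <= L * mass j * th * l' w by rewrite !mulr_ge0// ltW.
  apply: (le_trans (ler_wpM2r Lm (cut_shift A0 xA xy (two_gt0 R j)))).
  rewrite mulrDl; apply: lerD; first by apply: eq_ler; ring.
  have -> : (A / 4 <= two j)%R%:R * (4 * Y w / A) * (L * mass j * th * l' w) =
     L * th * (4 * Y w / A) * ((A / 4 <= two j)%R%:R * mass j) * l' w by ring.
  have -> : L * th * NN * (4 * Y w / A) * ((A / 4 <= two j)%R%:R * mass j) =
     L * th * (4 * Y w / A) * ((A / 4 <= two j)%R%:R * mass j) * NN by ring.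
  apply: ler_wpM2l => //; apply: mulr_ge0; last by rewrite mulr_ge0// ltW.
  by apply: mulr_ge0 => //; rewrite divr_ge0// ?mulr_ge0// ltW.
apply: (@le_trans _ _ (\sum_(j < N) (part j w + L * th * NN * (4 * Y w / A) * ((A / 4 <= two j)%R%:R * mass j)))).
  apply: ler_sum => j _; apply: (le_trans (h1 j)); apply: (le_trans (lerD (h2 j) (h3 j))).
  by rewrite /part !addrA.
rewrite big_split/= lerD2l -mulr_sumr.
apply: (@le_trans _ _ (L * th * NN * (4 * Y w / A) * (16 * scut A))).
  apply: ler_wpM2l; last exact: quarter_sum.
  apply: mulr_ge0; first by rewrite mulr_ge0.
  by rewrite divr_ge0// ?mulr_ge0// ltW.
rewrite -[leLHS]addr0 lerD//; apply: eq_ler; ring.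
Qed.

Lemma ball_step :
  E (fun w => Num.min 1 (barrier N (Z' w) (s + X w) (l' w))) <=
  barrier N 0 s l - L * th * eta * scumul N A + L * th * eta / 2 * scut A.
Proof.
have y0 w := le_trans ler01 (Y1 w).
have il : itg l'.
  by apply: (@itg_bnd _ _ _ _ _ NN) => // w; case/andP: (l0 w) => ? ?; rewrite ger0_norm.
have itY : itg tY by apply: itg_trunc.
have ihit : itg hit by apply: itg_indic; apply: measurable_le_set => //; exact: measurable_funM.
have i1 j : itg (fun w => chi (A / two j) * (3 * L * mass j * V (s + 2 * two j + X w))).
  by apply: itgZ; apply: itgZ.
have i2X j : itg (fun w => V (s + 2 * two j) / two j * X w) by exact: itgZ.
have i2t : itg (fun w => 8 * Vc * tY w) by exact: itgZ.
have i2' j := itgD (i2X j) i2t.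
have i2 j := itgZ (b j * (3 * L * mass j)) (i2' j).
have i3 j : itg (fun w => L * th * (chi (A / two j) * mass j) * l' w) by exact: itgZ.
have i23 j := itgD (i2 j) (i3 j).
have ip j : itg (part j) by exact: itgD (i1 j) (i23 j).
have iS : itg (fun w => \sum_(j < N) part j w) by exact: (@itg_sum _ _ _ P N part ip).
have i4 : itg (fun w => 64 * L * th * NN * scut A / A * Y w) by exact: itgZ.
have i5 := itgD i4 ihit; have iR := itgD iS i5.
have mb : measurable_fun [set: T] (fun w => barrier N (Z' w) (s + X w) (l' w)).
  by apply: measurable_barrier => //; exact: measurable_funD.
have ib : itg (fun w => Num.min 1 (barrier N (Z' w) (s + X w) (l' w))).
  apply: (@itg_bnd _ _ _ _ _ 1); first exact: measurable_minr.
  move=> w; have /andP[l1 _] := l0 w.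
  by rewrite ger0_norm ?ge_min ?lexx// le_min ler01 barrier_ge0.
apply: (le_trans (Ex_le ib iR ball_ptw)).
rewrite (ExD iS i5) (ExD i4 ihit) (ExZ _ iY) (@Ex_sum _ _ _ P N part ip).
have hhit : E hit <= 16 * scut A.
  have h41 : 1 <= 4 :> R by rewrite ler1n.
  have h4 := mass_tail iY j1 h41.
  have {}h4 : E hit <= 4 ^+ 2 * mass j1 by exact: h4.
  apply: (le_trans h4).
  have -> : 4 ^+ 2 = 16 :> R by ring.
  by rewrite ler_pM2l//; apply: scut_ge => //; case/andP: j1A.
have Ep j : E (part j) <= chi (A / two j) * (bracket j s 0 + L * mass j * th * l) -
    L * th * eta * (chi (A / two j) * mass j) +
    24 * Vc * L * trunc_mean P Y A * ((A / 4 <= two j)%R%:R * mass j).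
  rewrite /part (ExD (i1 j) (i23 j)) (ExD (i2 j) (i3 j)) (ExZ _ (i2' j)) (ExD (i2X j) i2t).
  rewrite (ExZ _ iX) EX0 mulr0 add0r (ExZ _ itY) (ExZ _ il) (ExZ _ (itgZ _ (iV _))) (ExZ _ (iV _)).
  have cj : 0 <= chi (A / two j) by case/andP: (chi01 (A / two j)).
  have -> : bracket j s 0 = 3 * L * mass j * V (s + 2 * two j) by rewrite /bracket pot_neg// subr0.
  have e1 : chi (A / two j) * (3 * L * mass j * E (fun t => V (s + 2 * two j + X t))) =
            chi (A / two j) * (3 * L * mass j * V (s + 2 * two j)).
    have [->|h] := eqVneq (chi (A / two j)) 0; first by rewrite !mul0r.
    by rewrite Vharm// ltW//; apply: chi_gt0_lt; rewrite sub0r.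
  rewrite e1.
  have e2 : b j * (3 * L * mass j) * (8 * Vc * E tY) <=
    24 * Vc * L * trunc_mean P Y A * ((A / 4 <= two j)%R%:R * mass j).
    have -> : b j * (3 * L * mass j) * (8 * Vc * E tY) =
      24 * Vc * L * trunc_mean P Y A * (b j * mass j) by rewrite /trunc_mean -/tY; ring.
    apply: ler_wpM2l.
      by rewrite !mulr_ge0// ?(ltW L0)//; apply: trunc_mean_ge0 => //; exact: ltW.
    rewrite ler_wpM2r ?(ltW (m0 j))// /b.
    by case: (A / 4 <= _); case: (_ < _); rewrite ?lexx ?ler01.
  have e3 : L * th * (chi (A / two j) * mass j) * E l' <= L * th * (chi (A / two j) * mass j) * (l - eta).
    by apply: ler_wpM2l => //; apply: mulr_ge0; apply: mulr_ge0 => //; exact: ltW.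
  apply: (le_trans (lerD (lexx _) (lerD e2 e3))).
  apply: eq_ler; ring.
have hs : \sum_(j < N) E (part j) <= barrier N 0 s l - L * th * eta * scumul N A +
    24 * Vc * L * trunc_mean P Y A * (16 * scut A).
  apply: (@le_trans _ _ (\sum_(j < N) (chi (A / two j) * (bracket j s 0 + L * mass j * th * l) -
    L * th * eta * (chi (A / two j) * mass j) +
    24 * Vc * L * trunc_mean P Y A * ((A / 4 <= two j)%R%:R * mass j)))).
    by apply: ler_sum => j _; exact: Ep.
  rewrite big_split/= sumrB -mulr_sumr -[X in _ + X <= _]mulr_sumr.
  have -> : \sum_(i < N) chi (A / two i) * (bracket i s 0 + L * mass i * th * l) = barrier N 0 s l.
    by apply: eq_bigr => j _; rewrite /term sub0r.
  rewrite lerD2l; apply: ler_wpM2l; last exact: quarter_sum.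
  by rewrite !mulr_ge0// ?(ltW L0)//; apply: trunc_mean_ge0 => //; exact: ltW.
have k1 : 24 * Vc * L * trunc_mean P Y A * (16 * scut A) <= L * scut A * (th * eta / 8).
  have -> : 24 * Vc * L * trunc_mean P Y A * (16 * scut A) = L * scut A * (384 * Vc * trunc_mean P Y A) by ring.
  by rewrite ler_wpM2l// mulr_ge0// ltW.
have k2 : 64 * L * th * NN * scut A / A * E Y <= L * scut A * (th * eta / 8).
  have -> : 64 * L * th * NN * scut A / A * E Y = L * scut A * th * (64 * NN * (E Y / A)) by ring.
  have -> : L * scut A * (th * eta / 8) = L * scut A * th * (eta / 8) by ring.
  by rewrite ler_wpM2l// mulr_ge0 ?mulr_ge0// ltW.
have k3 : 16 * scut A <= L * th * eta / 4 * scut A by rewrite ler_wpM2r.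
apply: (le_trans (lerD hs (lerD k2 hhit))).
apply: (le_trans (lerD (lerD (lexx _) k1) (lerD (lexx _) k3))).
apply: eq_ler; by field.
Qed.

End ball_step.

(** The estimates pass to the limit in the number of scales. *)
Section limit.
Variable j0 : nat.
Hypotheses (j02 : 2 <= two j0) (Lj0 : 1 <= L * mass j0).

Definition profile z s l : R := limn (fun N => Num.min 1 (barrier N z s l)).

Let cut_homo z s l : 0 <= z -> 0 <= l ->
  {homo (fun N => Num.min 1 (barrier N z s l)) : m n / (m <= n)%N >-> m <= n}.
Proof.
move=> z0 l0 m n mn; rewrite le_min ge_min lexx/= ge_min; apply/orP; right.
exact: barrier_homo.
Qed.

Lemma profile_cvg z s l : 0 <= z -> 0 <= l ->
  Num.min 1 (barrier N z s l) @[N --> \oo] --> profile z s l.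
Proof.
move=> z0 l0; apply: nondecreasing_is_cvgn; first exact: cut_homo.
by exists 1 => _ [N _ <-]; rewrite ge_min lexx.
Qed.

Lemma cut_le_profile N z s l : 0 <= z -> 0 <= l ->
  Num.min 1 (barrier N z s l) <= profile z s l.
Proof.
move=> z0 l0; apply: (nondecreasing_cvgn_le (cut_homo s z0 l0)).
by apply/cvg_ex; exists (profile z s l); exact: profile_cvg.
Qed.

Lemma profile_le z s l e : 0 <= z -> 0 <= l ->
  (forall N, Num.min 1 (barrier N z s l) <= e) -> profile z s l <= e.
Proof.
move=> z0 l0 h; apply: limr_le; last exact: nearW.
by apply/cvg_ex; exists (profile z s l); exact: profile_cvg.
Qed.

Lemma profile01 z s l : 0 <= z -> 0 <= l -> 0 <= profile z s l <= 1.
Proof.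
move=> z0 l0; apply/andP; split; last by apply: profile_le => // N; rewrite ge_min lexx.
apply: le_trans (cut_le_profile 0 s z0 l0).
by rewrite le_min ler01 barrier_ge0.
Qed.

Lemma profile_lt1 z s l : 0 <= z -> 0 <= l -> profile z s l < 1 ->
  barrier N z s l @[N --> \oo] --> profile z s l.
Proof.
move=> z0 l0 h.
suff <- : (fun N => Num.min 1 (barrier N z s l)) = (fun N => barrier N z s l).
  exact: profile_cvg.
apply/funext => N; have := le_lt_trans (cut_le_profile N s z0 l0) h.
by rewrite minEle; case: ifPn => //; rewrite ltxx.
Qed.

(** The barrier is at least [L * scut A], so that it is below 1 only where [A] is
large; this is what gives a meaning to asymptotic estimates in [A]. *)
Lemma profile_high z s l : 0 <= z -> 0 <= l -> profile z s l < 1 -> two j0 < z - s.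
Proof.
move=> z0 l0 h; rewrite ltNge; apply/negP => zs.
have := le_lt_trans (cut_le_profile j0.+1 s z0 l0) h.
apply/negP; rewrite -leNgt le_min lexx/=.
apply: (le_trans _ (barrier_ge j0.+1 s z0 l0)); apply: (le_trans Lj0).
rewrite ler_pM2l// /scumul big_ord_recr/= chi_eq1 ?ler_pdivrMr ?two_gt0 ?mul1r//.
by rewrite lerDr sumr_ge0// => i _; exact: chim_ge0.
Qed.

Lemma measurable_profile d1 (S : measurableType d1) (z s l : S -> R) :
  (forall u, 0 <= z u) -> (forall u, 0 <= l u) ->
  measurable_fun [set: S] z -> measurable_fun [set: S] s -> measurable_fun [set: S] l ->
  measurable_fun [set: S] (fun u => profile (z u) (s u) (l u)).
Proof.
move=> z0 l0 mz ms ml.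
apply: (@measurable_fun_cvg _ _ _ setT (fun N u => Num.min 1 (barrier N (z u) (s u) (l u)))).
  by move=> N; apply: measurable_minr => //; exact: measurable_barrier.
by move=> u _; exact: profile_cvg.
Qed.

(** At fixed height, [A] tends to infinity with [- s] and only the scales above [A]
remain, each of size [2 ^ j * mass j]. *)
Lemma profile_vanish z l e : 0 <= z -> 0 <= l -> 0 < e ->
  exists s0, forall s, s <= s0 -> profile z s l <= e.
Proof.
move=> z0 l0 e0; pose k := 9 * L * Vc + L * th * l + 1.
have kk : 0 <= L * th * l by rewrite !mulr_ge0// ltW.
have kv : 0 <= 9 * L * Vc by rewrite !mulr_ge0// ltW.
have k0 : 0 < k by rewrite /k; lra.
have [j2 hj] := mass_tail_cvg iY Y1 (divr_gt0 e0 k0).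
exists (Num.min 0 (z - 2 * two j2)) => s; rewrite le_min => /andP[s0 sz].
apply: profile_le => // N; rewrite ge_min; apply/orP; right.
apply: (@le_trans _ _ (k * \sum_(j < N) (j2 <= j)%N%:R * (two j * mass j))); last first.
  by rewrite mulrC -ler_pdivlMr.
rewrite mulr_sumr; apply: ler_sum => j _; rewrite /term.
have [jj|jj] := leqP j2 j; last first.
  rewrite mul0r mulr0 chi_eq0 ?mul0r// ler_pdivlMr ?two_gt0//.
  have := @two_homo R _ _ (ltnW jj); move: sz; lra.
have t1 := two_ge1 R j; have /andP[c0' c1'] := chi01 ((z - s) / two j).
rewrite mul1r.
have [->|h] := eqVneq (chi ((z - s) / two j)) 0.
  by rewrite mul0r mulr_ge0 ?mulr_ge0// ltW// two_gt0.
have Vb : V (s + 2 * two j) <= Vc * (3 * two j).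
  have h1 : s + 2 * two j <= 2 * two j by rewrite gerDr.
  apply: (le_trans (Vhomo h1)); apply: (le_trans (Vlin _)).
    by rewrite mulr_ge0// (le_trans ler01).
  by rewrite ler_wpM2l//; lra.
have mj := ltW (m0 j).
have B0 : 0 <= bracket j s z + L * mass j * th * l.
  by rewrite addr_ge0 ?(bracket_ge0 (chi_gt0_lt h))// !mulr_ge0// ltW.
apply: (@le_trans _ _ (bracket j s z + L * mass j * th * l)); first by rewrite ler_piMl.
apply: (@le_trans _ _ (3 * L * mass j * (Vc * (3 * two j)) + L * mass j * th * l)).
  by rewrite lerD2r (le_trans (bracket_le _ _ _))// ler_wpM2l.
have h3 : L * mass j * th * l <= L * th * l * (two j * mass j).
  have -> : L * mass j * th * l = L * th * l * (1 * mass j) by ring.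
  by rewrite ler_wpM2l// ler_wpM2r.
have h4 : 0 <= two j * mass j by rewrite mulr_ge0// ltW// two_gt0.
have -> : 3 * L * mass j * (Vc * (3 * two j)) = 9 * L * Vc * (two j * mass j) by ring.
have -> : k * (two j * mass j) =
  9 * L * Vc * (two j * mass j) + L * th * l * (two j * mass j) + two j * mass j by rewrite /k; ring.
by rewrite -[leLHS]addr0 lerD// lerD.
Qed.

Lemma step_limit z s l (Z' l' : T -> R) (j1 : nat) (u : nat -> R) (v : R) :
  0 <= z -> 0 <= l -> profile z s l < 1 ->
  measurable_fun [set: T] Z' -> measurable_fun [set: T] l' ->
  (forall w, 0 <= Z' w) -> (forall w, 0 <= l' w) ->
  (forall N, (j1 < N)%N ->
    E (fun w => Num.min 1 (barrier N (Z' w) (s + X w) (l' w))) <= barrier N z s l + u N) ->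
  u N @[N --> \oo] --> v ->
  E (fun w => profile (Z' w) (s + X w) (l' w)) <= profile z s l + v.
Proof.
move=> z0 l0 p1 mZ ml Z0 l0' hN uv.
have c1 : barrier N z s l + u N @[N --> \oo] --> profile z s l + v.
  by apply: cvgD => //; exact: profile_lt1.
have c2 : E (fun w => Num.min 1 (barrier N (Z' w) (s + X w) (l' w))) @[N --> \oo] -->
     E (fun w => profile (Z' w) (s + X w) (l' w)).
  have ms : measurable_fun [set: T] (fun w => s + X w) by exact: measurable_funD.
  apply: (@Ex_dct _ _ _ P (fun N w => Num.min 1 (barrier N (Z' w) (s + X w) (l' w))) _ (cst 1)).
  - by move=> N; apply: measurable_minr => //; exact: measurable_barrier.
  - exact: measurable_profile.
  - by move=> w; exact: profile_cvg.
  - exact: itg_cst.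
  - by move=> N w; rewrite ger0_norm ?ge_min ?lexx// le_min ler01 barrier_ge0.
apply: (ler_cvg_to c2 c1); exists j1.+1 => // N /= jN; exact: hN.
Qed.

Lemma profile_far z s (Z' l' : T -> R) : 0 < z -> profile z s 0 < 1 ->
  measurable_fun [set: T] Z' -> measurable_fun [set: T] l' ->
  (forall w, 0 <= Z' w) -> (forall w, 0 <= l' w <= NN) ->
  (forall w, height_drop z w (Z' w)) ->
  (forall w, 0 < l' w -> z <= Y w \/ 1 <= 2 * expR (- (`|z - q w| / 2))) ->
  E (fun w => profile (Z' w) (s + X w) (l' w)) <= profile z s 0.
Proof.
move=> z0 p1 mZ ml Z0 l0 hd he; have zA := profile_high (ltW z0) (lexx _) p1.
have A2 : 2 <= z - s by exact: le_trans j02 (ltW zA).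
have [j1 hj1] : exists j, z - s <= two j < 2 * (z - s).
  by apply: two_between; apply: le_trans A2; rewrite ler1n.
pose i := Num.truncn (z / del).
have zi : i%:R * del <= z < i.+1%:R * del.
  rewrite -ler_pdivlMr// -ltr_pdivrMr//.
  by apply: truncn_itv; apply: divr_ge0; exact: ltW.
rewrite -[leRHS]addr0.
apply: (@step_limit z s 0 Z' l' j1 (fun N => (scut (z - s) - scumul N (z - s)) *
   (L * (loss_coef * peak_mean i + 4 * NN * th * far_prob i)))) => //.
- exact: ltW.
- by move=> w; case/andP: (l0 w).
- move=> N jN; exact: (far_step z0 zi A2 mZ ml Z0 l0 hd he hj1 jN).
rewrite -[X in _ --> X](mul0r (L * (loss_coef * peak_mean i + 4 * NN * th * far_prob i))).
apply: cvgMl; rewrite -(subrr (scut (z - s))).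
by apply: cvgB; [exact: cvg_cst|exact: scumul_cvg].
Qed.

Variable eta : R.
Hypothesis eta0 : 0 < eta.
Hypothesis small1 : forall A, two j0 <= A -> 384 * Vc * trunc_mean P Y A <= th * eta / 8.
Hypothesis small2 : forall A, two j0 <= A -> 64 * NN * (E Y / A) <= eta / 8.
Hypothesis Lbig : 16 <= L * th * eta / 4.

Lemma profile_ball s l (Z' l' : T -> R) : 0 <= l -> profile 0 s l < 1 ->
  measurable_fun [set: T] Z' -> measurable_fun [set: T] l' ->
  (forall w, 0 <= Z' w) -> (forall w, 0 <= l' w <= NN) -> E l' <= l - eta ->
  E (fun w => profile (Z' w) (s + X w) (l' w)) <= profile 0 s l - L * th * eta / 2 * scut (- s).
Proof.
move=> lp p1 mZ ml Z0 l0 El; have zA := profile_high (lexx _) lp p1; rewrite sub0r in zA.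
have A2 : 2 <= - s by exact: le_trans j02 (ltW zA).
have [j1 hj1] : exists j, - s <= two j < 2 * - s.
  by apply: two_between; apply: le_trans A2; rewrite ler1n.
apply: (@step_limit 0 s l Z' l' 0 (fun N => - (L * th * eta * scumul N (- s)) + L * th * eta / 2 * scut (- s))) => //.
- by move=> w; case/andP: (l0 w).
- move=> N _; rewrite addrA; apply: (ball_step (j1 := j1)) => //.
    exact: small1 (ltW zA).
  exact: small2 (ltW zA).
have -> : - (L * th * eta / 2 * scut (- s)) =
   - (L * th * eta * scut (- s)) + L * th * eta / 2 * scut (- s) by field.
apply: cvgD; last exact: cvg_cst.
apply: cvgN; apply: cvgMr; exact: scumul_cvg.
Qed.

End limit.

End barrier.

(** * Choice of the constants *)
Section peak_sums.
Variables (R : realType) (del : R).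
Hypothesis del0 : 0 < del.

Let r : R := expR (- (del / 2)).
Definition geo : R := (1 - r)^-1.

Let r01 : 0 < r < 1.
Proof. by rewrite /r expR_gt0 -[ltRHS](expR0 R) ltr_expR oppr_lt0 divr_gt0. Qed.

Lemma geo_gt0 : 0 < geo.
Proof. by have /andP[r0 r1] := r01; rewrite invr_gt0 subr_gt0. Qed.

Let geoE : geo * r + 1 = geo.
Proof.
have /andP[r0 r1] := r01; have h : geo * (1 - r) = 1 by rewrite mulVf// subr_eq0 gt_eqF.
by move: h; rewrite mulrBr mulr1; move: geo => g h; lra.
Qed.

Let F (q : R) (n : nat) : R := expR (- (`|n%:R * del - q| / 2)).

Let Fup q n : n%:R * del <= q -> F q n.+1 = F q n / r \/ q < n.+1%:R * del.
Proof.
move=> h; have [h2|h2] := ltP q (n.+1%:R * del); [by right|left].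
rewrite /F /r -expRN -expRD; congr expR.
rewrite !ler0_norm ?subr_le0//; rewrite -natr1; by field.
Qed.

Let Fdn q n : q <= n%:R * del -> F q n.+1 = F q n * r.
Proof.
move=> h; have h2 : q <= n.+1%:R * del by apply: (le_trans h); rewrite ler_pM2r// ler_nat.
rewrite /F /r -expRD; congr expR.
rewrite !ger0_norm ?subr_ge0//; rewrite -natr1; by field.
Qed.

(** A two-sided geometric series; the bounds before and after the peak are carried
along the induction. *)
Lemma peak_sum (q : R) n : \sum_(i < n) F q i <= 2 * geo.
Proof.
have /andP[r0 r1] := r01; have g0 := geo_gt0; have gE := geoE.
have F01 m : 0 <= F q m <= 1.
  by rewrite /F expR_ge0 -[leRHS](expR0 R) ler_expR oppr_le0 divr_ge0.
suff : (n%:R * del <= q -> \sum_(i < n) F q i <= geo * r * F q n) /\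
       (q < n%:R * del -> \sum_(i < n) F q i <= 2 * geo - geo * F q n).
  move=> [h1 h2]; have /andP[f0 f1] := F01 n.
  have [h|h] := leP (n%:R * del) q.
    apply: (le_trans (h1 h)); apply: (@le_trans _ _ (geo * r)).
      by rewrite ler_piMr// mulr_ge0// ltW.
    by lra.
  by apply: (le_trans (h2 h)); rewrite gerBl mulr_ge0// ltW.
elim: n => [|n [IH1 IH2]].
  rewrite big_ord0 mul0r; have /andP[f0 f1] := F01 0%N; split=> _.
    by rewrite !mulr_ge0// ltW.
  have : geo * F q 0 <= geo * 1 by rewrite ler_wpM2l// ltW.
  lra.
rewrite big_ord_recr/=; have /andP[f0 f1] := F01 n; have /andP[f0' f1'] := F01 n.+1.
split=> h.
  have hn : n%:R * del <= q by apply: le_trans h; rewrite ler_pM2r// ler_nat.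
  have [->|] := Fup hn; last by move/lt_le_trans => /(_ _ h); rewrite ltxx.
  have -> : geo * r * (F q n / r) = geo * F q n by field; rewrite gt_eqF.
  by rewrite -[in leRHS]gE mulrDl mul1r lerD2r; exact: IH1.
have [hn|hn] := leP (n%:R * del) q.
  have h1 := IH1 hn.
  have h2 : geo * F q n.+1 <= geo * 1 by rewrite ler_wpM2l// ltW.
  have h3 : geo * F q n <= geo * 1 by rewrite ler_wpM2l// ltW.
  have h4 : geo * F q n = geo * r * F q n + F q n by rewrite -[in LHS]gE mulrDl mul1r.
  apply: (@le_trans _ _ (geo * r * F q n + F q n)); first by rewrite lerD2r.
  by rewrite -h4; move: h2 h3; rewrite !mulr1; move: (geo * F q n) (geo * F q n.+1) => ? ?; lra.
have h1 := IH2 hn; rewrite (Fdn (ltW hn)).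
have h4 : geo * F q n = geo * r * F q n + F q n by rewrite -[in LHS]gE mulrDl mul1r.
have -> : geo * (F q n * r) = geo * r * F q n by ring.
apply: (@le_trans _ _ (2 * geo - geo * F q n + F q n)); first by rewrite lerD2r.
by rewrite h4; move: (geo * r * F q n) (F q n) => ? ?; lra.
Qed.

Lemma peak_sum_min (q : R) n : \sum_(i < n) F q i <= 2 * geo * Num.min 1 (expR (q / 2)).
Proof.
have [q0|q0] := leP 0 q.
  rewrite (_ : Num.min _ _ = 1) ?mulr1 ?peak_sum//.
  by apply/min_idPl; rewrite -[leLHS](expR0 R) ler_expR divr_ge0.
rewrite (_ : Num.min _ _ = expR (q / 2)); last first.
  by apply/min_idPr; rewrite -[leRHS](expR0 R) ler_expR; lra.
have -> : \sum_(i < n) F q i = (\sum_(i < n) F 0 i) * expR (q / 2).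
  rewrite mulr_suml; apply: eq_bigr => i _; rewrite /F -expRD; congr expR.
  have i0 : 0 <= i%:R * del by rewrite mulr_ge0// ltW.
  rewrite subr0 !ger0_norm//; first by field.
  by rewrite subr_ge0 (le_trans (ltW q0)).
by rewrite ler_pM2r ?expR_gt0// peak_sum.
Qed.

End peak_sums.

Section constants.
Context d (T : measurableType d) (R : realType).
Variables (P : probability T R) (X Y q0 : T -> R) (a p : R).
Local Notation E := (Ex P).
Local Notation itg := (itg P).
Hypotheses (iX : itg X) (iY : itg Y) (EX0 : E X = 0).
Hypothesis mq : measurable_fun [set: T] q0.
Hypothesis YX : forall w, 1 + `|X w| <= Y w.
Hypotheses (a0 : 0 < a) (a2 : a <= 2) (p0 : 0 < p).
Hypothesis Xa : p <= E (\1_[set w | a <= X w]).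

Let Y1 w : 1 <= Y w. Proof. by apply: le_trans (YX w); rewrite lerDl. Qed.
Let mY : measurable_fun [set: T] Y := itg_meas iY.
Let del : R := a / 2.
Let del0 : 0 < del. Proof. by rewrite divr_gt0. Qed.

Let mqK (K : R) : measurable_fun [set: T] (fun w => q0 w - K).
Proof. exact: measurable_funB. Qed.

(** Raising the ball lowers the heights [q] of the translation parts below 0, out of
the range of the sum. *)
Lemma peak_mean_small (e : R) : 0 < e -> exists K0, forall K, K0 <= K -> forall n,
  \sum_(i < n) peak_mean P Y (fun w => q0 w - K) del i <= e.
Proof.
move=> e0; have g0 := geo_gt0 del0.
pose f (m : nat) w : R := Y w * Num.min 1 (expR ((q0 w - m%:R) / 2)).
have mf m : measurable_fun [set: T] (f m).
  apply: measurable_funM => //; apply: measurable_minr => //.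
  by apply: measurableT_comp => //; apply: measurable_funM.
have f01 (K : R) w : 0 <= Num.min 1 (expR ((q0 w - K) / 2)) <= 1.
  by rewrite le_min ler01 expR_ge0 ge_min lexx.
have cf : E (f m) @[m --> \oo] --> (0 : R).
  rewrite -(Ex_cst P 0); apply: (@Ex_dct _ _ _ P f _ Y) => //.
    move=> w; rewrite -(mulr0 (Y w)); apply: cvgMr.
    have h : expR (q0 w / 2) * expR (- (1 / 2)) ^+ m @[m --> \oo] --> (0 : R).
      rewrite -(mulr0 (expR (q0 w / 2))); apply: cvgMr; apply: cvg_expr.
      by rewrite ger0_norm ?expR_ge0// -[ltRHS](expR0 R) ltr_expR; lra.
    apply: (@squeeze_cvgr _ _ _ _ (fun=> 0) (fun m => expR (q0 w / 2) * expR (- (1 / 2)) ^+ m)) => //.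
      apply: nearW => m; have /andP[-> _] := f01 m%:R w; rewrite /= ge_min; apply/orP; right.
      by rewrite -expRM_natl -expRD ler_expR; lra.
    exact: cvg_cst.
  move=> m w; have /andP[h1 h2] := f01 m%:R w; have y0 := le_trans ler01 (Y1 w).
  by rewrite ger0_norm ?mulr_ge0// ler_piMr.
have e1 : 0 < e / (2 * geo del) by rewrite divr_gt0// mulr_gt0.
have /cvgrPdist_le/(_ _ e1)[N _ hN] := cf.
exists N%:R => K NK n.
have {hN} : E (f N) <= e / (2 * geo del).
  by apply: le_trans (hN N _); rewrite /= ?sub0r ?normrN ?ler_norm.
rewrite ler_pdivlMr ?mulr_gt0// => hN; apply: le_trans hN.
have isrc i : itg (fun w => Y w * peak (fun w => q0 w - K) del i w) by exact: itg_peak_mean.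
rewrite -(@Ex_sum _ _ _ P n (fun i w => Y w * peak (fun w => q0 w - K) del i w) isrc).
have iff : itg (f N).
  apply: itg_le iY _ => // w; have /andP[h1 h2] := f01 N%:R w; have y0 := le_trans ler01 (Y1 w).
  by rewrite ger0_norm ?mulr_ge0// ler_piMr.
rewrite mulrC -ExZ//; apply: Ex_le.
- exact: (@itg_sum _ _ _ P n (fun i w => Y w * peak (fun w => q0 w - K) del i w) isrc).
- exact: itgZ.
move=> w; have y0 := le_trans ler01 (Y1 w); rewrite -mulr_sumr /f mulrCA.
apply: ler_wpM2l => //; apply: (le_trans (peak_sum_min del0 _ _)).
rewrite ler_pM2l ?mulr_gt0// le_min ge_min lexx/= ge_min; apply/orP; right.
by rewrite ler_expR ler_pM2r// lerD2l lerN2.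
Qed.

Lemma far_prob_sum n : \sum_(i < n) far_prob P Y del i <= E Y / del + 1.
Proof.
have ifar i : itg (\1_[set w | i%:R * del <= Y w]) by exact: itg_far_prob.
rewrite -(@Ex_sum _ _ _ P n (fun i => \1_[set w | i%:R * del <= Y w]) ifar).
have iR : itg (fun w => del^-1 * Y w + 1) by apply: itgD; [exact: itgZ|exact: itg_cst].
have -> : E Y / del + 1 = E (fun w => del^-1 * Y w + 1).
  rewrite ExD ?Ex_cst ?ExZ// 1?mulrC//; [exact: itgZ|exact: itg_cst].
apply: Ex_le => //.
  exact: (@itg_sum _ _ _ P n (fun i => \1_[set w | i%:R * del <= Y w]) ifar).
move=> w; have y0 := le_trans ler01 (Y1 w).
have triv m : \sum_(i < m) (i%:R * del <= Y w)%R%:R <= (m%:R : R).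
  apply: (@le_trans _ _ (\sum_(i < m) (1 : R))).
    by apply: ler_sum => i _; case: (i%:R * del <= Y w); rewrite ?lexx ?ler01.
  by rewrite sumr_const card_ord.
suff h m : \sum_(i < m) (i%:R * del <= Y w)%R%:R <= del^-1 * Y w + 1.
  apply: le_trans (h n); apply: eq_ler.
  by apply: eq_bigr => i _; rewrite indicE; congr (_%:R); congr nat_of_bool; apply/idP/idP; rewrite in_setE.
have [hm|hm] := leP (m%:R * del) (Y w + del).
  apply: (@le_trans _ _ m%:R).
    exact: triv.
  rewrite -(ler_pM2r del0) mulrDl mul1r mulrAC mulVf ?gt_eqF// mul1r//.
elim: m hm => [|m IH] hm; first by move: hm y0 del0; rewrite mul0r; lra.
rewrite big_ord_recr/=.
have -> : (m%:R * del <= Y w) = false.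
  apply/negbTE; rewrite -ltNge; move: hm; rewrite -natr1 mulrDl mul1r ltrD2r//.
rewrite addr0; have [hm'|/IH//] := leP (m%:R * del) (Y w + del).
apply: (@le_trans _ _ m%:R).
  exact: triv.
by rewrite -(ler_pM2r del0) mulrDl mul1r mulrAC mulVf ?gt_eqF// mul1r.
Qed.

Lemma big_mean_sum K j n : \sum_(i < n) big_mean P Y (fun w => q0 w - K) del j i <= 32 * geo del * mass P Y j.
Proof.
have g0 := geo_gt0 del0.
pose b i w : R := \1_[set w | two R j <= 4 * Y w] w * peak (fun w => q0 w - K) del i w.
have ib i : itg (b i) by exact: itg_big_mean.
have mA : measurable [set w | two R j <= 4 * Y w].
  by apply: measurable_le_set => //; exact: measurable_funM.
have iA := itg_indic P mA.
rewrite -(@Ex_sum _ _ _ P n b ib).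
apply: (@le_trans _ _ (E (fun w => 2 * geo del * \1_[set w | two R j <= 4 * Y w] w))).
  apply: Ex_le; [exact: (@itg_sum _ _ _ P n b ib)|exact: itgZ|] => w.
  rewrite -mulr_sumr mulrC; apply: ler_wpM2r; first by rewrite indicE.
  exact: peak_sum.
have h4 : 1 <= 4 :> R by rewrite ler1n.
rewrite ExZ//.
have -> : 32 * geo del * mass P Y j = 2 * geo del * (4 ^+ 2 * mass P Y j) by ring.
by rewrite ler_pM2l ?mulr_gt0//; exact: mass_tail.
Qed.

(** The level [K] of the ball is fixed first, so that the sources needed to pay for
the drops have a small total; then the exit function, which depends on the ball; then
its weight [th]; then the threshold [2 ^ j0] for [A]; and finally the factor [L], large
enough for the barrier to exceed 1 below the threshold. *)
Lemma barrier_exists : exists K0, forall K, K0 <= K ->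
  forall NN eta, 0 <= NN -> 0 < eta -> exists Phi : R -> R -> R -> R,
  [/\ forall d1 (S : measurableType d1) (z s l : S -> R),
        (forall u, 0 <= z u) -> (forall u, 0 <= l u) ->
        measurable_fun [set: S] z -> measurable_fun [set: S] s -> measurable_fun [set: S] l ->
        measurable_fun [set: S] (fun u => Phi (z u) (s u) (l u)),
      forall z s l, 0 <= z -> 0 <= l -> 0 <= Phi z s l <= 1,
      forall z l e, 0 <= z -> 0 <= l -> 0 < e ->
        exists s0, forall s, s <= s0 -> Phi z s l <= e,
      forall z s (Z' l' : T -> R), 0 < z -> Phi z s 0 < 1 ->
        measurable_fun [set: T] Z' -> measurable_fun [set: T] l' ->
        (forall w, 0 <= Z' w) -> (forall w, 0 <= l' w <= NN) ->
        (forall w, height_drop X Y (fun w => q0 w - K) z w (Z' w)) ->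
        (forall w, 0 < l' w -> z <= Y w \/ 1 <= 2 * expR (- (`|z - (q0 w - K)| / 2))) ->
        E (fun w => Phi (Z' w) (s + X w) (l' w)) <= Phi z s 0 &
      forall M, exists2 eps, 0 < eps & forall s l (Z' l' : T -> R),
        0 <= l -> Phi 0 s l < 1 ->
        measurable_fun [set: T] Z' -> measurable_fun [set: T] l' ->
        (forall w, 0 <= Z' w) -> (forall w, 0 <= l' w <= NN) -> E l' <= l - eta ->
        E (fun w => Phi (Z' w) (s + X w) (l' w)) <= Phi 0 s l - (if - M <= s then eps else 0)].
Proof.
pose V := Vf P X; pose Vc := Vcst a p.
have Vc0 : 0 < Vc by exact: Vcst_gt0.
have [U [c [c0 [Uhomo Uneg UV] Ulip Usub Usrc]]] := subharmonic_exists iX EX0 a0 p0 Xa.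
have del1 : del <= 1 by rewrite /del ler_pdivrMr// mul1r.
have Vhomo : {homo V : x y / x <= y} := V_homo iX a0 p0 Xa.
have Vneg z : z < 0 -> V z = 0 := V_neg iX a0 p0 Xa (z := z).
have Vge1 z : 0 <= z -> 1 <= V z := V_ge1 iX a0 p0 Xa (z := z).
have Vlin z : 0 <= z -> V z <= Vc * (1 + z) := V_linear iX a0 p0 Xa (z := z).
have Vsub y l : 0 <= l -> V (y + l) <= V y + V l := V_subadd iX a0 p0 Xa y (l := l).
have iV z : itg (fun t => V (z + X t)) := itg_V iX a0 p0 Xa z.
have Vharm z : 0 <= z -> E (fun t => V (z + X t)) = V z := V_harmonic iX EX0 a0 p0 Xa (z := z).
pose k := loss_coef Vc Vc.
have k0 : 0 < k by rewrite /k /loss_coef /lossK addr_gt0// mulr_gt0// addr_gt0// mulr_gt0.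
have g0 := geo_gt0 del0.
have [K0 hK0] := peak_mean_small (divr_gt0 (divr_gt0 c0 k0) (ltr0n _ 2)).
exists K0 => K K0K NN eta NN0 eta0.
pose q w := q0 w - K.
have mq' : measurable_fun [set: T] q by exact: mqK.
have EY0 : 0 <= E Y by apply: Ex_ge0 => w; exact: le_trans ler01 (Y1 w).
pose fs := E Y / del + 1.
have fs0 : 0 < fs by rewrite ltr_wpDl// divr_ge0// ltW.
pose th := Num.min (1 + NN)^-1 (c / (8 * (1 + NN) * fs)).
have N1 : 0 < 1 + NN by rewrite ltr_wpDr.
have th0 : 0 < th by rewrite lt_min invr_gt0 N1 divr_gt0// mulr_gt0// mulr_gt0.
have thNN : th * NN <= 1.
  apply: (@le_trans _ _ ((1 + NN)^-1 * (1 + NN))); last by rewrite mulVf// gt_eqF.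
  by apply: ler_pM => //; [exact: ltW|rewrite ge_min lexx|rewrite lerDr].
have thf : 4 * NN * th * fs <= c / 2.
  apply: (@le_trans _ _ (4 * (1 + NN) * (c / (8 * (1 + NN) * fs)) * fs)); last first.
    by apply: eq_ler; field; rewrite !gt_eqF.
  rewrite ler_pM2r//; apply: ler_pM; [by rewrite mulr_ge0|exact: ltW| |].
    by rewrite ler_pM2l// lerDr.
  by rewrite ge_min lexx orbT.
have Y0 w : 0 <= Y w := le_trans ler01 (Y1 w).
have [A1 A10 hA1] := trunc_mean_small Y0 iY
  (divr_gt0 (divr_gt0 (mulr_gt0 th0 eta0) (ltr0n _ 8)) (mulr_gt0 (ltr0n _ 384) Vc0)).
pose A2 := 64 * NN * E Y * 8 / eta.
have [j0 hj0] := @two_unbounded R (Num.max 2 (Num.max A1 A2)).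
move: hj0; rewrite !ge_max => /and3P[j02 j0A1 j0A2].
have m0 j : 0 < mass P Y j := mass_gt0 iY Y1 j.
pose L := (mass P Y j0)^-1 + 128 * geo del / c + 64 / (th * eta).
have L1 : 0 < (mass P Y j0)^-1 by rewrite invr_gt0.
have L2 : 0 < 128 * geo del / c by rewrite divr_gt0// mulr_gt0.
have L3 : 0 < 64 / (th * eta) by rewrite divr_gt0// mulr_gt0.
have L0 : 0 < L by rewrite /L addr_gt0// addr_gt0.
pose om j i := (L * mass P Y j * (k * peak_mean P Y q del i + 4 * NN * th * far_prob P Y del i) +
   4 * big_mean P Y q del j i) / c.
have pk i w := peak01 q del i w.
have peak_mean0 i : 0 <= peak_mean P Y q del i.
  by apply: Ex_ge0 => w; rewrite mulr_ge0//; case/andP: (pk i w).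
have far0 i : 0 <= far_prob P Y del i by apply: Ex_ge0 => w; rewrite indicE.
have big0 j i : 0 <= big_mean P Y q del j i.
  by apply: Ex_ge0 => w; rewrite mulr_ge0 ?indicE//; case/andP: (pk i w).
have om0 j i : 0 <= om j i.
  have Lm : 0 <= L * mass P Y j by rewrite mulr_ge0// ltW.
  apply: divr_ge0; last exact: ltW.
  have h1 : 0 <= k * peak_mean P Y q del i by exact: mulr_ge0 (ltW k0) (peak_mean0 i).
  have h2 : 0 <= 4 * NN * th * far_prob P Y del i.
    by apply: mulr_ge0 => //; rewrite !mulr_ge0// ltW.
  have h3 : 0 <= 4 * big_mean P Y q del j i by rewrite mulr_ge0.
  by rewrite addr_ge0// mulr_ge0// addr_ge0.
have om_src j i : c * om j i = L * mass P Y j * (k * peak_mean P Y q del i + 4 * NN * th * far_prob P Y del i) +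
   4 * big_mean P Y q del j i by rewrite /om mulrC divfK// gt_eqF.
have omM j n : \sum_(i < n) om j i <= 2 * L * mass P Y j.
  rewrite -(ler_pM2l c0) mulr_sumr.
  under eq_bigr do rewrite om_src.
  rewrite big_split/= -mulr_sumr big_split/= -!mulr_sumr.
  have h1 : k * \sum_(i < n) peak_mean P Y q del i <= c / 2.
    apply: (le_trans (ler_wpM2l (ltW k0) (hK0 K K0K n))).
    by apply: eq_ler; field; rewrite gt_eqF.
  have h2 : 4 * NN * th * \sum_(i < n) far_prob P Y del i <= c / 2.
    apply: le_trans thf; apply: ler_wpM2l; last exact: far_prob_sum.
    by rewrite !mulr_ge0// ltW.
  have h3 : 4 * \sum_(i < n) big_mean P Y q del j i <= c * L * mass P Y j.
    apply: (@le_trans _ _ (4 * (32 * geo del * mass P Y j))).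
      by rewrite ler_pM2l// big_mean_sum.
    rewrite !mulrA ler_pM2r// -mulrA.
    have -> : 4 * (32 * geo del) = c * (128 * geo del / c) by field; rewrite gt_eqF.
    by rewrite ler_pM2l// /L; lra.
  have Lm : 0 <= L * mass P Y j by rewrite mulr_ge0// ltW.
  have h12 : L * mass P Y j * (k * \sum_(i < n) peak_mean P Y q del i + 4 * NN * th * \sum_(i < n) far_prob P Y del i) <=
      L * mass P Y j * c by apply: ler_wpM2l => //; lra.
  apply: (le_trans (lerD h12 h3)).
  by apply: eq_ler; ring.
have Lj0 : 1 <= L * mass P Y j0.
  rewrite -(@mulVf _ (mass P Y j0)) ?gt_eqF// ler_pM2r// /L; lra.
have small1 A : two R j0 <= A -> 384 * Vc * trunc_mean P Y A <= th * eta / 8.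
  move=> jA; have := hA1 A (le_trans j0A1 jA).
  have h384 : 0 < 384 * Vc by rewrite mulr_gt0.
  by rewrite (ler_pdivlMr _ _ h384) [X in X <= _]mulrC.
have small2 A : two R j0 <= A -> 64 * NN * (E Y / A) <= eta / 8.
  move=> jA; have Ap : 0 < A by apply: lt_le_trans jA; exact: two_gt0.
  rewrite mulrA ler_pdivrMr// [leRHS]mulrAC ler_pdivlMr//.
  have := le_trans j0A2 jA; rewrite /A2 ler_pdivrMr// => h; lra.
have Lbig : 16 <= L * th * eta / 4.
  rewrite ler_pdivlMr// -mulrA -ler_pdivrMr ?mulr_gt0//.
  have -> : 16 * 4 = 64 :> R by ring.
  by rewrite /L; lra.
have pc := ltW Vc0.
exists (profile P Y V U del L th om); split.
- move=> d1 S z s l z0 l0 mz ms ml.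
  exact: (measurable_profile iY YX del0 Vhomo Vge1 Uhomo Uneg UV L0 th0 om0 omM z0 l0 mz ms ml).
- move=> z s l z0 l0.
  exact: (profile01 iY YX del0 Vhomo Vge1 Uhomo UV L0 th0 om0 omM s z0 l0).
- move=> z l e z0 l0 e0.
  exact: (profile_vanish iY YX del0 pc Vhomo Vge1 Vlin Uhomo UV L0 th0 om0 omM z0 l0 e0).
- move=> z s Z' l' z0 p1 mZ ml Z0 l0 hd he.
  exact: (profile_far iX iY mq' YX pc del0 del1 pc Vhomo Vge1 Vlin iV Vharm Uhomo Uneg UV Ulip Usub Usrc
    L0 th0 NN0 thNN om0 omM om_src j02 Lj0 z0 p1 mZ ml Z0 l0 hd he).
move=> M; have [jM hM] := @two_unbounded R M.
exists (L * th * eta / 2 * mass P Y jM) => [|s l Z' l' lp p1 mZ ml Z0 l0 El].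
  by rewrite mulr_gt0// divr_gt0// !mulr_gt0.
have := (profile_ball iX iY EX0 YX del0 pc Vhomo Vneg Vge1 Vlin Vsub iV Vharm Uhomo Uneg UV L0 th0 NN0
    om0 omM j02 Lj0 small1 small2 Lbig lp p1 mZ ml Z0 l0 El).
move=> h; apply: (le_trans h); rewrite lerD2l lerN2.
have c2 : 0 < L * th * eta / 2 by rewrite divr_gt0// !mulr_gt0.
case: ifP => Ms; last by apply: mulr_ge0; [exact: ltW|exact: scut_ge0].
by rewrite ler_pM2l//; apply: scut_ge => //; apply: le_trans hM; rewrite lerNl.
Qed.

End constants.

(** * Geometry of one step *)
Section one_step.
Variable R : realType.
Implicit Types n m b k : R.

Definition height k n : R := ln (Num.max n (expR k)) - k.

Lemma height_ge0 k n : 0 <= height k n.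
Proof.
rewrite /height subr_ge0 -[leLHS]expRK ler_ln ?posrE ?expR_gt0//; last first.
  by rewrite lt_max expR_gt0 orbT.
by rewrite le_max lexx orbT.
Qed.

Lemma height_in k n : n <= expR k -> height k n = 0.
Proof. by move=> h; rewrite /height max_r// expRK subrr. Qed.

Lemma height_out k n : expR k <= n -> height k n = ln n - k.
Proof. by move=> h; rewrite /height max_l. Qed.

Lemma height_lb k n : 0 < n -> ln n - k <= height k n.
Proof.
move=> n0; rewrite lerD2r ler_ln ?posrE ?lt_max ?n0//.
by rewrite le_max lexx.
Qed.

Lemma height_gt0 k n : 0 < height k n -> expR k < n.
Proof. by move=> h; rewrite ltNge; apply: contraL h => /height_in ->; rewrite ltxx. Qed.

Lemma logp_ge0 t : 0 <= logp t :> R. Proof. by rewrite /logp le_max lexx orbT. Qed.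

Lemma logp_ge t : 0 <= t -> t <= expR (logp t) :> R.
Proof.
move=> t0; have [->|tn] := eqVneq t 0; first exact: expR_ge0.
have tp : 0 < t by rewrite lt_neqAle eq_sym tn.
by rewrite -[leLHS](@lnK _ t) ?posrE// ler_expR /logp le_max lexx.
Qed.

Lemma logp_eq t : 0 < t -> 1 < expR (logp t) -> expR (logp t) = t :> R.
Proof.
move=> tp; rewrite -{1}(expR0 R) ltr_expR => h.
have e : logp t = ln t.
  move: h; rewrite /logp lt_max ltxx orbF => h; apply: max_l; exact: ltW.
by rewrite e lnK.
Qed.

(* [n] and [n'] are the norms of a point and of its image under a map with ratio [c]
   and translation length [b] *)
Variables (K n n' c b : R).
Hypotheses (K2 : ln 2 <= K) (n0 : 0 <= n) (n'0 : 0 <= n') (c0 : 0 < c) (b0 : 0 <= b).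
Hypotheses (mb : c * n - b <= n') (bm : b - c * n <= n').
Hypothesis Z0 : 0 < height K n.

Let be := logp b.
Let Y := 1 + be + `|ln c|.
Let u := height K n - (be - ln c - K).
Let zeta := height K n + ln c.

Let ln2_gt0 : 0 < ln 2 :> R. Proof. by rewrite ln_gt0// ltr1n. Qed.
Let expln2 : expR (ln 2) = 2 :> R. Proof. by rewrite lnK// posrE. Qed.
Let ln2_le1 : ln 2 <= 1 :> R.
Proof. by rewrite -ler_expR expln2; have := expR_ge1Dx (1 : R); lra. Qed.

Let nK : expR K < n. Proof. exact: height_gt0. Qed.
Let np : 0 < n. Proof. by apply: lt_trans nK; exact: expR_gt0. Qed.
Let m0 : 0 < c * n. Proof. by rewrite mulr_gt0. Qed.
Let lnm : ln (c * n) = ln c + ln n. Proof. by rewrite lnM ?posrE. Qed.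
Let HE : height K n = ln n - K. Proof. by apply: height_out; exact: ltW. Qed.
Let be0 : 0 <= be. Proof. exact: logp_ge0. Qed.
Let uE : u = ln (c * n) - be. Proof. by rewrite /u HE lnm; ring. Qed.
Let zE : zeta = ln (c * n) - K. Proof. by rewrite /zeta HE lnm; ring. Qed.
Let zuE : zeta = u + be - K. Proof. by rewrite zE uE; ring. Qed.
Let b_le : b <= expR be. Proof. exact: logp_ge. Qed.

(** The translation is dominated by the dilated norm. *)
Let far_case : ln 2 <= u -> (1 - expR (- u)) * (c * n) <= n' /\ expR (- u) <= 1 / 2.
Proof.
move=> hu; split; last first.
  have : expR (- u) <= expR (- ln 2) by rewrite ler_expR lerN2.
  by rewrite [expR (- ln 2)]expRN expln2 div1r.
apply: le_trans mb; rewrite mulrBl mul1r lerD2l lerN2; apply: (le_trans b_le).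
have -> : c * n = expR (u + be) by rewrite uE subrK lnK// posrE.
by rewrite -expRD addrA addNr add0r.
Qed.

(** The translation dominates, and pushes the image further than the dilation alone. *)
Let push_case : u < - ln 2 -> 0 < zeta -> c * n < n' .
Proof.
move=> hu zp; have hm : 2 * (c * n) < expR be.
  have -> : expR be = expR (- u) * (c * n).
    rewrite -[X in _ * X](@lnK _ (c * n)) ?posrE// -expRD uE; congr expR; ring.
  by rewrite ltr_pM2r// -expln2 ltr_expR ltrNr.
have mK : expR K < c * n.
  rewrite -[ltRHS](@lnK _ (c * n)) ?posrE// ltr_expR.
  by move: zp; rewrite zE subr_gt0.
have K2' : 2 <= expR K by rewrite -expln2 ler_expR.
have be1 : 1 < expR be by lra.
have bp : 0 < b.
  rewrite lt_neqAle b0 andbT; apply/eqP => e.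
  move: be1; rewrite /be -e /logp ln0// maxxx expR0; lra.
move: hm; rewrite (logp_eq bp be1); move: bm; move: (c * n) => m; lra.
Qed.

Let near_case : - ln 2 <= u <= ln 2 -> 1 <= 2 * expR (- (`|u| / 2)).
Proof.
move=> hu; have hn : `|u| <= ln 2 by rewrite ler_norml.
apply: (@le_trans _ _ (2 * expR (- (ln 2)))).
  by rewrite expRN expln2 mulfV.
rewrite ler_pM2l// ler_expR lerN2; have := normr_ge0 u; lra.
Qed.

(** The height [be - K] of the translation part, shifted by [- ln c], is compared to
the height of the point. If it is much smaller the image is close to the dilated
point, with an exponentially small relative error; if it is much larger the image is
pushed upwards. *)
Lemma one_step_drop : [\/ zeta <= height K n',
  zeta - height K n' <= 1 /\
    (zeta - height K n') * (1 + zeta) <= 4 * (Y * expR (- (`|u| / 2))) |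
  zeta <= Y /\ 1 <= 2 * expR (- (`|u| / 2))].
Proof.
have H0 := height_ge0 K n'.
have [hz|hz] := leP zeta (height K n'); first by apply: Or31.
have zp : 0 < zeta by exact: le_lt_trans hz.
have Ybe : 1 + be <= Y by rewrite /Y lerDl.
have [hu|hu] := leP (ln 2) u.
  apply: Or32; have [hn' e2] := far_case hu.
  set t := expR (- u) in hn' e2.
  have t0 : 0 < t by exact: expR_gt0.
  have np' : 0 < n'.
    by apply: lt_le_trans hn'; rewrite mulr_gt0//; lra.
  have t1 : 0 < 1 - t by lra.
  have lam : zeta - height K n' <= 2 * t.
    have h1 : ln (1 - t) + ln (c * n) <= ln n'.
      by rewrite -lnM ?posrE// ler_ln ?posrE// mulr_gt0.
    have h2 : - ln (1 - t) <= 2 * t.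
      rewrite -lnV ?posrE//.
      apply: (@le_trans _ _ ((1 - t)^-1 - 1)).
        have h := @expR_ge1Dx R (ln (1 - t)^-1).
        rewrite lnK ?posrE ?invr_gt0// in h; lra.
      rewrite lerBlDr -div1r ler_pdivrMr//; nra.
    have := height_lb K np'; rewrite zE; lra.
  have u0 : 0 <= u by apply: le_trans hu; exact: ltW.
  split; first lra.
  apply: (@le_trans _ _ ((2 * t) * ((1 + u) * Y))).
    apply: ler_pM => //; [by rewrite subr_ge0 ltW|by rewrite addr_ge0// ltW|].
    have h : 1 + zeta <= 1 + u + be by rewrite zuE; have := ltW ln2_gt0; move: K2; lra.
    apply: (le_trans h); apply: (@le_trans _ _ ((1 + u) * (1 + be))); first by have := be0; nra.
    by rewrite ler_wpM2l// addr_ge0.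
  rewrite (ger0_norm u0).
  have h1 : 1 + u <= 2 * expR (u / 2) by have := @expR_ge1Dx R (u / 2); lra.
  have Y0 : 0 <= Y by apply: le_trans Ybe; rewrite addr_ge0.
  have -> : 4 * (Y * expR (- (u / 2))) = 2 * t * (2 * expR (u / 2) * Y).
    have -> : expR (- (u / 2)) = t * expR (u / 2) by rewrite /t -expRD; congr expR; field.
    ring.
  by rewrite ler_wpM2l ?mulr_ge0 ?(ltW t0)// ler_wpM2r.
have [hu2|hu2] := leP (- ln 2) u.
  apply: Or33; split; last by apply: near_case; rewrite hu2 ltW.
  apply: le_trans Ybe; rewrite zuE; move: K2; lra.
have := push_case hu2 zp => h; exfalso.
have : zeta <= height K n'; last by rewrite leNgt hz.
apply: le_trans (height_lb K (lt_trans m0 h)); rewrite zE lerD2r ler_ln ?posrE//; first exact: ltW.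
exact: lt_trans m0 h.
Qed.

(** Only a strong contraction, or a translation that almost cancels the dilated point,
can bring a point into the ball. *)
Lemma one_step_enter : n' <= expR K -> height K n <= Y \/ 1 <= 2 * expR (- (`|u| / 2)).
Proof.
move=> hn'; have [zn|zp] := leP zeta 0.
  left; have : height K n <= - ln c by move: zn; rewrite /zeta; lra.
  have := ler_norm (- ln c); rewrite normrN /Y; have := be0; lra.
have [hu|hu] := leP (ln 2) u.
  have [h1 e2] := far_case hu; left.
  have hm : c * n <= 2 * expR K.
    have : 1 / 2 * (c * n) <= (1 - expR (- u)) * (c * n) by rewrite ler_pM2r//; lra.
    lra.
  have hl : ln (c * n) <= ln 2 + K.
    have -> : ln 2 + K = ln (2 * expR K) by rewrite lnM ?posrE ?expR_gt0// expRK.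
    by rewrite ler_ln ?posrE// mulr_gt0// expR_gt0.
  rewrite HE; move: hl; rewrite lnm.
  have := ler_norm (- ln c); rewrite normrN /Y; have := be0; have := ln2_le1; lra.
have [hu2|hu2] := leP (- ln 2) u; first by right; apply: near_case; rewrite hu2 ltW.
have h := push_case hu2 zp; exfalso.
have : c * n <= expR K by exact: le_trans (ltW h) hn'.
rewrite leNgt => /negP; apply.
rewrite -[ltRHS](@lnK _ (c * n)) ?posrE// ltr_expR.
by move: zp; rewrite zE subr_gt0.
Qed.

End one_step.

(** * Separability of vector spaces over local fields *)
Section separability.
Variable R : realType.

Definition abs_dense (K : absFieldType R) (I : Type) (f : I -> K) :=
  forall (x : K) (e : R), 0 < e -> exists i, absv (x - f i) < e.

(** Approximating the coordinates approximates the vector, for any seminorm. *)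
Lemma vect_dense (F : absFieldType R) (I : countType) (f : I -> F)
    (W : vectType F) (N : W -> R) :
  abs_dense f -> (forall x, 0 <= N x) -> N 0 = 0 ->
  (forall x y, N (x + y) <= N x + N y) ->
  (forall a x, N (a *: x) <= absv a * N x) ->
  exists g : {ffun 'I_(\dim {:W}) -> I} -> W,
    forall x e, 0 < e -> exists i, N (x - g i) < e.
Proof.
move=> df N0 Nz ND NZ; pose b := vbasis {:W}.
exists (fun u => \sum_(i < \dim {:W}) f (u i) *: b`_i) => x e e0.
pose S := \sum_(i < \dim {:W}) N b`_i.
have S0 : 0 <= S by apply: sumr_ge0 => i _.
pose del := e / (1 + S).
have d0 : 0 < del by rewrite divr_gt0// ltr_pwDl.
have [c xc] : exists c : 'I_(\dim {:W}) -> F, x = \sum_(i < \dim {:W}) c i *: b`_i.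
  by exists (fun i => coord b i x); rewrite -coord_vbasis// memvf.
have /choice [u hu] : forall i, exists j, absv (c i - f j) < del by move=> i; exact: df.
exists [ffun i => u i].
have -> : x - \sum_(i < \dim {:W}) f ([ffun i => u i] i) *: b`_i =
    \sum_(i < \dim {:W}) (c i - f (u i)) *: b`_i.
  by rewrite xc -sumrB; apply: eq_bigr => i _; rewrite ffunE scalerBl.
have NS (J : seq 'I_(\dim {:W})) (G : 'I_(\dim {:W}) -> W) :
    N (\sum_(i <- J) G i) <= \sum_(i <- J) N (G i).
  elim: J => [|i J IH]; first by rewrite !big_nil Nz.
  by rewrite !big_cons (le_trans (ND _ _))// lerD2l.
apply: (le_lt_trans (NS _ _)).
apply: (@le_lt_trans _ _ (\sum_(i < \dim {:W}) del * N b`_i)).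
  by apply: ler_sum => i _; rewrite (le_trans (NZ _ _))// ler_wpM2r// ltW.
rewrite -mulr_sumr -/S /del mulrAC ltr_pdivrMr ?ltr_pwDl//.
by rewrite ltr_pM2l// ltrDr.
Qed.

Definition abs_separable (K : absFieldType R) :=
  exists (I : countType) (f : I -> K), abs_dense f.

Lemma finite_extension_separable (F K : absFieldType R) :
  finite_extension F K -> abs_separable F -> abs_separable K.
Proof.
move=> [L [f [bf fa]]] [I [d dd]].
have fZ (a : F) (x : L) : absv (f (a *: x)) = absv a * absv (f x).
  by rewrite -mulr_algl rmorphM absvM fa.
have [||||g hg] := @vect_dense F I d L (fun x => absv (f x)) dd.
- by move=> x; exact: absv_ge0.
- by apply/eqP; rewrite rmorph0 absv_eq0.
- by move=> x y; rewrite rmorphD absvD.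
- by move=> a x; rewrite fZ.
exists {ffun 'I_(\dim {:L}) -> I}, (fun u => f (g u)) => x e e0.
have [f' _ fK] := bf.
by have [i hi] := hg (f' x) e e0; exists i; rewrite rmorphB fK in hi.
Qed.

Lemma rat_approx (x e : R) : 0 < e -> exists q : rat, `|x - ratr q| < e.
Proof.
move=> e0; have xe : x - e < x + e by lra.
have [q] := rat_in_itvoo xe.
rewrite in_itv/= => /andP[q1 q2]; exists q; rewrite ltr_norml; lra.
Qed.

(** Truncated series are dense, and there are countably many of them as the
residue field is finite. *)
Lemma laurent_separable (k : finFieldType) (F : absFieldType R) :
  is_laurent_field k F -> abs_separable F.
Proof.
move=> [coef [icoef rcoef cD cM [r /andP[r0 r1] hr]]].
have [c hc] : exists c : int * seq k -> F, forall N (s : seq k) n,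
    coef (c (N, s)) n = if 0 <= n - N then nth 0 s `|n - N|%N else 0.
  suff /choice [c hc] : forall u : int * seq k, exists x, forall n,
      coef x n = if 0 <= n - u.1 then nth 0 u.2 `|n - u.1|%N else 0.
    by exists c => N s n; rewrite hc.
  move=> [N s] /=; pose v n : k := if 0 <= n - N then nth 0 s `|n - N|%N else 0.
  have : range coef v.
    rewrite rcoef; exists N => n nN; rewrite /v ifF//.
    by apply/negbTE; rewrite -ltNge subr_lt0.
  by move=> [x _ xv]; exists x => n; rewrite xv.
exists (int * seq k)%type, c => x e e0.
have [N hN] : exists N : int, forall n : int, n < N -> coef x n = 0.
  have : range coef (coef x) by exists x.
  by rewrite rcoef.
have coef0 n : coef 0 n = 0.
  by have := cD 0 0 n; rewrite addr0 => /eqP; rewrite -[eqbLHS]addr0 (inj_eq (addrI _)) eq_sym => /eqP.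
have coefN y n : coef (- y) n = - coef y n.
  by apply/eqP; rewrite -addr_eq0 -cD addNr coef0.
have [M [NM rM]] : exists M : int, N <= M /\ r ^ M < e.
  have : r ^+ n @[n --> \oo] --> (0 : R) by apply: cvg_expr; rewrite ger0_norm// ltW.
  move=> /cvgrPdist_lt/(_ _ e0)[n _ hn].
  exists (Posz (maxn n `|N|%N)); split.
    by rewrite (le_trans (ler_norm _))// -abszE lez_nat leq_maxr.
  have := hn (maxn n `|N|%N) (leq_maxl _ _).
  by rewrite /= sub0r normrN ger0_norm// exprn_ge0// ltW.
pose y := c (N, [seq coef x (N + Posz i) | i <- iota 0 `|M - N|%N]).
exists (N, [seq coef x (N + Posz i) | i <- iota 0 `|M - N|%N]); rewrite -/y.
have xy n : n < M -> coef (x - y) n = 0.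
  move=> nM; rewrite cD coefN hc.
  case: ifPn => [nN|]; last by rewrite -ltNge subr_lt0 => /hN ->; rewrite subrr.
  have e1 : Posz `|n - N|%N = n - N by rewrite gez0_abs.
  have lt1 : (`|n - N| < `|M - N|)%N.
    by rewrite -ltz_nat !gez0_abs ?ltrD2r// subr_ge0.
  by rewrite (nth_map 0%N) ?size_iota// nth_iota// add0n e1 [N + _]addrC subrK subrr.
have [e2|/eqP ne] := eqVneq (x - y) 0.
  by rewrite e2 (eqP (_ : absv (0 : F) == 0))// absv_eq0.
have [n hn] : exists n, coef (x - y) n != 0.
  apply: contrapT => h; apply: ne; apply: icoef; apply/funext => n.
  by rewrite coef0; apply/eqP/negPn/negP => h'; apply: h; exists n.
have nM : M <= n by rewrite leNgt; apply: contra_neqN hn => /xy ->.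
have e1 : n = M + Posz `|n - M|%N by rewrite gez0_abs ?subr_ge0// [M + _]addrC subrK.
pose Q i := coef (x - y) (M + Posz i) != 0.
have [|i Qi imin] := @ex_minnP Q; first by exists `|n - M|%N; rewrite /Q -e1.
rewrite (hr _ (M + Posz i) Qi).
  rewrite expfzDr ?gt_eqF// (le_lt_trans _ rM)// ler_piMr ?exprz_ge0 ?(ltW r0)//.
  by rewrite -exprnP exprn_ile1 ?(ltW r0)// ltW.
move=> j ji; have [jM|Mj] := ltP j M; first exact: xy.
have e3 : j = M + Posz `|j - M|%N by rewrite gez0_abs ?subr_ge0// [M + _]addrC subrK.
apply/eqP/negPn/negP => h; have := imin `|j - M|%N; rewrite /Q -e3 => /(_ h).
rewrite leqNgt => /negP; apply.
by rewrite -ltz_nat gez0_abs ?subr_ge0// ltrBlDl.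
Qed.

Lemma local_field_separable (K : absFieldType R) : local_field K -> abs_separable K.
Proof.
case=> [[f [[f' _ fK] fa]]|[f [[f' _ fK] fa]]|[p [F [hF]]]|[k [F [hF]]]].
- exists rat, (fun q => f (ratr q)) => x e e0.
  have [q hq] := rat_approx (f' x) e0; exists q.
  by rewrite -[x]fK -rmorphB fa.
- exists (rat * rat)%type, (fun q => f (Complex (ratr q.1) (ratr q.2))) => x e e0.
  have e2 : 0 < e / 2 by rewrite divr_gt0.
  have [q hq] := rat_approx (complex.Re (f' x)) e2.
  have [s hs] := rat_approx (complex.Im (f' x)) e2.
  exists (q, s); rewrite -[x]fK -rmorphB fa; case: (f' x) hq hs => u v /= hq hs.
  set A := u - _ in hq *; set B := v - _ in hs *.
  have : Num.sqrt (A ^+ 2 + B ^+ 2) <= `|A| + `|B|.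
    rewrite -[leRHS]ger0_norm ?addr_ge0// -sqrtr_sqr ler_sqrt ?sqr_ge0//.
    rewrite [leRHS]sqrrD !real_normK ?num_real// lerD2r lerDl mulrn_wge0// mulr_ge0//.
  lra.
- move=> /finite_extension_separable; apply.
  by case: hF => _ _ h _; exists rat, (fun q => ratr q).
- by move=> /finite_extension_separable; apply; exact: laurent_separable hF.
Qed.

Lemma normedVect_separable (K : absFieldType R) (V : normedVectType K) :
  local_field K -> exists D : nat -> V, forall x e, 0 < e -> exists n, vnorm (x - D n) < e.
Proof.
move=> /local_field_separable[I [f df]].
have [||||g hg] := @vect_dense K I f V (@vnorm R K V) df.
- exact: vnorm_ge0.
- exact: vnorm0.
- exact: vnormD.
- by move=> a x; rewrite vnormZ.
exists (fun n => if unpickle n is Some u then g u else 0) => x e e0.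
by have [u hu] := hg x e e0; exists (pickle u); rewrite pickleK.
Qed.

End separability.

Lemma measurable_lt d (T : measurableType d) (R : realType) (f : T -> R) :
  (forall c, measurable [set x | f x < c]) -> measurable_fun [set: T] f.
Proof.
move=> h; apply: (measurability _ (RGenInftyO.measurableE R)).
move=> _ [_ [c ->] <-]; rewrite setTI; move: (h c); congr (measurable _).
Qed.

(** * Measurability of the action *)
Section similarity_facts.
Variables (R : realType) (K : absFieldType R) (V : normedVectType K).
Implicit Types (g h : asim V) (x y v : V).

Lemma sim_ratioP g : similarity_ratio (lin g) (sim_ratio (lin g)).
Proof. have [_ [c hc]] := sim_linP g; exact: (@xgetI _ 1 (similarity_ratio (lin g)) c). Qed.

Lemma sim_ratio_gt0 g : 0 < sim_ratio (lin g).
Proof. by case: (sim_ratioP g). Qed.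

Lemma sim_ratioE g x : vnorm (lin g x) = sim_ratio (lin g) * vnorm x.
Proof. by case: (sim_ratioP g). Qed.

Lemma aactB g x y : aact g x - aact g y = lin g (x - y).
Proof. by rewrite /aact opprD addrACA subrr addr0 linearB. Qed.

Lemma vnorm_aactB g x y :
  vnorm (aact g x - aact g y) = sim_ratio (lin g) * vnorm (x - y).
Proof. by rewrite aactB sim_ratioE. Qed.

Lemma vnormB x y : vnorm (x - y) = vnorm (y - x).
Proof. by rewrite -vnormN opprB. Qed.

Lemma vnorm_lipl x y : `|vnorm x - vnorm y| <= vnorm (x - y).
Proof.
have := vnormD (x - y) y; have := vnormD (y - x) x.
rewrite !subrK vnormB ler_norml; lra.
Qed.

Lemma vnorm_aact_ge g x :
  sim_ratio (lin g) * vnorm x - vnorm (trans g) <= vnorm (aact g x) /\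
  vnorm (trans g) - sim_ratio (lin g) * vnorm x <= vnorm (aact g x).
Proof.
rewrite -sim_ratioE /aact; split; rewrite lerBlDr.
  rewrite -[X in X <= _](_ : vnorm (lin g x + trans g - trans g) = _); last by rewrite addrK.
  by apply: le_trans (vnormD _ _) _; rewrite vnormN.
rewrite -[X in X <= _](_ : vnorm (lin g x + trans g - lin g x) = _).
  by apply: le_trans (vnormD _ _) _; rewrite vnormN.
by rewrite addrAC subrr add0r.
Qed.

Lemma aactM g h x : aact (g * h)%g x = aact g (aact h x).
Proof.
by rewrite /aact/= comp_lfunE linearD -addrA; congr (_ + _); rewrite addrC.
Qed.

Lemma aact1 x : aact (1%g : asim V) x = x.
Proof. by rewrite /aact/= id_lfunE addr0. Qed.

Lemma asim_lip_measurable (f : asim V -> R) (k : R) :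
  (forall g h, `|f g - f h| <= k * asim_dist g h) -> measurable_fun [set: asim V] f.
Proof.
move=> fk; apply: measurable_lt => c; apply: sub_sigma_algebra.
have kp : 0 < `|k| + 1 by rewrite ltr_wpDl.
have ad0 g h : 0 <= asim_dist g h.
  by rewrite addr_ge0 ?vnorm_ge0 ?opnorm_ge0//; exact: bounded_asimB.
rewrite /= openE => g /= gc; rewrite /interior -nbhs_ballE.
have e0 : 0 < (c - f g) / (`|k| + 1) by rewrite divr_gt0// subr_gt0.
exists ((c - f g) / (`|k| + 1)) => //= h.
rewrite ballEmdist /= => gh.
have : `|f h - f g| < c - f g.
  rewrite distrC; apply: (le_lt_trans (fk g h)).
  apply: (@le_lt_trans _ _ ((`|k| + 1) * asim_dist g h)).
    by rewrite ler_wpM2r// (le_trans (ler_norm _))// lerDl.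
  by rewrite mulrC -ltr_pdivlMr.
by rewrite ltr_norml; lra.
Qed.

Lemma measurable_aact_norm x v :
  measurable_fun [set: asim V] (fun g => vnorm (aact g x - v)).
Proof.
apply: (@asim_lip_measurable _ (1 + vnorm x)) => g h.
apply: (le_trans (vnorm_lipl _ _)).
have -> : aact g x - v - (aact h x - v) = (lin g - lin h) x + (trans g - trans h).
  by rewrite /aact add_lfunE opp_lfunE opprB addrA subrK opprD addrACA.
apply: (le_trans (vnormD _ _)); rewrite /asim_dist.
have := le_opnorm x (bounded_asimB g h); have := vnorm_ge0 x.
have := vnorm_ge0 (trans g - trans h).
have := opnorm_ge0 (bounded_asimB g h).
set a := opnorm _; set b := vnorm _; set c := vnorm x; set d := vnorm _.
nra.
Qed.

Lemma measurable_trans_norm :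
  measurable_fun [set: asim V] (fun g => vnorm (trans g)).
Proof.
under eq_fun => g do have -> : trans g = aact g 0 - 0 by rewrite /aact linear0 add0r subr0.
exact: measurable_aact_norm.
Qed.

Lemma measurable_ratio (x0 : V) : x0 != 0 ->
  measurable_fun [set: asim V] (fun g => sim_ratio (lin g)).
Proof.
move=> x00; have n0 : vnorm x0 != 0 by rewrite vnorm_eq0.
rewrite (_ : (fun g => _) = (fun g => vnorm (lin g x0) / vnorm x0)); last first.
  by apply/funext => g; rewrite sim_ratioE mulfK.
apply: measurable_funM => //.
apply: (@asim_lip_measurable _ (vnorm x0)) => g h.
apply: (le_trans (vnorm_lipl _ _)).
have -> : lin g x0 - lin h x0 = (lin g - lin h) x0 by rewrite add_lfunE opp_lfunE.
apply: (le_trans (le_opnorm x0 (bounded_asimB g h))).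
by rewrite mulrC ler_wpM2l ?vnorm_ge0// /asim_dist lerDr vnorm_ge0.
Qed.

(** The sigma-algebra generated by balls, which is enough to make the action jointly
measurable. The alias [vmeas] carries it without adding structure to [V]. *)
Definition vballs : set (set V) :=
  [set A | exists v e, A = [set x | vnorm (x - v) < e]].
Definition vmeas : Type := V.

HB.instance Definition _ := Choice.on vmeas.
HB.instance Definition _ := isPointed.Build vmeas (0 : V).

Definition vsigma : set (set vmeas) := <<s vballs >>.

Lemma vsigmaC (A : set vmeas) : vsigma A -> vsigma (~` A).
Proof. by move=> mA; rewrite -setTD; exact: sigma_algebraCD. Qed.

HB.instance Definition _ := @isMeasurable.Build default_measure_display vmeas
  vsigma (@sigma_algebra0 _ setT vballs) vsigmaC
  (@sigma_algebra_bigcup _ setT vballs).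

Lemma measurable_vnorm v : measurable_fun [set: vmeas] (fun x : vmeas => vnorm ((x : V) - v)).
Proof.
by apply: measurable_lt => c; apply: sub_sigma_algebra; exists v, c.
Qed.

Lemma measurable_to_vmeas d (T : measurableType d) (f : T -> vmeas) :
  (forall v c, measurable [set t | vnorm ((f t : V) - v) < c]) ->
  measurable_fun [set: T] f.
Proof.
move=> h; apply: (@measurability _ _ T vmeas setT f vballs) => //.
by move=> _ [_ [v [c ->]] <-]; rewrite setTI; exact: h.
Qed.

Hypothesis hK : local_field K.

(** The map is continuous in the point, at a rate given by the ratio, so it is
measurable as a limit over a countable dense set. *)
Lemma measurable_act : measurable_fun [set: vmeas * asim V]
  (fun u : vmeas * asim V => aact u.2 (u.1 : V) : vmeas).
Proof.
have [[x0 x00]|V0] := pselect (exists x0 : V, x0 != 0); last first.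
  have z x : x = 0 :> V by apply/eqP/negPn/negP => h; apply: V0; exists x.
  rewrite (_ : (fun u => _) = cst (0 : vmeas)); first exact: measurable_cst.
  by apply/funext => u /=; exact: z.
have [D hD] := normedVect_separable V hK.
apply: measurable_to_vmeas => v c.
pose Q (n m : nat) : set (vmeas * asim V) :=
  [set u | sim_ratio (lin u.2) * vnorm ((u.1 : V) - D n) < m.+1%:R^-1] `&`
  [set u | vnorm (aact u.2 (D n) - v) < c - m.+1%:R^-1].
rewrite (_ : [set u | _] = \bigcup_n \bigcup_m Q n m); last first.
  apply/seteqP; split=> [[x g] /= h|[x g] [n _ [m _ [/= h1 h2]]]] /=; last first.
    have -> : aact g x - v = (aact g x - aact g (D n)) + (aact g (D n) - v).
      by rewrite addrA subrK.
    rewrite (le_lt_trans (vnormD _ _))// vnorm_aactB.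
    by apply: (lt_le_trans (ltrD h1 h2)); rewrite addrC subrK.
  set r := sim_ratio (lin g); have r0 : 0 < r := sim_ratio_gt0 g.
  set l := vnorm _ in h; have lc : 0 < (c - l) / 2 by rewrite divr_gt0// subr_gt0.
  have [m hm] : exists m : nat, m.+1%:R^-1 < (c - l) / 2.
    exists (Num.truncn ((c - l) / 2)^-1).
    rewrite invf_plt ?posrE//.
    by have /andP[] := truncn_itv (ltW (eqbRL (invr_gt0 _) lc)).
  have e0 : 0 < m.+1%:R^-1 / r by rewrite divr_gt0.
  have [n hn] := hD x _ e0; exists n => //; exists m => //; split=> /=.
    by rewrite mulrC -ltr_pdivlMr.
  have -> : aact g (D n) - v = (aact g (D n) - aact g x) + (aact g x - v).
    by rewrite addrA subrK.
  rewrite (le_lt_trans (vnormD _ _))// vnorm_aactB -/r [vnorm (D n - x)]vnormB.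
  have h3 : r * vnorm (x - D n) < m.+1%:R^-1 by rewrite mulrC -ltr_pdivlMr.
  rewrite -ltrBrDr; apply: (lt_le_trans h3); rewrite -/l. by move: hm; move: (m.+1%:R^-1 : R) => k hm; lra.
apply: bigcupT_measurable => n; apply: bigcupT_measurable => m.
apply: measurableI; apply: measurable_lt_set => //.
- apply: measurable_funM.
    apply: (measurableT_comp (f := fun g => sim_ratio (lin g))) => //.
    exact: measurable_ratio x00.
  apply: (measurableT_comp (f := fun x : vmeas => vnorm ((x : V) - D n))) => //.
  exact: measurable_vnorm.
- apply: (measurableT_comp (f := fun g => vnorm (aact g (D n) - v))) => //.
  exact: measurable_aact_norm.
Qed.

End similarity_facts.

(** * Displacement and exit from a ball *)
Section displacement.
Variables (R : realType) (K : absFieldType R) (V : normedVectType K).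
Variable mu : probability (asim V) R.
Hypothesis nondegenerate : ~ exists v : V, forall g, msupport mu g -> aact g v = v.
Local Notation E := (Ex mu).

Lemma nontrivial_space : exists x : V, x != 0.
Proof.
apply: contrapT => h; apply: nondegenerate; exists 0 => g _.
have z (x : V) : x = 0 by apply/eqP/negPn/negP => hx; apply: h; exists x.
by rewrite [LHS]z.
Qed.

Lemma measurable_sim_ratio : measurable_fun [set: asim V] (fun g => sim_ratio (lin g)).
Proof. by have [x0 h] := nontrivial_space; exact: measurable_ratio h. Qed.

Lemma contraction_fixpoint (g : asim V) : sim_ratio (lin g) < 1 -> exists v, aact g v = v.
Proof.
move=> c1; pose f := (\1 - lin g)%VF.
have kf : lker f == 0%VS.
  apply/lker0P => x y; rewrite /f !add_lfunE !opp_lfunE !id_lfunE => h.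
  have h2 : lin g (x - y) = x - y.
    apply/esym/eqP; rewrite linearB -subr_eq0.
    have -> : x - y - (lin g x - lin g y) = (x - lin g x) - (y - lin g y).
      by rewrite !opprD !opprK addrACA.
    by rewrite h subrr.
  have h3 := sim_ratioE g (x - y); rewrite h2 in h3.
  apply/eqP; rewrite -subr_eq0 -vnorm_eq0; have := vnorm_ge0 (x - y).
  rewrite le_eqVlt eq_sym => /orP[//|h4].
  have : vnorm (x - y) < vnorm (x - y); last by rewrite ltxx.
  by rewrite {1}h3 -[ltRHS]mul1r ltr_pM2r.
exists (f^-1%VF (trans g)); rewrite /aact.
have := lker0_lfunVK kf (trans g); rewrite {1}/f add_lfunE opp_lfunE id_lfunE => h.
by rewrite -[X in _ + X]h addrC subrK.
Qed.

Lemma open_displaced (v : V) : open [set h : asim V | 0 < vnorm (aact h v - v)].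
Proof.
rewrite openE => g /= g0; rewrite /interior -nbhs_ballE.
have k0 : 0 < 1 + vnorm v by rewrite ltr_wpDr// vnorm_ge0.
have e0 : 0 < vnorm (aact g v - v) / (1 + vnorm v) by rewrite divr_gt0.
exists (vnorm (aact g v - v) / (1 + vnorm v)) => //= h.
rewrite ballEmdist /= => gh.
have h1 : vnorm (aact g v - aact h v) <= (1 + vnorm v) * asim_dist g h.
  have -> : aact g v - aact h v = (lin g - lin h) v + (trans g - trans h).
    by rewrite /aact add_lfunE opp_lfunE opprD addrACA.
  apply: (le_trans (vnormD _ _)); rewrite /asim_dist.
  have := le_opnorm v (bounded_asimB g h); have := vnorm_ge0 v.
  have := vnorm_ge0 (trans g - trans h).
  have := opnorm_ge0 (bounded_asimB g h).
  set a := opnorm _; set b := vnorm _; set c := vnorm v; set d := vnorm _.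
  nra.
have h2 : vnorm (aact g v - v) <= vnorm (aact g v - aact h v) + vnorm (aact h v - v).
  by apply: le_trans (vnormD _ _); rewrite addrA subrK.
have h3 : (1 + vnorm v) * asim_dist g h < vnorm (aact g v - v).
  by rewrite mulrC -ltr_pdivlMr.
lra.
Qed.

Hypothesis contracting : (0 < mu [set g | (sim_ratio (lin g) < 1)%R])%E.

(** Otherwise there are points [x_k] that a random map moves by less than [e_k] with
probability at least [1 - e_k], where [e_k = 2 ^ - (k + 1)]. By Borel-Cantelli almost
every map moves [x_k] by less than [e_k] eventually. One of these maps is a
contraction, which forces [x_k] to converge to its fixed point, so that almost every
map fixes this point, and then all the maps of the support do. *)
Lemma displacement : exists rho p, [/\ 0 < rho, 0 < p &
  forall x : V, p <= E (\1_[set g | rho <= vnorm (aact g x - x)])].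
Proof.
have mF (e : R) (x : V) : measurable [set g : asim V | e <= vnorm (aact g x - x)].
  apply: measurable_le_set => //.
  exact: measurable_aact_norm.
apply: contrapT => hn.
have hx k : exists x : V, E (\1_[set g | (two R k.+1)^-1 <= vnorm (aact g x - x)]) < (two R k.+1)^-1.
  apply: contrapT => h; apply: hn; exists (two R k.+1)^-1, (two R k.+1)^-1.
  split; rewrite ?invr_gt0 ?two_gt0// => x; rewrite leNgt; apply/negP => h2.
  by apply: h; exists x.
have [x_ hx_] := choice hx; pose F k := [set g : asim V | (two R k.+1)^-1 <= vnorm (aact g (x_ k) - x_ k)].
have mu0 : mu (lim_sup_set F) = 0%E.
  apply: lim_sup_set_cvg0 => [k|]; first exact: mF.
  apply: (@le_lt_trans _ _ (\sum_(k <oo) (1 / (2 ^ k.+1)%N%:R : R)%:E)%E); last first.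
    by apply: le_lt_trans (epsilon_trick0 xpredT ler01) _; rewrite ltry.
  apply: lee_nneseries => [k _ _|k _]; first exact: measure_ge0.
  have muE : mu (F k) = (E (\1_(F k)))%:E.
    by rewrite Ex_indic; [rewrite fineK// fin_num_measure//; exact: mF|exact: mF].
  apply: (@le_trans _ _ (E (\1_(F k)))%:E); first by rewrite -muE.
  rewrite lee_fin div1r natrX -/(two R k.+1).
  exact: ltW (hx_ k).
have mN : measurable (lim_sup_set F)
  by apply: bigcapT_measurable => n; apply: bigcup_measurable => j _; exact: mF.
have outN g : ~ lim_sup_set F g -> exists n, forall j, (n <= j)%N -> vnorm (aact g (x_ j) - x_ j) < (two R j.+1)^-1.
  move=> h; apply: contrapT => h2; apply: h => n _; apply: contrapT => h3; apply: h2.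
  exists n => j nj; rewrite ltNge; apply/negP => h4; apply: h3; exists j => //.
have null (A : set (asim V)) : measurable A -> A `<=` lim_sup_set F -> mu A = 0%E.
  move=> mA AN; apply/eqP; rewrite -measure_le0 -mu0; apply: le_measure => //; rewrite inE//.
have [g0 [c1 g0N]] : exists g0, sim_ratio (lin g0) < 1 /\ ~ lim_sup_set F g0.
  apply: contrapT => h; move: contracting; rewrite null ?ltxx//.
    apply: measurable_lt_set => //.
    exact: measurable_sim_ratio.
  by move=> g /= cg; apply: contrapT => gN; apply: h; exists g.
have [v gv] := contraction_fixpoint c1.
have d0 : 0 < 1 - sim_ratio (lin g0) by rewrite subr_gt0.
have [n0 hn0] := outN g0 g0N.
have xv j : (n0 <= j)%N -> vnorm (x_ j - v) <= (two R j.+1)^-1 / (1 - sim_ratio (lin g0)).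
  move=> nj; rewrite ler_pdivlMr// mulrBr mulr1 lerBlDr.
  have h1 : vnorm (x_ j - v) <= vnorm (x_ j - aact g0 (x_ j)) + vnorm (aact g0 (x_ j) - aact g0 v).
    by rewrite gv; apply: le_trans (vnormD _ _); rewrite addrA subrK.
  apply: (le_trans h1); rewrite vnorm_aactB [X in _ + X <= _]mulrC lerD2r vnormB.
  exact: ltW (hn0 j nj).
have fixv g : ~ lim_sup_set F g -> aact g v = v.
  move=> gN; have [n1 hn1] := outN g gN.
  apply/eqP; rewrite -subr_eq0 -vnorm_eq0; apply: contraT => nz.
  have dp : 0 < vnorm (aact g v - v) by rewrite lt_neqAle eq_sym nz vnorm_ge0.
  pose k := (sim_ratio (lin g) + 1) / (1 - sim_ratio (lin g0)) + 1.
  have k0 : 0 < k.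
    by rewrite addr_gt0// divr_gt0// addr_gt0// sim_ratio_gt0.
  have [j0 hj0] := @two_unbounded R (k / vnorm (aact g v - v)).
  pose j := maxn j0 (maxn n0 n1).
  have j1 : (n0 <= j)%N by rewrite /j leq_max leq_max leqnn orbT.
  have j2 : (n1 <= j)%N by rewrite /j leq_max leq_max leqnn !orbT.
  have hj : k / vnorm (aact g v - v) < two R j.+1.
    apply: (le_lt_trans hj0); apply: (@le_lt_trans _ _ (two R j)).
      by apply: two_homo; rewrite leq_maxl.
    by rewrite twoS ltr_pMl ?two_gt0// ltr1n.
  have h1 : vnorm (aact g v - v) <= vnorm (aact g v - aact g (x_ j)) + (vnorm (aact g (x_ j) - x_ j) + vnorm (x_ j - v)).
    rewrite (le_trans _ (lerD (lexx _) (vnormD _ _)))// addrA subrK.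
    by apply: le_trans (vnormD _ _); rewrite addrA subrK.
  have h2 : vnorm (aact g v - v) <= (two R j.+1)^-1 * k.
    apply: (le_trans h1); rewrite vnorm_aactB [vnorm (v - _)]vnormB.
    have a1 := xv j j1; have a2 := ltW (hn1 j j2).
    have a3 : sim_ratio (lin g) * vnorm (x_ j - v) <= sim_ratio (lin g) * ((two R j.+1)^-1 / (1 - sim_ratio (lin g0))).
      by rewrite ler_pM2l// sim_ratio_gt0.
    apply: (le_trans (lerD a3 (lerD a2 a1))).
    apply: eq_ler; rewrite /k; ring.
  have tp := two_gt0 R j.+1.
  have h4 : two R j.+1 * vnorm (aact g v - v) <= k by rewrite mulrC -ler_pdivlMr// [k / _]mulrC.
  have h3 : k < two R j.+1 * vnorm (aact g v - v) by rewrite -ltr_pdivrMr.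
  by have := lt_le_trans h3 h4; rewrite ltxx.
apply: nondegenerate; exists v => g gs; apply: contrapT => gv'.
have gU : [set h : asim V | 0 < vnorm (aact h v - v)] g.
  by rewrite /= lt_neqAle vnorm_ge0 andbT eq_sym vnorm_eq0 subr_eq0; apply/eqP.
have := gs _ (@open_displaced v) gU; rewrite null ?ltxx//.
  exact: sub_sigma_algebra (@open_displaced v).
move=> h /= hp; apply: contrapT => hN; move: hp.
by rewrite (fixv h hN) subrr vnorm0 ltxx.
Qed.

End displacement.

Lemma measurable_Ex_section d1 d2 (T1 : measurableType d1) (T2 : measurableType d2)
    (R : realType) (m : probability T2 R) (f : T1 * T2 -> R) :
  measurable_fun [set: T1 * T2] f -> (forall u, 0 <= f u) ->
  measurable_fun [set: T1] (fun x => Ex m (fun y => f (x, y))).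
Proof.
move=> mf f0.
apply: (measurableT_comp (f := fine)); first exact: fine_measurable.
apply: (@measurable_fun_fubini_tonelli_F _ _ T1 T2 R m (EFin \o f)).
  exact/measurable_EFinP.
by move=> u; rewrite /= lee_fin.
Qed.

Section exit_function.
Variables (R : realType) (K : absFieldType R) (V : normedVectType K).
Variable mu : probability (asim V) R.
Hypothesis hK : local_field K.
Local Notation E := (Ex mu).
Variables (a pa rho p r : R).
Hypotheses (a0 : 0 < a) (pa0 : 0 < pa) (rho0 : 0 < rho) (p0 : 0 < p) (r0 : 0 < r).
Hypothesis mc : measurable_fun [set: asim V] (fun g => sim_ratio (lin g)).
Hypothesis expand : pa <= E (\1_[set g | a <= ln (sim_ratio (lin g))]).
Hypothesis displaced : forall x : V, p <= E (\1_[set g | rho <= vnorm (aact g x - x)]).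

Let avg (f : V -> R) (x : V) : R := E (fun g => f (aact g x)).
Let ok (f : V -> R) := measurable_fun [set: vmeas V] (f : vmeas V -> R) /\ forall x, 0 <= f x <= 1.

Let mact (f : V -> R) x : ok f -> measurable_fun [set: asim V] (fun g => f (aact g x)).
Proof.
move=> [mf _]; apply: (measurableT_comp (f := (f : vmeas V -> R))) => //.

exact: (measurable_fun_pair2 (x : vmeas V) (measurable_act hK)).
Qed.

Let iact (f : V -> R) x : ok f -> itg mu (fun g => f (aact g x)).
Proof.
move=> okf; apply: (@itg_bnd _ _ _ _ _ 1); first exact: mact.
by move=> g; have /andP[h1 h2] := okf.2 (aact g x); rewrite ger0_norm.
Qed.

Let ok_avg f : ok f -> ok (avg f).
Proof.
move=> okf; split=> [|x].
  apply: (@measurable_Ex_section _ _ (vmeas V) (asim V) R mu (fun u => f (aact u.2 (u.1 : V)))).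
    apply: (measurableT_comp (f := (f : vmeas V -> R))); first exact: okf.1.
    exact: measurable_act hK.
  by move=> u; have /andP[] := okf.2 (aact u.2 (u.1 : V)).
rewrite Ex_ge0 => [|g]; last by have /andP[] := okf.2 (aact g x).
rewrite -(Ex_cst mu 1) Ex_le//; [exact: iact|exact: itg_cst|].
by move=> g; have /andP[] := okf.2 (aact g x).
Qed.

Let inB (x : V) : R := (vnorm x <= r)%R%:R.

Let ok_inB : ok inB.
Proof.
split=> [|x]; last by rewrite /inB; case: (vnorm x <= r); rewrite /= ?lexx ?ler01.
have mB : measurable [set x : vmeas V | vnorm (x : V) <= r].
  apply: measurable_le_set => //.
  have h := @measurable_vnorm R K V 0.
  by apply: eq_measurable_fun h => x _; rewrite subr0.
have -> : (inB : vmeas V -> R) = \1_[set x : vmeas V | vnorm (x : V) <= r].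
  by apply/funext => x; rewrite /inB indicE; congr (_%:R); congr nat_of_bool; apply/idP/idP; rewrite in_setE.
exact: measurable_indic.
Qed.

(** The probability that the walk from a given point is in the ball at time [k]. *)
Fixpoint hit k : V -> R := if k is k'.+1 then avg (hit k') else inB.
(** The probability that it is in the ball at all times up to [k]. *)
Fixpoint stay k : V -> R := if k is k'.+1 then fun x => inB x * avg (stay k') x else inB.

Let ok_hit k : ok (hit k).
Proof. by elim: k => [|k IH] /=; [exact: ok_inB|exact: ok_avg]. Qed.

Let ok_stay k : ok (stay k).
Proof.
elim: k => [|k IH] /=; first exact: ok_inB.
have [m1 h1] := ok_inB; have [m2 h2] := ok_avg IH; split=> [|x].
  exact: measurable_funM.
have /andP[x1 x2] := h1 x; have /andP[x3 x4] := h2 x.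
by rewrite mulr_ge0// mulr_ile1.
Qed.

Let avg_le f g x : ok f -> ok g -> (forall y, f y <= g y) -> avg f x <= avg g x.
Proof. by move=> okf okg fg; apply: Ex_le; [exact: iact|exact: iact|]. Qed.

Let stay_le_hit k x : stay k x <= hit k x.
Proof.
elim: k x => [//|k IH] x /=.
have /andP[h1 h2] := ok_inB.2 x; have /andP[h3 h4] := (ok_avg (ok_stay k)).2 x.
by apply: (@le_trans _ _ (avg (stay k) x)); [rewrite ler_piMl|exact: avg_le].
Qed.

Let stay_decr k x : stay k.+1 x <= stay k x.
Proof.
elim: k x => [|k IH] x.
  rewrite /=; have /andP[h1 h2] := ok_inB.2 x; have /andP[h3 h4] := (ok_avg ok_inB).2 x.
  by rewrite ler_piMr.
rewrite /=; apply: ler_wpM2l; last exact: (avg_le x (ok_stay k.+1) (ok_stay k) IH).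
by have /andP[] := ok_inB.2 x.
Qed.

Let mexpand : measurable [set g : asim V | a <= ln (sim_ratio (lin g))].
Proof.
apply: measurable_le_set => //.
exact: measurableT_comp.
Qed.

(** Two starting points that are far apart cannot both lead to the ball with a high
probability, since [k] expanding steps may drive them even further apart. *)
Let hit_far k x y : 2 * r * expR (- (a * k%:R)) < vnorm (x - y) ->
  hit k x + hit k y <= 2 - pa ^+ k.
Proof.
elim: k x y => [|k IH] x y.
  rewrite mulr0 oppr0 expR0 mulr1 expr0 /= /inB => h.
  case: (leP (vnorm x) r) => hx; case: (leP (vnorm y) r) => hy /=; try lra.
  have := vnormD x (- y); rewrite vnormN; lra.
move=> h; rewrite /= -ExD; [|exact: iact|exact: iact].
have p1 : 0 <= pa ^+ k by rewrite exprn_ge0// ltW.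
pose e : asim V -> R := \1_[set g : asim V | a <= ln (sim_ratio (lin g))].
have ie : itg mu e by exact: itg_indic.
have i1 : itg mu (fun g => 2 - pa ^+ k * e g) by apply: itgB; [exact: itg_cst|exact: itgZ].
apply: (@le_trans _ _ (E (fun g => 2 - pa ^+ k * e g))).
  apply: Ex_le => //; first by apply: itgD; exact: iact.
  move=> g; rewrite /e indicE; have [/set_mem /= hg|_] := boolP (g \in _); last first.
    have /andP[_ h1] := (ok_hit k).2 (aact g x); have /andP[_ h2] := (ok_hit k).2 (aact g y).
    by rewrite mulr0 subr0 -[2]/(1 + 1) lerD.
  rewrite mulr1; apply: IH; rewrite vnorm_aactB.
  have cg := sim_ratio_gt0 g; have ca : expR a <= sim_ratio (lin g).
    by rewrite -[leRHS](@lnK _ (sim_ratio (lin g))) ?posrE// ler_expR.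
  have -> : 2 * r * expR (- (a * k%:R)) = expR a * (2 * r * expR (- (a * k.+1%:R))).
    rewrite mulrCA -expRD; congr (_ * expR _); rewrite -natr1; ring.
  apply: (@lt_le_trans _ _ (expR a * vnorm (x - y))); first by rewrite ltr_pM2l// expR_gt0.
  by rewrite ler_wpM2r// vnorm_ge0.
rewrite ExB; [|exact: itg_cst|exact: itgZ].
rewrite Ex_cst ExZ// lerD2l lerN2 exprS mulrC; exact: ler_wpM2l.
Qed.

(** Compare the walk from [x] with the one that skips the first step. They start
at distance at least [rho] with probability at least [p], and then one of them is out of
the ball at time [n] with a definite probability. *)
Lemma stay_exits : exists n eta, 0 < eta /\ forall x, stay n.+1 x <= 1 - eta.
Proof.
have [n hn] : exists n : nat, 2 * r * expR (- (a * n%:R)) < rho.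
  have h : expR (- a) ^+ n @[n --> \oo] --> (0 : R).
    by apply: cvg_expr; rewrite ger0_norm ?expR_ge0// -[ltRHS](expR0 R) ltr_expR oppr_lt0.
  have d0 : 0 < rho / (2 * r) by rewrite divr_gt0// mulr_gt0.
  have /cvgrPdist_lt/(_ _ d0)[N _ hN] := h; exists N.
  have := hN N (leqnn _); rewrite /= sub0r normrN ger0_norm ?exprn_ge0 ?expR_ge0//.
  rewrite ltr_pdivlMr ?mulr_gt0// mulrC -expRM_natr; congr (_ * expR _ < _); ring.
exists n, (p * pa ^+ n / 2); have pn : 0 < pa ^+ n by rewrite exprn_gt0.
split=> [|x]; first by rewrite divr_gt0// mulr_gt0.
pose e : asim V -> R := \1_[set g : asim V | rho <= vnorm (aact g x - x)].
have ie : itg mu e.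
  by apply: itg_indic; apply: measurable_le_set => //; exact: measurable_aact_norm.
have s1 : stay n.+1 x <= avg (hit n) x.
  rewrite /=; have /andP[h1 h2] := ok_inB.2 x; have /andP[h3 h4] := (ok_avg (ok_stay n)).2 x.
  by apply: (@le_trans _ _ (avg (stay n) x)); [rewrite ler_piMl|apply: avg_le].
have s2 : stay n.+1 x <= hit n x by exact: le_trans (stay_decr n x) (stay_le_hit n x).
have s3 : avg (hit n) x + hit n x <= 2 - pa ^+ n * E e.
  rewrite -[X in _ + X <= _](Ex_cst mu) -ExD; [|exact: iact|exact: itg_cst].
  rewrite -[X in X - _](Ex_cst mu) -ExZ// -ExB; [|exact: itg_cst|exact: itgZ].
  apply: Ex_le; [by apply: itgD; [exact: iact|exact: itg_cst]|by apply: itgB; [exact: itg_cst|exact: itgZ]|].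
  move=> g; rewrite /e indicE; have [/set_mem /= hg|_] := boolP (g \in _); last first.
    have /andP[_ h1] := (ok_hit n).2 (aact g x); have /andP[_ h2] := (ok_hit n).2 x.
    by rewrite mulr0 subr0 -[2]/(1 + 1) lerD.
  by rewrite mulr1; apply: hit_far; exact: lt_le_trans hn hg.
have s4 : pa ^+ n * p <= pa ^+ n * E e.
  by apply: ler_wpM2l; [exact: ltW|exact: displaced].
rewrite [p * _]mulrC; move: s1 s2 s3 s4.
by move: (stay n.+1 x) (avg _ _) (hit _ _) (pa ^+ n * p) (pa ^+ n * E e) => ? ? ? ? ? *; lra.
Qed.

(** The expected number of times in the ball before exit, up to a bounded time. *)
Lemma exit_function : exists (NN eta : R) (l : V -> R), [/\ 0 <= NN, 0 < eta,
  measurable_fun [set: vmeas V] (l : vmeas V -> R),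
  (forall x, 0 <= l x <= NN) /\ (forall x, r < vnorm x -> l x = 0) &
  forall x, vnorm x <= r -> E (fun g => l (aact g x)) <= l x - eta].
Proof.
have [n [eta [eta0 he]]] := stay_exits.
pose l x := \sum_(k < n.+1) stay k x.
exists n.+1%:R, eta, l; split=> //.
- by apply: measurable_sum => k; exact: (ok_stay k).1.
- split=> x.
    rewrite sumr_ge0 => [|k _]; last by have /andP[] := (ok_stay k).2 x.
    rewrite -[n.+1]card_ord -sumr_const; apply: ler_sum => k _.
    by have /andP[] := (ok_stay k).2 x.
  move=> hx; apply: big1 => -[[|k] hk] _ /=; first by rewrite /inB leNgt hx.
  by rewrite /inB leNgt hx mul0r.
move=> x hx; have hl : E (fun g => l (aact g x)) = \sum_(k < n.+1) stay k.+1 x.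
  rewrite (@Ex_sum _ _ _ mu n.+1 (fun k g => stay k (aact g x))); last by move=> k; exact: iact.
  by apply: eq_bigr => k _ /=; rewrite /inB hx mul1r.
rewrite hl /l [leLHS]big_ord_recr [X in _ <= X - _]big_ord_recl /=.
have -> : \sum_(i < n) inB x * avg (stay i) x = \sum_(i < n) stay (bump 0 i) x.
  by apply: eq_bigr => i _; rewrite /bump add1n.
have hb : inB x = 1 by rewrite /inB hx.
by have := he x; rewrite /= hb; move: (\sum_(_ < _) _) (1 * _) => S t; lra.
Qed.

End exit_function.

(** * Markov chains driven by independent steps *)
Section chain.
Context dE (E : measurableType dE) dS (S : measurableType dS) (R : realType).
Context d (Omega : measurableType d).
Variables (P : probability Omega R) (X : nat -> {mfun Omega >-> S}) (mu : probability S R).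
Hypotheses (indep : mutually_independent P X) (law : forall i, has_law P (X i) mu).
Variables (step : E * S -> E) (y0 : E).
Hypothesis mstep : measurable_fun [set: E * S] step.

Fixpoint chain n (w : Omega) : E :=
  if n is m.+1 then step (chain m w, X m w) else y0.

Let mX n : measurable_fun [set: Omega] (X n). Proof. by []. Qed.

Lemma measurable_chain n : measurable_fun [set: Omega] (chain n).
Proof.
elim: n => [|n IH] /=; first exact: measurable_cst.
apply: (measurableT_comp mstep); exact: measurable_fun_pair.
Qed.

Let Z n (w : Omega) := (chain n w, X n w).
Let mZ n : measurable_fun [set: Omega] (Z n).
Proof. exact: measurable_fun_pair (measurable_chain n) (mX n). Qed.

Let mpre d1 (T1 : measurableType d1) (f : Omega -> T1) A :
  measurable_fun [set: Omega] f -> measurable A -> measurable (f @^-1` A).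
Proof. by move=> mf mA; rewrite -[X in measurable X]setTI; exact: mf. Qed.

Let cyl (J : seq nat) (B : nat -> set S) := \bigcap_(i in [set` J]) (X i @^-1` B i).

Let mcyl J B : (forall i, measurable (B i)) -> measurable (cyl J B).
Proof.
by move=> mB; apply: bigcap_measurableType => i _; exact: mpre.
Qed.

(** The state at time [n] is independent of the later steps; the pair of the state and
of the next step is treated by the pi-lambda theorem. *)
Let indep_cyl n A J B : measurable A -> (forall i, measurable (B i)) -> uniq J ->
  all (leq n) J -> P (chain n @^-1` A `&` cyl J B) = (P (cyl J B) * P (chain n @^-1` A))%E.
Proof.
elim: n A J B => [|n IH] A J B mA mB uJ nJ.
  have [Ay|nAy] := pselect (A y0).
    have -> : chain 0 @^-1` A = setT by apply/seteqP; split.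
    by rewrite setTI probability_setT mule1.
  have -> : chain 0 @^-1` A = set0 by apply/seteqP; split.
  by rewrite set0I measure0 mule0.
have mG := mcyl J mB.
have finG : P (cyl J B) \is a fin_num by rewrite fin_num_measure.
have nJ' : n \notin J by apply/negP => /(allP nJ); rewrite ltnn.
have uJ' : uniq (n :: J) by rewrite /= nJ' uJ.
have allJ' : all (leq n) (n :: J) by rewrite /= leqnn; apply: sub_all nJ => i; exact: ltnW.
suff key D : measurable D -> P (Z n @^-1` D `&` cyl J B) = (P (cyl J B) * P (Z n @^-1` D))%E.
  apply: (key (step @^-1` A)); rewrite -[X in measurable X]setTI; exact: mstep.
pose G := [set A `*` B | A in @measurable _ E & B in @measurable _ S].
move=> mD; have : <<s G >> D by rewrite -measurable_prod_measurableType.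
have ZI D1 : measurable D1 -> measurable (Z n @^-1` D1) by exact: mpre.
pose Q : set_system (E * S)%type := fun D1 => P (Z n @^-1` D1 `&` cyl J B) = (P (cyl J B) * P (Z n @^-1` D1))%E.
move: D {mD}; apply: (@dynkin_induction _ (E * S)%type G Q); rewrite /Q => //.
- exact: measurable_prod_measurableType.
- move=> _ _ [A1 mA1 [B1 mB1 <-]] [A2 mA2 [B2 mB2 <-]].
  exists (A1 `&` A2); first exact: measurableI.
  exists (B1 `&` B2); first exact: measurableI.
  by rewrite setXI.
- by rewrite preimage_setT setTI probability_setT mule1.
- move=> _ [A1 mA1 [B1 mB1 <-]].
  pose B' i := if i == n then B1 else B i.
  have mB' i : measurable (B' i) by rewrite /B'; case: ifP.
  have BJ i : i \in J -> B' i = B i.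
    by move=> iJ; rewrite /B'; case: eqP => // e; rewrite -e iJ in nJ'.
  have cJ : cyl J B' = cyl J B by apply: eq_bigcapr => i iJ; rewrite BJ.
  have cS : cyl (n :: J) B' = X n @^-1` B1 `&` cyl J B.
    rewrite -cJ; apply/seteqP; split=> w.
      move=> h; split; first by have := h n; rewrite /= mem_head /B' eqxx; apply.
      by move=> i iJ; apply: h; rewrite /= inE iJ orbT.
    move=> [h1 h2] i /=; rewrite inE => /orP[/eqP->|iJ]; first by rewrite /B' eqxx.
    exact: h2.
  have c1 : cyl [:: n] B' = X n @^-1` B1.
    apply/seteqP; split=> w; first by move/(_ n); rewrite /= mem_head /B' eqxx; apply.
    by move=> h i /=; rewrite inE => /eqP ->; rewrite /B' eqxx.
  have ZX : Z n @^-1` (A1 `*` B1) = chain n @^-1` A1 `&` X n @^-1` B1 by [].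
  rewrite ZX -setIA -cS IH// -c1 IH//=; last by rewrite leqnn.
  have -> : P (cyl (n :: J) B') = (P (cyl [:: n] B') * P (cyl J B'))%E.
    by rewrite /cyl !indep// big_cons big_seq1.
  by rewrite cJ muleCA muleA [(_ * P (cyl J B))%E]muleC.
- move=> D1 mD1 hD1; have {}hD1 : P (Z n @^-1` D1 `&` cyl J B) = (P (cyl J B) * P (Z n @^-1` D1))%E := hD1.
  have -> : Z n @^-1` (~` D1) = ~` (Z n @^-1` D1) by [].
  rewrite setIC -setDE.
  rewrite measureD//; [|exact: ZI|by rewrite -ge0_fin_numE].
  have h2 : P (cyl J B `&` Z n @^-1` D1) = (P (cyl J B) * P (Z n @^-1` D1))%E by rewrite setIC.
  transitivity (P (cyl J B) - P (cyl J B `&` Z n @^-1` D1))%E => //.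
  rewrite h2 probability_setC; last exact: ZI.
  have finZ : P (Z n @^-1` D1) \is a fin_num by rewrite fin_num_measure//; exact: ZI.
  rewrite -(fineK finG) -(fineK finZ) -EFinM -EFinB -EFinB -EFinM; congr EFin; ring.
- move=> F mF tF hF; rewrite preimage_bigcup setI_bigcupl.
  have tZ : trivIset setT (fun k => Z n @^-1` F k).
    apply/trivIsetP => i j _ _ ij; rewrite -preimage_setI.
    by move/trivIsetP : tF => ->//; rewrite preimage_set0.
  rewrite measure_bigcup//; last 2 first.
  - by move=> k _; apply: measurableI => //; exact: ZI.
  - by apply: trivIset_setIr.
  rewrite [in RHS]measure_bigcup//; last by move=> k _; exact: ZI.
  rewrite -(fineK finG) -nneseriesZl//.
  have {}hF k : P (Z n @^-1` F k `&` cyl J B) = ((fine (P (cyl J B)))%:E * P (Z n @^-1` F k))%E.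
    by rewrite fineK//; exact: (hF k).
  by apply: eq_eseriesr => k _; exact: hF.
Qed.

Lemma joint_law n A B : measurable A -> measurable B ->
  P (Z n @^-1` (A `*` B)) = (P (chain n @^-1` A) * mu B)%E.
Proof.
move=> mA mB.
have ZX : Z n @^-1` (A `*` B) = chain n @^-1` A `&` cyl [:: n] (fun=> B).
  apply/seteqP; split=> w [h1 h2]; split=> //; first by move=> i /=; rewrite inE => /eqP ->.
  by have := h2 n; rewrite /= mem_head; apply.
have c1 : cyl [:: n] (fun=> B) = X n @^-1` B.
  apply/seteqP; split=> w; first by move/(_ n); rewrite /= mem_head; apply.
  by move=> h i /=; rewrite inE => /eqP ->.
rewrite ZX indep_cyl//= ?leqnn// c1 -(law n mB) muleC //.
Qed.

Lemma chain_step n (f : E -> R) : measurable_fun [set: E] f -> (forall y, 0 <= f y <= 1) ->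
  Ex P (fun w => f (chain n.+1 w)) = Ex P (fun w => Ex mu (fun g => f (step (chain n w, g)))).
Proof.
move=> mf f01.
have f0 y : (0 <= (f y)%:E)%E by rewrite lee_fin; case/andP: (f01 y).
pose c : {mfun Omega >-> E} := HB.pack (chain n) (isMeasurableFun.Build _ _ _ _ (chain n) (measurable_chain n)).
pose z : {mfun Omega >-> (E * S)%type} := HB.pack (Z n) (isMeasurableFun.Build _ _ _ _ (Z n) (@mZ n)).
pose F (u : E * S) : \bar R := (f (step u))%:E.
have mF : measurable_fun [set: E * S] F by apply/measurable_EFinP; exact: measurableT_comp.
have F0 u : (0 <= F u)%E by exact: f0.
have zE D : measurable D -> distribution P z D = (distribution P c \x mu)%E D.
  move=> mD; symmetry; apply: (@product_measure_unique _ _ E S R (distribution P c) mu (distribution P z)) => // A B mA mB.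
  exact: joint_law.
have h1 : (\int[P]_w (f (chain n.+1 w))%:E = \int[P]_w \int[mu]_g (f (step (chain n w, g)))%:E)%E.
  have -> : (\int[P]_w (f (chain n.+1 w))%:E = \int[P]_w (F \o z) w)%E by [].
  rewrite -ge0_integral_distribution//.
  rewrite (eq_measure_integral (distribution P c \x mu)%E); last by move=> D mD _; exact: zE.
  rewrite fubini_tonelli1//.
  rewrite ge0_integral_distribution//.
    exact: (@measurable_fun_fubini_tonelli_F _ _ E S R mu F).
  by move=> y; apply: integral_ge0 => g _; exact: F0.
have is1 y : itg mu (fun g => f (step (y, g))).
  apply: (@itg_bnd _ _ _ _ _ 1); last by move=> g; have /andP[a b] := f01 (step (y, g)); rewrite ger0_norm.
  by apply: measurableT_comp => //; exact: (measurable_fun_pair2 y mstep).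
rewrite /Ex /Rintegral h1; congr fine; apply: eq_integral => w _.
by rewrite -[RHS]/((Ex mu (fun g => f (step (chain n w, g))))%:E) -ExE.
Qed.

End chain.

Section transience.
Context dE (E : measurableType dE) dS (S : measurableType dS) (R : realType).
Context d (Omega : measurableType d).
Variables (P : probability Omega R) (X : nat -> {mfun Omega >-> S}) (mu : probability S R).
Hypotheses (indep : mutually_independent P X) (law : forall i, has_law P (X i) mu).
Variables (step : E * S -> E) (y0 : E).
Hypothesis mstep : measurable_fun [set: E * S] step.
Variables (Phi : E -> R) (A : set E) (eps : R).
Hypotheses (mPhi : measurable_fun [set: E] Phi) (Phi01 : forall y, 0 <= Phi y <= 1).
Hypotheses (mA : measurable A) (eps0 : 0 < eps).
Hypothesis super : forall y, Phi y < 1 ->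
  Ex mu (fun g => Phi (step (y, g))) <= Phi y - eps * \1_A y.

(** The state is completed by a flag which tells that [Phi] was below 1 at all earlier
times: this stops the supermartingale. *)
Let EB : measurableType _ := (E * bool)%type.
Let alive (u : EB) : bool := u.2 && (Phi u.1 < 1).
Let stepB (v : EB * S) : EB := (step (v.1.1, v.2), alive v.1).
Let f (u : EB) : R := if u.2 then Phi u.1 else 1.

Let m11 : measurable_fun [set: EB] (fun u : EB => u.1). Proof. exact: measurable_fst. Qed.
Let mPhi1 : measurable_fun [set: EB] (fun u : EB => Phi u.1).
Proof. exact: measurableT_comp mPhi m11. Qed.

Let malive : measurable_fun [set: EB] alive.
Proof.
apply: measurable_and; first exact: measurable_snd.
by apply: measurable_fun_ltr.
Qed.

Let mstepB : measurable_fun [set: EB * S] stepB.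
Proof.
apply: measurable_fun_pair; last by apply: (measurableT_comp malive); exact: measurable_fst.
apply: (measurableT_comp mstep); apply: measurable_fun_pair; last exact: measurable_snd.
by apply: (measurableT_comp m11); exact: measurable_fst.
Qed.

Let mf : measurable_fun [set: EB] f.
Proof. by apply: measurable_fun_ifT => //; exact: measurable_snd. Qed.

Let f01 u : 0 <= f u <= 1.
Proof. by rewrite /f; case: ifP => _ //; rewrite ler01 lexx. Qed.

Let Y := chain X stepB (y0, true).

Let Y1 n w : (Y n w).1 = chain X step y0 n w.
Proof. by elim: n => [//|n IH] /=; rewrite /stepB/= IH. Qed.

Let mY n : measurable_fun [set: Omega] (Y n). Proof. exact: measurable_chain. Qed.

Let AL : set EB := [set u | alive u].
Let D : set EB := [set u | alive u /\ A u.1].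

Let mAL : measurable AL.
Proof.
have -> : AL = [set: EB] `&` alive @^-1` [set true] by apply/seteqP; split=> u; [split|case].
exact: malive.
Qed.

Let mD : measurable D.
Proof.
have -> : D = AL `&` (fun u : EB => u.1) @^-1` A by [].
by apply: measurableI => //; rewrite -[X in measurable X]setTI; exact: m11.
Qed.

Let mYn n B : measurable B -> measurable (Y n @^-1` B).
Proof. by move=> mB; rewrite -[X in measurable X]setTI; exact: mY. Qed.

Let f_step u : Ex mu (fun g => f (stepB (u, g))) <= f u - eps * \1_D u.
Proof.
have [al|nal] := boolP (alive u).
  have [u2 p1] := andP al.
  have -> : \1_D u = \1_A u.1 :> R.
    rewrite !indicE; congr (_%:R); congr nat_of_bool; apply/idP/idP; rewrite !in_setE => //.
    by case.
  rewrite {2}/f u2; apply: le_trans (super p1).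
  by apply/eq_ler/eq_Ex => g; rewrite /f /stepB /= al.
have -> : \1_D u = 0 :> R.
  by rewrite indicE memNset// => -[h _]; rewrite h in nal.
rewrite mulr0 subr0 (eq_Ex mu (g := fun=> 1)) ?Ex_cst; last first.
  by move=> g; rewrite /f /stepB /= (negbTE nal).
rewrite /f; case: ifP => // u2; move: nal; rewrite /alive u2 /= -leNgt //.
Qed.

Let meanf n : R := Ex P (fun w => f (Y n w)).
Let D_ n := Y n @^-1` D.

Let itgf n : itg P (fun w => f (Y n w)).
Proof.
apply: (@itg_bnd _ _ _ _ _ 1); first exact: measurableT_comp.
by move=> w; have /andP[h1 h2] := f01 (Y n w); rewrite ger0_norm.
Qed.

Let meanf_step n : meanf n.+1 + eps * Ex P (\1_(D_ n)) <= meanf n.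
Proof.
have iD : itg P (\1_(D_ n)) by apply: itg_indic; exact: mYn.
rewrite -lerBrDr -(ExZ _ iD) /meanf -ExB//; last exact: itgZ.
rewrite (chain_step indep law (y0, true) mstepB n mf f01).
apply: Ex_le => [| |w].
- apply: (@itg_bnd _ _ _ _ _ 1).
    apply: (measurableT_comp (f := fun u : EB => Ex mu (fun g => f (stepB (u, g))))); last exact: mY.
    apply: (@measurable_Ex_section _ _ EB S R mu (fun v => f (stepB v))).
      exact: measurableT_comp.
    by move=> v; case/andP: (f01 (stepB v)).
  move=> w; rewrite ger0_norm; last by apply: Ex_ge0 => g; case/andP: (f01 (stepB (Y n w, g))).
  apply: (le_trans (f_step _)); have /andP[_ h] := f01 (Y n w).
  by rewrite (le_trans _ h)// gerBl mulr_ge0 ?(ltW eps0)// indicE.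
- by apply: itgB => //; exact: itgZ.
- by apply: (le_trans (f_step _)); rewrite lerD2l lerN2 ler_pM2l//.
Qed.

Let sum_visits n : eps * (\sum_(k < n) Ex P (\1_(D_ k))) <= Phi y0 - meanf n.
Proof.
elim: n => [|n IH].
  by rewrite big_ord0 mulr0 /meanf /Y /= /f /= Ex_cst subrr.
by rewrite big_ord_recr/= mulrDr; have := meanf_step n; move: IH; lra.
Qed.

Let meanf_ge0 n : 0 <= meanf n.
Proof. by apply: Ex_ge0 => w; case/andP: (f01 (Y n w)). Qed.

Let meanf_le n : meanf n <= Phi y0.
Proof.
have := sum_visits n; rewrite -subr_ge0; apply: contraTT; rewrite -!ltNge => h.
have h1 : 0 <= eps * (\sum_(k < n) Ex P (\1_(D_ k))).
  by rewrite mulr_ge0 ?(ltW eps0)// sumr_ge0// => k _; apply: Ex_ge0 => w; rewrite indicE.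
lra.
Qed.

Let PE B : measurable B -> P B = (Ex P (\1_B))%:E.
Proof. by move=> mB; rewrite Ex_indic// fineK// fin_num_measure. Qed.

Let visits_null : P (lim_sup_set D_) = 0%E.
Proof.
apply: lim_sup_set_cvg0 => [k|]; first exact: mYn.
apply: (@le_lt_trans _ _ (Phi y0 / eps)%:E); last by rewrite ltry.
apply: lime_le; first by apply: is_cvg_nneseries => k _ _; exact: measure_ge0.
apply: nearW => n.
rewrite (eq_bigr (fun k => (Ex P (\1_(D_ k)))%:E)); last by move=> k _; apply: PE; exact: mYn.
rewrite sumEFin lee_fin ler_pdivlMr// mulrC big_mkord.
by apply: (le_trans (sum_visits n)); rewrite gerBl.
Qed.

Let dead n := ~` (Y n @^-1` AL).

Let mdead n : measurable (dead n).
Proof. by apply: measurableC; exact: mYn. Qed.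

Let dead_le n : (P (dead n) <= (Phi y0)%:E)%E.
Proof.
rewrite PE// lee_fin; apply: le_trans (meanf_le n); apply: Ex_le => // [|w].
  exact: itg_indic.
rewrite indicE; have [/set_mem hw|_] := boolP (w \in _); last by case/andP: (f01 (Y n w)).
rewrite /f; case: ifP => // u2; rewrite leNgt; apply/negP => h; apply: hw.
by rewrite /= /AL /= /alive u2.
Qed.

Let dead_union : (P (\bigcup_n dead n) <= (Phi y0)%:E)%E.
Proof.
have h : P (dead n) @[n --> \oo] --> P (\bigcup_n dead n).
  apply: nondecreasing_cvg_mu => //; first exact: bigcupT_measurable.
  apply/nondecreasing_seqP => n; apply/subsetPset => w hw h; apply: hw.
  by move: h => /andP[].
rewrite -(cvg_lim _ h)//; apply: lime_le; first by apply/cvg_ex; exists (P (\bigcup_n dead n)).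
exact: nearW.
Qed.

(** As long as it is alive, the stopped supermartingale loses [eps] at each visit to
[A], so by Borel-Cantelli there are finitely many of them; it dies with probability at
most [Phi y0]. *)
Lemma transient :
  (P (lim_sup_set (fun n => chain X step y0 n @^-1` A)) <= (Phi y0)%:E)%E.
Proof.
apply: le_trans dead_union; rewrite -[leRHS]add0e -visits_null.
have mlim (F : nat -> set Omega) : (forall n, measurable (F n)) -> measurable (lim_sup_set F).
  by move=> mF; apply: bigcapT_measurable => n; apply: bigcup_measurable => j _; exact: mF.
have mU : measurable (\bigcup_n dead n) by exact: bigcupT_measurable.
have mC n : measurable (chain X step y0 n @^-1` A).
  by rewrite -[X in measurable X]setTI; exact: measurable_chain.
apply: (@le_trans _ _ (P (lim_sup_set D_ `|` \bigcup_n dead n))); last first.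
  by apply: measureU2 => //; apply: mlim => n; exact: mYn.
apply: le_measure; rewrite ?inE; [exact: mlim| |].
  by apply: measurableU => //; apply: mlim => n; exact: mYn.
move=> w hw; have [h|h] := pselect ((\bigcup_n dead n) w); [by right|left].
move=> n _; have [j nj hj] := hw n I; exists j => //; split.
  by apply: contrapT => hd; apply: h; exists j.
by rewrite Y1.
Qed.

End transience.

Lemma negligible_null d (T : measurableType d) (R : realType) (P : probability T R) (A : set T) :
  measurable A -> P A = 0%E -> P.-negligible A.
Proof. by move=> mA A0; exists A; split. Qed.

(** * The random walk of similarities *)

(** A centred variable that is almost surely nonpositive is almost surely 0. *)
Lemma centered_positive_part d (T : measurableType d) (R : realType) (P : probability T R) (X : T -> R) :
  itg P X -> Ex P X = 0 -> (P [set w | X w = 0%R] < 1)%E ->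
  exists a, [/\ 0 < a, a <= 2 & 0 < Ex P (\1_[set w | a <= X w])].
Proof.
move=> iX EX0 X1; have mX := itg_meas iX; apply: contrapT => h.
have mk (a : R) : measurable [set w | a <= X w].
  by apply: measurable_le_set.
pose N := [set w | 0 < X w].
have mN : measurable N.
  by apply: measurable_lt_set.
have nN : P.-negligible N.
  apply: (@negligibleS _ _ _ P (\bigcup_k [set w | k.+1%:R^-1 <= X w])).
    move=> w /= w0; exists (Num.truncn (X w)^-1) => //=.
    rewrite invf_ple ?posrE//; apply: ltW.
    by have /andP[] := truncn_itv (ltW (eqbRL (invr_gt0 _) w0)).
  apply: negligible_bigcup => k; apply: negligible_null => //.
  have e : P [set w | k.+1%:R^-1 <= X w] = (Ex P (\1_[set w | k.+1%:R^-1 <= X w]))%:E.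
    by rewrite Ex_indic// fineK// fin_num_measure.
  apply/eqP; rewrite -measure_le0 [leLHS]e lee_fin leNgt; apply/negP => hk; apply: h; exists k.+1%:R^-1.
  by split=> //; rewrite (@le_trans _ _ 1)// ?ler1n// invf_le1 ?ler1n.
have N0 : P N = 0%E by apply: measure_negligible.
have i0 : (\int[P]_(x in setT `\` N) (X x)%:E = 0)%E.
  by rewrite -negligible_integral// ExE// EX0.
have mD : measurable (setT `\` N) by exact: measurableD.
have mX' : measurable_fun (setT `\` N) (EFin \o X).
  by apply: measurable_funS measurableT _ _ => //; exact/measurable_EFinP.
have nX : P.-negligible [set w | ~ (~ N w -> X w = 0)].
  have /ae_eq_integral_abs : (\int[P]_(x in setT `\` N) `|(EFin \o X) x| = 0)%E.
    rewrite (eq_integral (fun x => - (EFin \o X) x)%E); last first.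
      move=> w; rewrite in_setE => -[_ /negP]; rewrite -leNgt => w0.
      by rewrite /= ler0_norm.
    by rewrite integralN ?i0 ?oppe0//; apply: integrable_add_def => //;
      exact: (integrableS measurableT mD (@subsetT _ _) iX).
  move=> /(_ mD mX'); apply: negligibleS => w /= h1 h2; apply: h1 => wN.
  by have := h2 (conj I wN) => -[].
have nU := negligibleU nN nX.
have mE : measurable [set w | X w = 0].
  have -> : [set w | X w = 0] = [set: T] `&` X @^-1` [set 0] by rewrite setTI.
  exact: mX.
have e : P (~` [set w | X w = 0]) = 0%E.
  apply: measure_negligible; first exact: measurableC.
  apply: negligibleS nU => w /= w0; have [wN|wN] := pselect (N w); [by left|right].
  by move=> h1; apply: w0; exact: h1.
have e1 : P [set w | X w = 0%R] = 1%E.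
  have := probability_setC P mE; rewrite e -(@fineK _ (P [set w | X w = 0%R])) ?fin_num_measure//.
  by rewrite -EFinB => -[] /eqP; rewrite eq_sym subr_eq0 => /eqP <-.
by move: X1; rewrite e1 ltxx.
Qed.

(** The positive part is integrable, so the negative part is as well, since the
integral is not minus infinity. *)
Lemma itg_of_centered d (T : measurableType d) (R : realType) (P : probability T R) (X Y : T -> R) :
  measurable_fun [set: T] X -> itg P Y -> (forall w, Num.max (X w) 0 <= Y w) ->
  (\int[P]_w (X w)%:E = 0)%E -> itg P X /\ Ex P X = 0.
Proof.
move=> mX iY XY X0.
have mE : measurable_fun [set: T] (EFin \o X) by exact/measurable_EFinP.
have ip : itg P (fun w => Num.max (X w) 0).
  apply: itg_le iY _; first exact: measurable_maxr.
  by move=> w; rewrite ger0_norm// le_max lexx orbT.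
have pE : (\int[P]_w (EFin \o X)^\+ w = (Ex P (fun w => Num.max (X w) 0))%:E)%E.
  by rewrite -ExE//; apply: eq_integral => w _; rewrite funeposE /= EFin_max.
have nf : (\int[P]_w (EFin \o X)^\- w < +oo)%E.
  rewrite ltey; apply/eqP => h; move: X0; rewrite integralE.
  by rewrite [X in (X - _)%E]pE [X in (_ - X)%E]h.
have iX : itg P X.
  apply/integrableP; split=> //.
  rewrite (eq_integral (fun w => ((EFin \o X)^\+ w + (EFin \o X)^\- w)%E)); last first.
    by move=> w _; rewrite -[LHS]/((abse \o (EFin \o X)) w) fune_abse.
  rewrite ge0_integralD//; [|exact: measurable_funepos|exact: measurable_funeneg].
  by rewrite lte_add_pinfty// pE ltry.
by split=> //; rewrite /Ex /Rintegral X0.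
Qed.

Section compact_bound.
Variables (R : realType) (K : absFieldType R) (V : normedVectType K).

Lemma compact_bounded_norm (U : set V) : compact U -> exists r, forall x, U x -> vnorm x <= r.
Proof.
move=> /compact_near_coveringP cU.
have := cU nat \oo (fun n x => vnorm x <= n%:R) _.
case=> [x Ux|N _ hN]; last by exists N%:R => x Ux; exact: (hN N (leqnn N)).
exists ([set y | vnorm (x - y) < 1], [set n | vnorm x + 1 <= n%:R]).
  split=> /=.
    by rewrite -nbhs_ballE; exists 1 => //= y; rewrite ballEmdist.
  exists (Num.truncn (vnorm x + 1)).+1 => // n /= hn.
  have x0 : 0 <= vnorm x + 1 by rewrite addr_ge0 ?vnorm_ge0.
  have /andP[_ h] := truncn_itv x0; apply: (le_trans (ltW h)).
  by rewrite ler_nat.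
move=> [y n] /= [h1 h2]; apply: le_trans h2; apply: (@le_trans _ _ (vnorm (y - x) + vnorm x)).
  by apply: le_trans (vnormD _ _); rewrite subrK.
by rewrite addrC lerD2l vnormB ltW.
Qed.

End compact_bound.

Section main.
Variables (R : realType) (K : absFieldType R) (V : normedVectType K).
Variables (hK : local_field K) (mu : probability (asim V) R).
Hypothesis moment : (\int[mu]_g
      (logp (sim_ratio (lin g)) + logp (vnorm (trans g)))%:E < +oo)%E.
Hypothesis nondegenerate : ~ exists v : V, forall g, msupport mu g -> aact g v = v.
Hypothesis centered : (\int[mu]_g (ln (sim_ratio (lin g)))%:E = 0)%E.
Hypothesis nontrivial : (mu [set g | sim_ratio (lin g) = 1%R] < 1)%E.
Local Notation E := (Ex mu).

Let lr (g : asim V) : R := ln (sim_ratio (lin g)).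
Let bt (g : asim V) : R := logp (vnorm (trans g)).
Let Y (g : asim V) : R := 1 + bt g + `|lr g|.
Let q0 (g : asim V) : R := bt g - lr g.

Let mc : measurable_fun [set: asim V] (fun g => sim_ratio (lin g)).
Proof. exact: (measurable_sim_ratio nondegenerate). Qed.

Let mlr : measurable_fun [set: asim V] lr.
Proof. exact: measurableT_comp. Qed.

Let mlogp (f : asim V -> R) : measurable_fun [set: asim V] f ->
  measurable_fun [set: asim V] (fun g => logp (f g)).
Proof. by move=> mf; apply: measurable_maxr => //; exact: measurableT_comp. Qed.

Let mbt : measurable_fun [set: asim V] bt.
Proof. by apply: mlogp; exact: measurable_trans_norm. Qed.

Let bt0 g : 0 <= bt g. Proof. exact: logp_ge0. Qed.

Let isum : itg mu (fun g => logp (sim_ratio (lin g)) + bt g).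
Proof.
apply/integrableP; split.
  by apply/measurable_EFinP; apply: measurable_funD => //; exact: mlogp.
rewrite (eq_integral (fun g => (logp (sim_ratio (lin g)) + bt g)%:E)) => [//|g _].
by rewrite /= ger0_norm// addr_ge0// logp_ge0.
Qed.

Let lr_centered : itg mu lr /\ E lr = 0.
Proof.
apply: (itg_of_centered mlr isum) => // g.
by rewrite /lr /logp lerDl.
Qed.

Let ibt : itg mu bt.
Proof.
apply: itg_le isum _ => // g.
by rewrite ger0_norm// lerDr logp_ge0.
Qed.

Let iY : itg mu Y.
Proof.
have [il _] := lr_centered.
by apply: itgD; [apply: itgD; [exact: itg_cst|]|exact: itg_norm].
Qed.

Let YX g : 1 + `|lr g| <= Y g.
Proof. by rewrite /Y -addrA lerD2l lerDr. Qed.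

Let lr_eq0 g : (lr g == 0) = (sim_ratio (lin g) == 1).
Proof. by rewrite /lr ln_eq0// sim_ratio_gt0. Qed.

Let lr_nontrivial : (mu [set g | lr g = 0%R] < 1)%E.
Proof.
have -> : [set g | lr g = 0] = [set g | sim_ratio (lin g) = 1].
  by apply/seteqP; split=> g /= /eqP; rewrite ?lr_eq0 => h; apply/eqP; rewrite ?lr_eq0.
exact: nontrivial.
Qed.

Let contracting : (0 < mu [set g | (sim_ratio (lin g) < 1)%R])%E.
Proof.
have [il l0] := lr_centered.
have iN : itg mu (fun g => - lr g).
  by have := itgZ (-1) il; under eq_fun do rewrite mulN1r.
have N0 : E (fun g => - lr g) = 0.
  by rewrite (eq_Ex mu (g := fun g => -1 * lr g)) ?ExZ ?l0 ?mulr0// => g; rewrite mulN1r.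
have N1 : (mu [set g | (- lr g = 0)%R] < 1)%E.
  have -> : [set g | - lr g = 0] = [set g | lr g = 0].
    apply/seteqP; split=> g /=; last by move=> ->; rewrite oppr0.
    by move/eqP; rewrite oppr_eq0 => /eqP.
  exact: lr_nontrivial.
have [a [a0 _ ha]] := centered_positive_part iN N0 N1.
have m1 : measurable [set g : asim V | a <= - lr g].
  apply: measurable_le_set => //.
  exact: measurableT_comp.
have m2 : measurable [set g : asim V | sim_ratio (lin g) < 1].
  by apply: measurable_lt_set.
apply: (@lt_le_trans _ _ (mu [set g | a <= - lr g])).
  by rewrite -(@fineK _ (mu _)) ?fin_num_measure// lte_fin -Ex_indic.
apply: le_measure; rewrite ?inE// => g /= h.
have : expR (lr g) < 1 by rewrite -[ltRHS](expR0 R) ltr_expR; move: a0 h; lra.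
by rewrite /lr lnK// posrE sim_ratio_gt0.
Qed.

Variables (d : measure_display) (Omega : measurableType d) (P : probability Omega R).
Variable X : nat -> {mfun Omega >-> asim V}.
Hypotheses (indep : mutually_independent P X) (law : forall i : nat, has_law P (X i) mu).

Let walk n w (x : V) : V := aact (left_walk (fun i => X i w) n) x.
Definition log_ratio n w : R := \sum_(i < n) lr (X i w).

Let walkS n w x : walk n.+1 w x = aact (X n w) (walk n w x).
Proof. by rewrite /walk /= aactM. Qed.

Lemma walk_contraction n w x y :
  vnorm (walk n w x - walk n w y) = expR (log_ratio n w) * vnorm (x - y).
Proof.
elim: n => [|n IH].
  by rewrite /walk /= !aact1 /log_ratio big_ord0 expR0 mul1r.
rewrite !walkS vnorm_aactB IH mulrA /log_ratio big_ord_recr/= expRD [_ * expR _]mulrC /lr.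
by rewrite lnK// posrE sim_ratio_gt0.
Qed.

Let stepE (u : (vmeas V * R) * asim V) : vmeas V * R :=
  (aact u.2 (u.1.1 : V) : vmeas V, u.1.2 + lr u.2).

Let mstepE : measurable_fun [set: (vmeas V * R) * asim V] stepE.
Proof.
apply: measurable_fun_pair.
  apply: (@measurableT_comp _ _ _ _ _ _ (fun u : vmeas V * asim V => aact u.2 (u.1 : V) : vmeas V) _
     (fun u : (vmeas V * R) * asim V => (u.1.1, u.2))); first exact: measurable_act hK.
  apply: measurable_fun_pair; last exact: measurable_snd.
  by apply: (measurableT_comp (f := fst)) => //; exact: measurable_fst.
apply: measurable_funD.
  by apply: (measurableT_comp (f := snd)) => //; exact: measurable_fst.
by apply: (measurableT_comp mlr); exact: measurable_snd.
Qed.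

Let chainE (x : V) s n w : chain X stepE ((x : vmeas V), s) n w = ((walk n w x : vmeas V), s + log_ratio n w).
Proof.
elim: n => [|n IH] /=.
  by rewrite /walk /= aact1 /log_ratio big_ord0 addr0.
by rewrite IH /stepE/= walkS /log_ratio big_ord_recr/= addrA.
Qed.

(** The bound given by the barrier holds for each starting value [s0] of the second
coordinate, while the event does not depend on it. *)
Lemma visits_negligible (r : R) (x : V) (M : R) :
  P.-negligible (lim_sup_set (fun n => [set w | vnorm (walk n w x) <= r /\ - M <= log_ratio n w])).
Proof.
have [il l0] := lr_centered.
have [a [a0 a2 ha]] := centered_positive_part il l0 lr_nontrivial.
have mq : measurable_fun [set: asim V] q0 by exact: measurable_funB.
have [K0 hK0] := barrier_exists il iY l0 mq YX a0 a2 ha (lexx _).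
pose k := Num.max K0 (Num.max (ln 2) (ln (Num.max r 1))).
have kK0 : K0 <= k by rewrite le_max lexx.
have k2 : ln 2 <= k by rewrite !le_max lexx orbT.
have rk : r <= expR k.
  apply: (@le_trans _ _ (Num.max r 1)); first by rewrite le_max lexx.
  by rewrite -[leLHS]lnK ?posrE ?lt_max ?ltr01 ?orbT// ler_expR !le_max lexx !orbT.
have [rho [p [rho0 p0 hdisp]]] := displacement nondegenerate contracting.
have [NN [eta [l [NN0 eta0 ml [l01 lout] lin_]]]] :=
  exit_function hK a0 ha rho0 p0 (expR_gt0 k) mc (lexx _) hdisp.
have [Phi [mPhi Phi01 Phi_vanish Phi_far Phi_ball]] := hK0 k kK0 NN eta NN0 eta0.
pose hgt (z : V) := height k (vnorm z).
have mhgt : measurable_fun [set: vmeas V] (hgt : vmeas V -> R).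
  apply: measurable_funB => //; apply: measurableT_comp => //; apply: measurable_maxr => //.
  have h := @measurable_vnorm R K V 0.
  by apply: eq_measurable_fun h => z _; rewrite subr0.
have l0' z : 0 <= l z by case/andP: (l01 z).
pose PhiE (u : vmeas V * R) := Phi (hgt u.1) u.2 (l u.1).
have mPhiE : measurable_fun [set: vmeas V * R] PhiE.
  apply: (mPhi _ (vmeas V * R)%type (fun u => hgt u.1) snd (fun u => l u.1)) => //.
  - by move=> u; exact: height_ge0.
  - by apply: (measurableT_comp mhgt); exact: measurable_fst.
  - by apply: (measurableT_comp ml); exact: measurable_fst.
have PhiE01 u : 0 <= PhiE u <= 1 by apply: Phi01 => //; exact: height_ge0.
have mact (f : V -> R) z : measurable_fun [set: vmeas V] (f : vmeas V -> R) ->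
    measurable_fun [set: asim V] (fun g => f (aact g z)).
  move=> mf; apply: (measurableT_comp (f := (f : vmeas V -> R))) => //.
  exact: (measurable_fun_pair2 (z : vmeas V) (measurable_act hK)).
pose A s0 : set (vmeas V * R) := [set u | vnorm (u.1 : V) <= expR k /\ s0 - M <= u.2].
have mA s0 : measurable (A s0).
  have -> : A s0 = [set u : vmeas V * R | vnorm (u.1 : V) <= expR k] `&` [set u | s0 - M <= u.2] by [].
  apply: measurableI; apply: measurable_le_set => //.
  apply: (measurableT_comp (f := fun z : vmeas V => vnorm (z : V))); last exact: measurable_fst.
  have h := @measurable_vnorm R K V 0.
  by apply: eq_measurable_fun h => z _; rewrite subr0.
pose F n := [set w | vnorm (walk n w x) <= expR k /\ - M <= log_ratio n w].
have FE s0 : (fun n => chain X stepE ((x : vmeas V), s0) n @^-1` A s0) = F.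
  apply/funext => n; apply/seteqP; split=> w.
    rewrite /preimage/= chainE => -[/= h1 h2]; split=> //.
    by move: h2; rewrite lerD2l.
  by move=> [h1 h2]; rewrite /preimage/= chainE; split=> //=; rewrite lerD2l.
have mF n : measurable (F n).
  have h := measurable_chain X ((x : vmeas V), (0 : R)) mstepE n measurableT (mA 0).
  by rewrite setTI in h; rewrite -(FE 0); exact: h.
have key s0 : (P (lim_sup_set F) <= (PhiE ((x : vmeas V), s0))%:E)%E.
  have [eps eps0 heps] := Phi_ball (M - s0).
  rewrite -(FE s0); apply: (transient indep law _ mstepE mPhiE PhiE01 (mA s0) eps0).
  move=> [z s] Phi1.
  have mZ : measurable_fun [set: asim V] (fun g => hgt (aact g z)) by exact: mact.
  have mL : measurable_fun [set: asim V] (fun g => l (aact g z)) by exact: mact.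
  have Z0 g : 0 <= hgt (aact g z) by exact: height_ge0.
  have [zr|zr] := leP (vnorm z) (expR k).
    have hz : hgt z = 0 by exact: height_in.
    have := heps s (l z) (fun g => hgt (aact g z)) (fun g => l (aact g z)) (l0' z).
    rewrite /PhiE /= hz in Phi1 * => h; apply: le_trans (h Phi1 mZ mL Z0 (fun g => l01 _) (lin_ z zr)) _.
    rewrite lerD2l lerN2 indicE opprB.
    case: (boolP (_ \in _)) => [/set_mem[/= _ hs]|_]; first by rewrite hs mulr1.
    by rewrite mulr0; case: ifP => // _; exact: ltW.
  have hz : 0 < hgt z.
    rewrite /hgt height_out; last exact: ltW.
    rewrite subr_gt0 -[ltLHS]expRK ltr_ln ?posrE ?expR_gt0//.
    exact: lt_trans (expR_gt0 _) zr.
  have -> : \1_(A s0) (z, s) = 0 :> R.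
    by rewrite indicE memNset//= => -[/= h _]; move: zr; rewrite ltNge h.
  have lz : l z = 0 by exact: lout.
  rewrite /PhiE /= lz mulr0 subr0 in Phi1 *.
  apply: (Phi_far (hgt z) s (fun g => hgt (aact g z)) (fun g => l (aact g z))) => //.
    move=> g; apply: (@one_step_drop R k (vnorm z) (vnorm (aact g z)) (sim_ratio (lin g)) (vnorm (trans g))) => //.
    - exact: sim_ratio_gt0.
    - exact: vnorm_ge0.
    - by have [] := vnorm_aact_ge g z.
    - by have [] := vnorm_aact_ge g z.
  move=> g lg.
  have lg' : vnorm (aact g z) <= expR k.
    by rewrite leNgt; apply/negP => /lout e; move: lg; rewrite e ltxx.
  apply: (@one_step_enter R k (vnorm z) (vnorm (aact g z)) (sim_ratio (lin g)) (vnorm (trans g))) => //.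
  - exact: sim_ratio_gt0.
  - exact: vnorm_ge0.
  - by have [] := vnorm_aact_ge g z.
  - by have [] := vnorm_aact_ge g z.
have mlim : measurable (lim_sup_set F).
  by apply: bigcapT_measurable => n; apply: bigcup_measurable => j _; exact: mF.
have lim0 : P (lim_sup_set F) = 0%E.
  apply/eqP; rewrite -measure_le0; apply/lee_addgt0Pr => e e0.
  have [s0 hs0] := Phi_vanish (hgt x) (l x) e (height_ge0 _ _) (l0' x) e0.
  by rewrite add0e; apply: (le_trans (key s0)); rewrite lee_fin; exact: hs0.
apply: negligibleS (negligible_null mlim lim0) => w hw n _.
by have [j nj [h1 h2]] := hw n I; exists j => //; split=> //; exact: le_trans rk.
Qed.

End main.

Theorem theoremA2 (R : realType) (K : absFieldType R) (hK : local_field K)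
  (V : normedVectType K) (mu : probability (asim V) R)
  (moment : (\int[mu]_g
      (logp (sim_ratio (lin g)) + logp (vnorm (trans g)))%:E < +oo)%E)
  (nondegenerate : ~ exists v : V, forall g, msupport mu g -> aact g v = v)
  (centered : (\int[mu]_g (ln (sim_ratio (lin g)))%:E = 0)%E)
  (nontrivial : (mu [set g | sim_ratio (lin g) = 1%R] < 1)%E)
  (d : measure_display) (Omega : measurableType d) (P : probability Omega R)
  (X : nat -> {mfun Omega >-> asim V})
  (indep : mutually_independent P X)
  (law : forall i : nat, has_law P (X i) mu)
  (U : set V) (compactU : compact U) (x y : V) :
  {ae P, forall w : Omega,
    let L := left_walk (fun i => X i w) in
    vnorm (aact (L n) x - aact (L n) y) * \1_U (aact (L n) x)
      @[n --> \oo] --> (0 : R)}.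
Proof.
have [r hr] := compact_bounded_norm compactU.
have vn (M : nat) := visits_negligible hK moment nondegenerate centered nontrivial
  indep law r x M%:R.
apply: negligibleS (negligible_bigcup vn) => w /= hw; apply: contrapT => hM; apply: hw.
apply/cvgrPdist_lt => e e0.
have xy0 : 0 <= vnorm (x - y) := vnorm_ge0 _.
(* [M] is such that a contraction by [expR (- M)] brings the two points at distance less than [e] *)
pose M := (Num.truncn (vnorm (x - y) / e)).+1.
have hMe : expR (- M%:R) * vnorm (x - y) < e.
  have /andP[_ h] := truncn_itv (divr_ge0 xy0 (ltW e0)).
  rewrite expRN mulrC ltr_pdivrMr ?expR_gt0//.
  rewrite ltr_pdivrMr// in h; apply: (lt_le_trans h); rewrite mulrC ler_pM2l//.
  by apply: le_trans (expR_ge1Dx _); rewrite lerDr.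
have [N hN] : exists N, forall n, (N <= n)%N ->
    ~ (vnorm (aact (left_walk (fun i => X i w) n) x) <= r /\ - M%:R <= log_ratio X n w).
  apply: contrapT => h; apply: hM; exists M => // n _; apply: contrapT => h2.
  by apply: h; exists n => j nj hj; apply: h2; exists j.
exists N => // n /= Nn; rewrite sub0r normrN.
have [inU|notU] := pselect (U (aact (left_walk (fun i => X i w) n) x)); last first.
  by rewrite indicE memNset// mulr0 normr0.
rewrite indicE mem_set// mulr1 ger0_norm ?vnorm_ge0//.
rewrite (walk_contraction X n w x y); apply: le_lt_trans hMe.
rewrite ler_wpM2r// ler_expR leNgt; apply/negP => h; apply: (hN n Nn).
by split; [exact: hr|exact: ltW].
Qed.
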